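(* Let $d\ge2$ and $s\in\{1,\dots,d-1\}$. Let $$\widehat\chi_s=\{\{i,i+1,\dots,i+d-1\}:0\le i\le d,\ i\ne d-s\}$$ be the configuration describing the dual dented pentagram map on curves, and let $\chi$ be the configuration obtained from $\widehat\chi_s$ by adding $\delta=1-d-\frac{s}{d}$ to every parameter. Then $\chi$ is centralized, i.e. for every smooth nondegenerate curve with monodromy with normalized lift $\Gamma$, the normalized lift $\Gamma_\varepsilon$ of $T^\chi_\varepsilon(\gamma)$ has an expansion $\Gamma_\varepsilon=\Gamma+\varepsilon^2G_2\Gamma+O(\varepsilon^3)$ with vanishing linear term. Hence the continuous limit $\frac{d}{dt}\Gamma=G_2\Gamma$ of the shifted dual dented map is the $(2,d+1)$-KdV equation: $G_2=cQ_2$ for a nonzero constant $c$, where $Q_2=\partial^2+\frac{2}{d+1}u_{d-1}$, so that (after constant rescaling of time) $\frac{d}{dt}L=[Q_2,L]$ for $L=\partial^{d+1}+u_{d-1}\partial^{d-1}+\dots+u_0$.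
   Context: Write $\partial=\frac{d}{dx}$. A curve $\gamma:\mathbb{R}\to\mathbb{RP}^d$ has monodromy $M\in\mathrm{PGL}(d+1,\mathbb{R})$ if $\gamma(x+2\pi)=M\cdot\gamma(x)$ for all $x$; it is nondegenerate if $\gamma'(x),\dots,\gamma^{(d)}(x)$ are linearly independent for every $x$ in some (hence any) affine chart. Its normalized lift is a smooth lift $\Gamma$ to $\mathbb{R}^{d+1}$ with $\det(\Gamma,\Gamma',\dots,\Gamma^{(d)})\equiv1$ (which exists, after composing $\gamma$ with a projective transformation if necessary); it satisfies $L\Gamma=0$ with $L=\partial^{d+1}+u_{d-1}\partial^{d-1}+\dots+u_0$, $u_i$ smooth and $2\pi$-periodic. For a configuration $\chi=\{\{p_{1,0},\dots,p_{1,d-1}\},\dots,\{p_{d,0},\dots,p_{d,d-1}\}\}$ of $d$ sets of $d$ distinct reals, and small $\varepsilon>0$, let $P_\varepsilon^i(x)$ be the hyperplane through $\gamma(x+p_{i,0}\varepsilon),\dots,\gamma(x+p_{i,d-1}\varepsilon)$, and $T_\varepsilon^\chi(\gamma)(x)=\bigcap_{i=1}^dP_\varepsilon^i(x)$ (the $\chi$-pentagram map). $\Gamma_\varepsilon$ is the lift of the curve $T_\varepsilon^\chi(\gamma)$ with $\det(\Gamma_\varepsilon,\dots,\Gamma_\varepsilon^{(d)})\equiv1$ and $\Gamma_\varepsilon\to\Gamma$ as $\varepsilon\to0$; it is expanded as $\Gamma_\varepsilon=\Gamma+\varepsilon G_1\Gamma+\varepsilon^2G_2\Gamma+\dots$ with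 $G_i=\sum_{j=0}^d\alpha_{i,j}(x)\partial^j$. $\chi$ is centralized if $G_1=0$. Shifting all parameters of $\widehat\chi_s$ by $\delta$ is the same as considering the curve $x\mapsto T_\varepsilon^{\widehat\chi_s}(\gamma)(x+\delta\varepsilon)$. The dual dented pentagram map takes a vertex $v_i$ of a generic twisted polygon to $\bigcap_{0\le k\le d,\,k\ne d-s}P_{i+k}$, where $P_i$ is the hyperplane through the $d$ consecutive vertices $v_i,\dots,v_{i+d-1}$. The $(2,d+1)$-KdV equation is $\frac{d}{dt}L=[Q_2,L]$; it is a known fact that, if $L\Gamma=0$, the evolution $\frac{d}{dt}\Gamma=Q_2\Gamma$ implies it. *)

(* Defs.v *)
From HB Require Import structures.
From mathcomp Require Import all_boot all_order all_algebra.
From mathcomp Require Import all_classical all_reals all_analysis.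

Set Implicit Arguments.
Unset Strict Implicit.
Unset Printing Implicit Defensive.

Import Order.TTheory GRing.Theory Num.Theory.
Import numFieldNormedType.Exports.

Local Open Scope classical_set_scope.
Local Open Scope ring_scope.

(* In ring_scope these would be the derivatives of polynomials. *)
Local Notation "f ^` ()" := (derive1 f) : ring_scope.
Local Notation "f ^` ( n )" := (derive1n n f) : ring_scope.

(** ** Smooth functions and differential operators in one variable *)

Definition smooth (R : realType) (V : normedModType R) (f : R -> V) : Prop :=
  forall n x, derivable f^`(n) x 1.

(* The operator [a_0 + a_1 D + ... + a_(n-1) D^(n-1)], hence of order < n,
   acting on scalar (V = R^o) or vector valued functions. *)
Definition diffop (R : realType) (V : normedModType R) (n : nat)
    (a : nat -> R -> R) (f : R -> V) : R -> V :=
  fun x => \sum_(j < n) a j x *: f^`(j) x.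

(* L = D^(d+1) + u_(d-1) D^(d-1) + ... + u_0 *)
Definition Lop (R : realType) (V : normedModType R) (d : nat)
    (u : nat -> R -> R) (f : R -> V) : R -> V :=
  fun x => f^`(d.+1) x + diffop d u f x.

(* Q_2 = D^2 + 2/(d+1) u_(d-1) *)
Definition Q2op (R : realType) (V : normedModType R) (d : nat)
    (u : nat -> R -> R) (f : R -> V) : R -> V :=
  fun x => f^`(2) x + (2%:R / d.+1%:R * u d.-1 x) *: f x.

(** ** Curves in RP^d and their lifts *)

(* RP^d: lines through the origin of R^(d+1), whose elements are row vectors. *)
Record projpoint (R : realType) (d : nat) := ProjPoint {
  line :> {vspace 'rV[R]_d.+1};
  dim_line : \dim line = 1%N }.

(* The action of (the class of) an invertible M on subspaces. *)
Definition projact (R : realType) (d : nat) (M : 'M[R]_d.+1)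
    (U : {vspace 'rV[R]_d.+1}) : {vspace 'rV[R]_d.+1} :=
  (linfun (mulmxr M) @: U)%VS.

Definition has_monodromy (R : realType) (d : nat) (gam : R -> projpoint R d)
    (M : 'M[R]_d.+1) : Prop :=
  M \in unitmx /\ forall x, line (gam (x + 2 * pi)) = projact M (gam x).

(* The standard affine chart {v_j <> 0} of RP^d, with values v_k / v_j, k <> j;
   vpick p is a nonzero vector of p. *)
Definition in_chart (R : realType) (d : nat) (j : 'I_d.+1)
    (p : projpoint R d) : bool := vpick p 0 j != 0.

Definition chart (R : realType) (d : nat) (j : 'I_d.+1)
    (p : projpoint R d) : 'rV[R]_d :=
  col' j ((vpick p 0 j)^-1 *: vpick p).

Definition smooth_curve (R : realType) (d : nat)
    (gam : R -> projpoint R d) : Prop :=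
  forall x : R, exists j : 'I_d.+1,
    (\forall y \near x, in_chart j (gam y)) /\
    (forall n, \forall y \near x, derivable (chart j \o gam)^`(n) y 1).

Definition nondegenerate (R : realType) (d : nat)
    (gam : R -> projpoint R d) : Prop :=
  forall x, exists j : 'I_d.+1,
    in_chart j (gam x) /\
    row_free (\matrix_(k < d) (chart j \o gam)^`(k.+1) x).

Definition wronskian (R : realType) (d : nat) (G : R -> 'rV[R]_d.+1) (x : R) : R :=
  \det (\matrix_(k < d.+1) G^`(k) x).

Definition normalized_lift (R : realType) (d : nat)
    (c : R -> {vspace 'rV[R]_d.+1}) (G : R -> 'rV[R]_d.+1) : Prop :=
  [/\ smooth G, forall x, <[G x]>%VS = c x & forall x, wronskian G x = 1].

(* A smooth nondegenerate curve with monodromy and a normalized lift of it. *)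
Definition curve_with_lift (R : realType) (d : nat)
    (gam : R -> projpoint R d) (Gam : R -> 'rV[R]_d.+1) : Prop :=
  [/\ smooth_curve gam, nondegenerate gam, exists M, has_monodromy gam M
    & normalized_lift (fun x => line (gam x)) Gam].

(* L Gamma = 0, where L has smooth 2pi-periodic coefficients u_0, ..., u_(d-1). *)
Definition lax_coefs (R : realType) (d : nat) (Gam : R -> 'rV[R]_d.+1)
    (u : nat -> R -> R) : Prop :=
  [/\ forall i, (i < d)%N -> smooth (u i : R -> R^o),
      forall i x, (i < d)%N -> u i (x + 2 * pi) = u i x
    & forall x, Lop d u Gam x = 0].

(** ** Pentagram maps *)

Record config (R : realType) (d : nat) := Config {
  param :> 'I_d -> 'I_d -> R;
  param_inj : forall i, injective (param i) }.

Lemma shift_param_inj (R : realType) (d : nat) (chi : config R d) (delta : R) i :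
  injective (fun j => chi i j + delta).
Proof. by move=> j k /addIr /param_inj. Qed.

Definition shift_config (R : realType) (d : nat) (chi : config R d) (delta : R) :
  config R d := Config (@shift_param_inj R d chi delta).

(* i |-> bump (d - s) i enumerates {0, ..., d} minus {d - s}, for i < d. *)
Definition dual_dented_param (R : realType) (d s : nat) (i j : 'I_d) : R :=
  (bump (d - s) i + j)%:R.

Lemma dual_dented_param_inj (R : realType) (d s : nat) i :
  injective (@dual_dented_param R d s i).
Proof. by move=> j k /eqP; rewrite eqr_nat eqn_add2l => /eqP /val_inj. Qed.

Definition dual_dented (R : realType) (d s : nat) : config R d :=
  Config (@dual_dented_param_inj R d s).

(* The hyperplanes are given as subspaces of R^(d+1). *)
Definition hyperplane (R : realType) (d : nat) (chi : config R d)
    (gam : R -> projpoint R d) (eps : R) (i : 'I_d) (x : R) :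
    {vspace 'rV[R]_d.+1} :=
  (\sum_(j < d) line (gam (x + chi i j * eps)%R))%VS.

Definition pentagram (R : realType) (d : nat) (chi : config R d)
    (gam : R -> projpoint R d) (eps : R) (x : R) : {vspace 'rV[R]_d.+1} :=
  (\bigcap_(i < d) hyperplane chi gam eps i x)%VS.

(* For small eps > 0 the d points spanning each hyperplane are independent, the
   d hyperplanes meet in a single point of RP^d (the span of the nonzero vector
   Game eps x), and Game eps is the normalized lift of the resulting curve that
   tends to Gam. *)
Definition pentagram_lift (R : realType) (d : nat) (chi : config R d)
    (gam : R -> projpoint R d) (Gam : R -> 'rV[R]_d.+1)
    (Game : R -> R -> 'rV[R]_d.+1) : Prop :=
  (\forall eps \near 0^'+,
     (forall i x, \dim (hyperplane chi gam eps i x) = d) /\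
     normalized_lift (pentagram chi gam eps) (Game eps)) /\
  (forall x, Game eps x @[eps --> 0^'+] --> Gam x).

(* Game = Gam + eps G_1 Gam + eps^2 G_2 Gam + O(eps^3), locally uniformly in x,
   where G_1, G_2 are the operators of order <= d with coefficients a1, a2. *)
Definition expansion2 (R : realType) (d : nat) (Gam : R -> 'rV[R]_d.+1)
    (Game : R -> R -> 'rV[R]_d.+1) (a1 a2 : nat -> R -> R) : Prop :=
  forall A : R, exists C : R, \forall eps \near 0^'+, forall x, `|x| <= A ->
    `|Game eps x - (Gam x + eps *: diffop d.+1 a1 Gam x
                    + eps ^+ 2 *: diffop d.+1 a2 Gam x)| <= C * eps ^+ 3.

(* Game is determined by gam, Gam for each small eps > 0 separately, so it is
   both required to exist and quantified universally. *)
Definition has_expansion (R : realType) (d : nat) (chi : config R d)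
    (gam : R -> projpoint R d) (Gam : R -> 'rV[R]_d.+1)
    (a1 a2 : nat -> R -> R) : Prop :=
  (exists Game, pentagram_lift chi gam Gam Game) /\
  (forall Game, pentagram_lift chi gam Gam Game -> expansion2 Gam Game a1 a2).

Definition centralized (R : realType) (d : nat) (chi : config R d) : Prop :=
  forall gam Gam, curve_with_lift gam Gam ->
    exists a2, has_expansion chi gam Gam (fun _ _ => 0) a2.

(** ** Evolutions *)

(* Iterated partial derivatives; true stands for d/dt, false for d/dx. *)
Fixpoint partials (R : realType) (V : normedModType R) (w : seq bool)
    (F : R -> R -> V) : R -> R -> V :=
  match w with
  | [::] => F
  | true :: w' => fun t x => (fun t' => partials w' F t' x)^`() t
  | false :: w' => fun t x => (partials w' F t)^`() x
  end.

(* C^oo on I x R: all iterated partial derivatives exist and are continuous. *)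
Definition smooth2 (R : realType) (V : normedModType R) (I : set R)
    (F : R -> R -> V) : Prop :=
  forall w t x, I t ->
    [/\ derivable (fun t' => partials w F t' x) t 1,
        derivable (partials w F t) x 1
      & {for (t, x), continuous (fun z : R * R => partials w F z.1 z.2)}].

(* The evolution d/dt Gamma = G_2 Gamma for t in I, where u t i is the
   coefficient u_i of the operator L of the curve at time t, and where G_2 is
   the eps^2 term of the chi-pentagram map at the curve at time t. *)
Definition continuous_limit (R : realType) (d : nat) (chi : config R d)
    (I : set R) (gam : R -> R -> projpoint R d) (Gam : R -> R -> 'rV[R]_d.+1)
    (u : R -> nat -> R -> R) : Prop :=
  smooth2 I Gam /\
  forall t, I t ->
    [/\ curve_with_lift (gam t) (Gam t), lax_coefs (Gam t) (u t)
      & exists2 a2, has_expansion chi (gam t) (Gam t) (fun _ _ => 0) a2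
        & forall x, (fun t' => Gam t' x)^`() t = diffop d.+1 a2 (Gam t) x].

(* d/dt L = [Q_2, L], as an identity of operators on smooth functions; d/dt L
   has coefficients d/dt u_i, i < d. *)
Definition kdv (R : realType) (d : nat) (I : set R)
    (u : R -> nat -> R -> R) : Prop :=
  forall t, I t ->
    (forall i x, (i < d)%N -> derivable (fun t' => u t' i x) t 1) /\
    (forall f : R -> R^o, smooth f -> forall x,
       diffop d (fun i y => (fun t' => u t' i y)^`() t) f x =
       Q2op d (u t) (Lop d (u t) f) x - Lop d (u t) (Q2op d (u t) f) x).

(* Main.v *)
(* Put v_r = Gamma(x + (r + delta) eps). The hyperplanes P_i with i < d - s
   contain the points v_(d-s-1), ..., v_(d-1), and those with i > d - s contain
   v_d, ..., v_(2d-s): together these are d + 2 consecutive points of R^(d+1),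
   and their linear relation sum_m a_m v_(d-s-1+m) = 0 gives the vertex of the
   image curve as V = sum_(m <= s) a_m v_(d-s-1+m). Solving for the (d+1)-st
   difference of Gamma in the frame of the lower differences, and using that
   D^(d+1) Gamma has no D^d Gamma component, the a_m are proportional to
   (-1)^m C(d+1, m) up to O(eps^2). Hence V is proportional to
   Gamma + eps^2 c Gamma'' + O(eps^3): the first moment of these coefficients
   vanishes by the choice of delta, and c is half their second moment. The
   normalization by the Wronskian then adds eps^2 2c/(d+1) u_(d-1) Gamma.
   All estimates are locally uniform in x together with all x-derivatives;
   what is needed for every x at once (independence of consecutive points,
   positivity of the Wronskian of V) follows from the monodromy, because
   determinants are periodic.
   For the KdV equation, differentiating L Gamma = 0 in t gives
   L_t Gamma = c [Q_2, L] Gamma, and both sides are operators of order <= d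
   applied to d + 1 independent functions. *)
From HB Require Import structures.
Require Import Defs.
From mathcomp Require Import all_boot all_order all_fingroup all_algebra.
From mathcomp Require Import all_classical all_reals all_analysis.
From mathcomp Require Import ring lra zify.

Set Implicit Arguments.
Unset Strict Implicit.
Unset Printing Implicit Defensive.

Import Order.TTheory GRing.Theory Num.Theory.
Import numFieldNormedType.Exports.

Local Open Scope classical_set_scope.
Local Open Scope ring_scope.

(* In ring_scope these would be the derivatives of polynomials. *)
Local Notation "f ^` ()" := (derive1 f) : ring_scope.
Local Notation "f ^` ( n )" := (derive1n n f) : ring_scope.

(** The normalization uses the Wronskian of the vertex curve, hence d derivatives in x, and a merely
    pointwise O(eps^3) would not pass through it. The class [bigO] is therefore closed under
    x-differentiation, and Taylor remainders for shifts proportional to eps are shown to stay in it.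
    Adjugates replace inverses, so that no denominator has to be estimated before the final (d+1)-st
    root is taken. In V = Y (Gamma + eps^2 c Gamma'') + O(eps^3) the scalar factor Y is known only
    as 1 + O(eps). This is enough: Y enters the Wronskian as Y^(d+1) and is divided out again.
    Likewise the a_m are needed only modulo eps^2, because Taylor terms beyond the constant one
    carry a further factor eps. When d + 1 is even, the Wronskian leaves the sign of a lift open;
    the limit eps -> 0 decides it. The statement quantifies over all pentagram lifts and all
    coefficients of G_2, so the expansion is proved for an arbitrary lift, and G_2 is shown to be
    determined by it. *)

(** * Smooth functions of one variable *)

(* Locked copies of [derive1] and [derivable] for scalar functions: failing
   unification problems would otherwise unfold them down to filters. *)
HB.lock Definition dx (R : realType) (f : R -> R) : R -> R := derive1 f.
HB.lock Definition dfun (R : realType) (f : R -> R) : Prop :=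
  forall x, derivable f x 1.

Section Smooth.
Variable R : realType.
Implicit Types (f g : R -> R) (n : nat).

(** The recursion peels off the innermost derivative, so that closure under an operation follows by
    induction on [n] for all functions at once, as soon as the derivative is expressed by operations
    of the same kind. *)
Fixpoint nderivable n (f : R -> R) : Prop :=
  if n is m.+1 then dfun f /\ nderivable m (dx f) else True.

Inductive smth f : Prop := Smth of forall n, nderivable n f.

Definition dxn n f := iter n (@dx R) f.

Lemma dxE f : dx f = derive1 f. Proof. by rewrite dx.unlock. Qed.

Lemma dfunP f : dfun f <-> forall x, derivable f x 1.
Proof. by rewrite dfun.unlock. Qed.

Lemma dxnS n f : dxn n.+1 f = dx (dxn n f). Proof. by []. Qed.
Lemma dxSn n f : dxn n.+1 f = dxn n (dx f). Proof. exact: iterSr. Qed.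

Lemma dxnE n f : dxn n f = derive1n n f.
Proof. by elim: n => // n IH; rewrite dxnS IH dxE derive1nS. Qed.

Lemma smthP f : @smooth R R^o f <-> smth f.
Proof.
split=> [sf|[nf] n x].
  constructor=> n; elim: n f sf => //= n IH f sf; split.
    by apply/dfunP => x; exact: (sf 0%N).
  by apply: IH => k x; rewrite dxE -derive1Sn; exact: sf.
have := nf n.+1; elim: n f {nf} => [|n IH] f [df nf].
  by move/dfunP: df; exact.
by rewrite derive1Sn -dxE; apply: IH.
Qed.

Lemma nderivableW n f : nderivable n.+1 f -> nderivable n f.
Proof. by elim: n f => //= n IH f [df /IH]. Qed.

Lemma dfun_is f (df : R -> R) :
  (forall x : R, is_derive x (1 : R) f (df x)) -> dfun f /\ dx f = df.
Proof.
move=> D; split.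
  by apply/dfunP => x; apply: (@ex_derive _ _ _ _ _ _ _ (D x)).
by apply/funext => x; rewrite dxE derive1E (@derive_val _ _ _ _ _ _ _ (D x)).
Qed.

Lemma dfun_derive f (x : R) : dfun f -> is_derive x (1 : R) f (dx f x).
Proof. by move=> /dfunP df; rewrite dxE derive1E; apply/derivableP. Qed.

Lemma dfun_cst (a : R) : dfun (fun=> a) /\ dx (fun=> a) = (fun=> 0).
Proof. by apply: dfun_is => x; exact: is_derive_cst. Qed.

Lemma dfunD f g : dfun f -> dfun g -> dfun (fun x => f x + g x) /\
  dx (fun x => f x + g x) = (fun x => dx f x + dx g x).
Proof.
move=> df dg; apply: dfun_is => x.
by apply: is_deriveD; apply: dfun_derive.
Qed.

Lemma dfunM f g : dfun f -> dfun g -> dfun (fun x => f x * g x) /\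
  dx (fun x => f x * g x) = (fun x => dx f x * g x + f x * dx g x).
Proof.
move=> df dg; apply: dfun_is => x; apply: is_derive_eq.
  by apply: is_deriveM; apply: dfun_derive.
by rewrite /GRing.scale /= addrC [g x * _]mulrC.
Qed.

Lemma dfun_shift f h : dfun f -> dfun (fun x => f (x + h)) /\
  dx (fun x => f (x + h)) = (fun x => dx f (x + h)).
Proof.
move=> df; apply: dfun_is => x; apply: is_derive_eq.
  apply: (@is_derive1_comp R f (fun x => x + h)).
  exact: dfun_derive.
by rewrite addr0 mulr1.
Qed.

Lemma dfun_powR f (a : R) : (forall x, 0 < f x) -> dfun f ->
  dfun (fun x => f x `^ a) /\
  dx (fun x => f x `^ a) = (fun x => a * f x `^ (a - 1) * dx f x).
Proof.
move=> f0 df; apply: dfun_is => x; apply: (@is_derive1_comp R (fun y => y `^ a) f).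
  exact: is_derive1_powR.
exact: dfun_derive.
Qed.

Lemma nderivable_cst n (a : R) : nderivable n (fun=> a).
Proof. by elim: n a => //= n IH a; have [? ->] := dfun_cst a. Qed.

Lemma nderivableD n f g : nderivable n f -> nderivable n g ->
  nderivable n (fun x => f x + g x).
Proof.
elim: n f g => //= n IH f g [df nf] [dg ng].
by have [? ->] := dfunD df dg; split=> //; apply: IH.
Qed.

Lemma nderivableM n f g : nderivable n f -> nderivable n g ->
  nderivable n (fun x => f x * g x).
Proof.
elim: n f g => //= n IH f g [df nf] [dg ng].
have [? ->] := dfunM df dg; split=> //; apply: nderivableD; apply: IH => //.
  exact: nderivableW.
exact: nderivableW.
Qed.

Lemma nderivable_shift n f h : nderivable n f ->
  nderivable n (fun x => f (x + h)).
Proof.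
elim: n f => //= n IH f [df nf].
by have [? ->] := dfun_shift h df; split=> //; apply: IH.
Qed.

(** The exponent is general in the induction because differentiation lowers it by one. Inverses and
    the normalizing (d+1)-st root are both instances. *)
Lemma nderivable_powR n f (a : R) : (forall x, 0 < f x) -> nderivable n f ->
  nderivable n (fun x => f x `^ a).
Proof.
move=> f0; elim: n a => //= n IH a [df nf].
have [? ->] := dfun_powR a f0 df; split=> //.
apply: nderivableM => //; apply: nderivableM; first exact: nderivable_cst.
by apply: IH; apply: nderivableW.
Qed.

Lemma smth_dfun f : smth f -> dfun f.
Proof. by case=> /(_ 1%N) []. Qed.

Lemma smth_dx f : smth f -> smth (dx f).
Proof. by case=> nf; constructor=> n; have [] := nf n.+1. Qed.

Lemma smth_dxn n f : smth f -> smth (dxn n f).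
Proof. by move=> sf; elim: n => // n IH; apply: smth_dx. Qed.

Lemma smth_cst (a : R) : smth (fun=> a).
Proof. by constructor=> n; apply: nderivable_cst. Qed.

Lemma smthD f g : smth f -> smth g -> smth (fun x => f x + g x).
Proof. by case=> sf [sg]; constructor=> n; apply: nderivableD. Qed.

Lemma smthM f g : smth f -> smth g -> smth (fun x => f x * g x).
Proof. by case=> sf [sg]; constructor=> n; apply: nderivableM. Qed.

Lemma smth_shift f h : smth f -> smth (fun x => f (x + h)).
Proof. by case=> sf; constructor=> n; apply: nderivable_shift. Qed.

Lemma smth_sum I (r : seq I) (F : I -> R -> R) :
  (forall i, smth (F i)) -> smth (fun x => \sum_(i <- r) F i x).
Proof.
move=> sF; elim: r => [|i r IH].
  rewrite (_ : (fun x => _) = fun=> 0); first exact: smth_cst.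
  by apply/funext => x; rewrite big_nil.
rewrite (_ : (fun x => _) = fun x => F i x + \sum_(j <- r) F j x).
  exact: smthD.
by apply/funext => x; rewrite big_cons.
Qed.

Lemma smth_powR f (a : R) : (forall x, 0 < f x) -> smth f ->
  smth (fun x => f x `^ a).
Proof. by move=> f0 [sf]; constructor=> n; apply: nderivable_powR. Qed.

Lemma smthV f : (forall x, 0 < f x) -> smth f -> smth (fun x => (f x)^-1).
Proof.
move=> f0 sf; rewrite (_ : (fun x => _) = fun x => f x `^ (-1)).
  exact: smth_powR.
by apply/funext => x; rewrite powR_inv1 // ltW.
Qed.

Lemma dfun_continuous f : dfun f -> continuous f.
Proof.
by move=> /dfunP df x; apply/differentiable_continuous/derivable1_diffP/df.
Qed.

Lemma smth_continuous f : smth f -> continuous f.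
Proof. by move=> /smth_dfun; exact: dfun_continuous. Qed.

Lemma dxn_shift n f h : smth f ->
  dxn n (fun x => f (x + h)) = (fun x => dxn n f (x + h)).
Proof.
elim: n f => // n IH f sf; have [_ sE] := dfun_shift h (smth_dfun sf).
by rewrite !dxSn sE IH //; apply: smth_dx.
Qed.

Lemma dxnD n f g : smth f -> smth g ->
  dxn n (fun x => f x + g x) = (fun x => dxn n f x + dxn n g x).
Proof.
elim: n f g => // n IH f g sf sg.
have [_ sE] := dfunD (smth_dfun sf) (smth_dfun sg).
by rewrite !dxSn sE IH //; apply: smth_dx.
Qed.

Lemma dxn0 n : dxn n ((fun=> 0) : R -> R) = fun=> 0.
Proof. by elim: n => // n IH; rewrite dxnS IH; have [] := dfun_cst 0. Qed.

Lemma dxZ (a : R) f : smth f -> dx (fun x => a * f x) = (fun x => a * dx f x).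
Proof.
move=> sf; have [da ca] := dfun_cst a; have [_ ->] := dfunM da (smth_dfun sf).
by rewrite ca; apply/funext => x; rewrite mul0r add0r.
Qed.

Lemma smthZ (a : R) f : smth f -> smth (fun x => a * f x).
Proof. by apply: smthM; exact: smth_cst. Qed.

Lemma dxnZ n (a : R) f : smth f -> dxn n (fun x => a * f x) = (fun x => a * dxn n f x).
Proof.
elim: n f => // n IH f sf.
by rewrite !dxSn dxZ // IH //; apply: smth_dx.
Qed.

Lemma dxn_sum n I (r : seq I) (F : I -> R -> R) :
  (forall i, smth (F i)) ->
  dxn n (fun x => \sum_(i <- r) F i x) = (fun x => \sum_(i <- r) dxn n (F i) x).
Proof.
move=> sF; elim: r => [|i r IH].
  rewrite (_ : (fun x => _) = fun=> 0).
    by rewrite dxn0; apply/funext => x; rewrite big_nil.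
  by apply/funext => x; rewrite big_nil.
rewrite (_ : (fun x => _) = fun x => F i x + \sum_(j <- r) F j x).
  rewrite dxnD // ?IH; last exact: smth_sum.
  by apply/funext => x; rewrite big_cons.
by apply/funext => x; rewrite big_cons.
Qed.

Lemma dx_sum I (r : seq I) (F : I -> R -> R) :
  (forall i, smth (F i)) ->
  dx (fun x => \sum_(i <- r) F i x) = (fun x => \sum_(i <- r) dx (F i) x).
Proof. exact: (@dxn_sum 1). Qed.

Lemma dxnM n f g : smth f -> smth g ->
  dxn n (fun x => f x * g x) =
  (fun x => \sum_(i < n.+1) 'C(n, i)%:R * dxn (n - i) f x * dxn i g x).
Proof.
move=> sf sg; elim: n => [|n IH].
  by apply/funext => x; rewrite big_ord1 bin0 mul1r.
have s i : smth (fun x => 'C(n, i)%:R * dxn (n - i) f x).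
  exact/smthZ/smth_dxn.
rewrite dxnS IH dx_sum; last by move=> i; apply: smthM (s i) (smth_dxn i sg).
apply/funext => x.
under eq_bigr => i _.
  rewrite (dfunM (smth_dfun (s i)) (smth_dfun (smth_dxn i sg))).2.
  rewrite dxZ; last exact: smth_dxn.
  rewrite -!dxnS -subSn; last by rewrite -ltnS.
  over.
rewrite big_split /= big_ord_recl /= [in RHS]big_ord_recl /=.
rewrite !bin0 -addrA; congr (_ + _).
rewrite [in RHS](eq_bigr (fun i : 'I_n.+1 =>
   'C(n, i.+1)%:R * dxn (n - i) f x * dxn i.+1 g x +
   'C(n, i)%:R * dxn (n - i) f x * dxn i.+1 g x)); last first.
  by move=> i _; rewrite /bump /= add1n binS natrD subSS !mulrDl.
rewrite big_split /=; congr (_ + _).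
rewrite [in RHS]big_ord_recr /= bin_small // !mul0r addr0.
by apply: eq_bigr => i _; rewrite /bump /= add1n subSS.
Qed.

Lemma smth_bounded f (A : R) : smth f ->
  exists2 C, 0 <= C & forall x, `|x| <= A -> `|f x| <= C.
Proof.
move=> sf; have [A0|A0] := leP 0 A; last first.
  exists 0 => // x xA; have := le_lt_trans xA A0.
  by rewrite ltNge normr_ge0.
have cf : {within `[- A, A], continuous (fun x => `|f x|)}.
  apply: continuous_subspaceT => x; apply: continuous_comp.
    exact: smth_continuous.
  exact: norm_continuous.
have AA : - A <= A by rewrite ge0_cp.
have [c _ cmax] := EVT_max AA cf.
exists `|f c| => // x xA; apply: cmax.
by rewrite in_itv /= -ler_norml.
Qed.

End Smooth.

(** * Estimates uniform with all x-derivatives *)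

Section BigO.
Variable R : realType.
Implicit Types (F G : R -> R -> R) (n m K : nat).

(* [bigOn n K F]: in the range 0 < e <= 1, each [F e] is K times
   differentiable and its derivatives are O(e^n), locally uniformly in x. *)
Fixpoint bigOn n K F : Prop :=
  (forall A, exists C, forall e x, 0 < e <= 1 -> `|x| <= A ->
     `|F e x| <= C * e ^+ n) /\
  (if K is K'.+1 then
     (forall e, 0 < e <= 1 -> dfun (F e)) /\ bigOn n K' (fun e => dx (F e))
   else True).

Inductive bigO n F : Prop := BigO of forall K, bigOn n K F.

Lemma bigOn_bound n K F : bigOn n K F -> forall A, exists2 C, 0 <= C &
  forall e x, 0 < e <= 1 -> `|x| <= A -> `|F e x| <= C * e ^+ n.
Proof.
move=> OF A; have [C HC] : exists C, forall e x, 0 < e <= 1 -> `|x| <= A ->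
  `|F e x| <= C * e ^+ n by case: K OF => [|K] [+ _]; apply.
exists `|C| => // e x he xA; apply: le_trans (HC e x he xA) _.
by apply: ler_wpM2r (ler_norm C); rewrite exprn_ge0 // ltW //; case/andP: he.
Qed.

Lemma bigO_bound n F : bigO n F -> forall A, exists2 C, 0 <= C &
  forall e x, 0 < e <= 1 -> `|x| <= A -> `|F e x| <= C * e ^+ n.
Proof. by case=> OF; apply: (@bigOn_bound n 0 F). Qed.

Lemma bigOnW n K F : bigOn n K.+1 F -> bigOn n K F.
Proof.
elim: K F => [|K IH] F [bF [dF OF]]; first by split.
by split => //; split => //; apply: IH.
Qed.

Lemma bigO_dfun n F e : bigO n F -> 0 < e <= 1 -> dfun (F e).
Proof. by case=> /(_ 1%N) [_ [+ _]]; apply. Qed.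

Lemma bigO_dx n F : bigO n F -> bigO n (fun e => dx (F e)).
Proof. by case=> OF; constructor=> K; have [_ []] := OF K.+1. Qed.

Lemma bigO_dxn n F k : bigO n F -> bigO n (fun e => dxn k (F e)).
Proof. by move=> OF; elim: k => // k IH; apply: bigO_dx IH. Qed.

Lemma bigO_smth n F e : bigO n F -> 0 < e <= 1 -> smth (F e).
Proof.
move=> OF he; constructor=> k; elim: k F OF => //= k IH F OF.
by split; [exact: (bigO_dfun OF he)|apply: IH (bigO_dx OF)].
Qed.

Lemma bigOn_eq n K F G : (forall e x, 0 < e <= 1 -> F e x = G e x) ->
  bigOn n K F -> bigOn n K G.
Proof.
have E F' G' : (forall e x, 0 < e <= 1 -> F' e x = G' e x) ->
    (forall A, exists C, forall e x, 0 < e <= 1 -> `|x| <= A ->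
      `|F' e x| <= C * e ^+ n) ->
    (forall A, exists C, forall e x, 0 < e <= 1 -> `|x| <= A ->
      `|G' e x| <= C * e ^+ n).
  move=> FG bF A; have [C HC] := bF A; exists C => e x he xA.
  by rewrite -FG ?HC.
elim: K F G => [|K IH] F G FG [bF dF]; split=> //; try exact: E FG bF.
have FGe e : 0 < e <= 1 -> G e = F e by move=> he; apply/funext=> x; rewrite FG.
split=> [e he|]; first by rewrite FGe //; apply: dF.1.
by apply: IH dF.2 => e x he; rewrite FGe.
Qed.

Lemma bigO_eq n F G : (forall e x, 0 < e <= 1 -> F e x = G e x) ->
  bigO n F -> bigO n G.
Proof. by move=> FG [OF]; constructor=> K; apply: bigOn_eq (OF K). Qed.

Lemma bigOnD n K F G : bigOn n K F -> bigOn n K G ->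
  bigOn n K (fun e x => F e x + G e x).
Proof.
have bD F' G' K' : bigOn n K' F' -> bigOn n K' G' -> forall A, exists C,
    forall e x, 0 < e <= 1 -> `|x| <= A -> `|F' e x + G' e x| <= C * e ^+ n.
  move=> /bigOn_bound bF /bigOn_bound bG A.
  have [C C0 HC] := bF A; have [D D0 HD] := bG A.
  exists (C + D) => e x he xA; apply: le_trans (ler_normD _ _) _.
  by rewrite mulrDl lerD ?HC ?HD.
elim: K F G => [|K IH] F G OF OG; split=> //; first exact: (bD _ _ 0%N).
  exact: (bD _ _ K.+1).
case: OF => _ [dF OF]; case: OG => _ [dG OG].
split=> [e he|]; first by have [] := dfunD (dF e he) (dG e he).
apply: bigOn_eq (IH _ _ OF OG) => e x he.
by have [_ ->] := dfunD (dF e he) (dG e he).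
Qed.

Lemma bigOD n F G : bigO n F -> bigO n G -> bigO n (fun e x => F e x + G e x).
Proof. by case=> OF [OG]; constructor=> K; apply: bigOnD. Qed.

Lemma bigOnM n m K F G : bigOn n K F -> bigOn m K G ->
  bigOn (n + m) K (fun e x => F e x * G e x).
Proof.
have bM F' G' K' : bigOn n K' F' -> bigOn m K' G' -> forall A, exists C,
    forall e x, 0 < e <= 1 -> `|x| <= A ->
      `|F' e x * G' e x| <= C * e ^+ (n + m).
  move=> /bigOn_bound bF /bigOn_bound bG A.
  have [C C0 HC] := bF A; have [D D0 HD] := bG A.
  exists (C * D) => e x he xA; rewrite normrM exprD mulrACA.
  by rewrite ler_pM ?HC ?HD.
elim: K F G => [|K IH] F G OF OG; split=> //; first exact: (bM _ _ 0%N).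
  exact: (bM _ _ K.+1).
have [OF' OG'] := (bigOnW OF, bigOnW OG).
case: OF => _ [dF OF]; case: OG => _ [dG OG].
split=> [e he|]; first by have [] := dfunM (dF e he) (dG e he).
apply: bigOn_eq (bigOnD (IH _ _ OF OG') (IH _ _ OF' OG)) => e x he.
by have [_ ->] := dfunM (dF e he) (dG e he).
Qed.

Lemma bigOM n m F G : bigO n F -> bigO m G ->
  bigO (n + m) (fun e x => F e x * G e x).
Proof. by case=> OF [OG]; constructor=> K; apply: bigOnM. Qed.

(** A factor depending on e alone passes through x-derivatives. Lowering the order, constant
    factors, powers of e and division by e are all instances. *)
Lemma bigO_scale (a : R -> R) n m B F :
  (forall e, 0 < e <= 1 -> `|a e| * e ^+ m <= B * e ^+ n) -> bigO m F ->
  bigO n (fun e x => a e * F e x).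
Proof.
move=> aB OF; have bS F' : bigO m F' -> forall A, exists C,
    forall e x, 0 < e <= 1 -> `|x| <= A -> `|a e * F' e x| <= C * e ^+ n.
  move=> OF' A; have [C C0 HC] := bigO_bound OF' A.
  exists (C * B) => e x he xA; rewrite normrM -mulrA.
  apply: le_trans (ler_wpM2l C0 (aB e he)).
  by rewrite mulrCA ler_wpM2l // HC.
constructor=> K; elim: K F OF => [|K IH] F OF; split=> //; try exact: bS.
have D e : 0 < e <= 1 -> _ := fun he => dfunM (dfun_cst (a e)).1 (bigO_dfun OF he).
split=> [e he|]; first by have [] := D e he.
apply: bigOn_eq (IH _ (bigO_dx OF)) => e x he.
by have [_ ->] := D e he; rewrite (dfun_cst _).2 mul0r add0r.
Qed.

Lemma bigO_leq n m F : (n <= m)%N -> bigO m F -> bigO n F.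
Proof.
move=> nm OF; apply: (@bigO_eq _ (fun e x => 1 * F e x)).
  by move=> e x _; rewrite mul1r.
apply: (@bigO_scale (fun=> 1) n m 1) OF => e /andP[e0 e1].
by rewrite normr1 !mul1r ler_wiXn2l // ltW.
Qed.

Lemma bigOZ n (a : R) F : bigO n F -> bigO n (fun e x => a * F e x).
Proof. by apply: (@bigO_scale (fun=> a) n n `|a|). Qed.

Lemma bigON n F : bigO n F -> bigO n (fun e x => - F e x).
Proof. by move=> /(bigOZ (-1)); apply: bigO_eq => e x _; rewrite mulN1r. Qed.

Lemma bigOB n F G : bigO n F -> bigO n G -> bigO n (fun e x => F e x - G e x).
Proof. by move=> OF OG; apply: (bigOD OF (bigON OG)). Qed.

Lemma bigO_exp k n F : bigO n F -> bigO (k + n) (fun e x => e ^+ k * F e x).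
Proof.
apply: (@bigO_scale (fun e => e ^+ k) _ _ 1) => e /andP[e0 e1].
by rewrite mul1r exprD ger0_norm // exprn_ge0 // ltW.
Qed.

Lemma bigO_div n F : bigO n.+1 F -> bigO n (fun e x => e^-1 * F e x).
Proof.
apply: (@bigO_scale (fun e => e^-1) _ _ 1) => e /andP[e0 e1].
by rewrite gtr0_norm ?invr_gt0 // mul1r exprS mulKf // gt_eqF.
Qed.

Lemma bigO_fun (f : R -> R) : smth f -> bigO 0 (fun=> f).
Proof.
move=> sf; constructor=> K; elim: K f sf => [|K IH] f sf; split=> //.
- move=> A; have [C C0 HC] := smth_bounded A sf.
  by exists C => e x _ xA; rewrite mulr1 HC.
- move=> A; have [C C0 HC] := smth_bounded A sf.
  by exists C => e x _ xA; rewrite mulr1 HC.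
split=> [e _|]; first exact: (smth_dfun sf).
by apply: IH (smth_dx sf).
Qed.

Lemma bigO_cst (a : R) : bigO 0 (fun _ _ => a).
Proof. by apply: bigO_fun; exact: smth_cst. Qed.

Lemma bigO0 n : bigO n (fun _ _ => 0).
Proof.
apply: (@bigO_eq _ (fun e x => e ^+ n * 0)); first by move=> e x _; rewrite mulr0.
by apply: bigO_leq (bigO_exp n (bigO_cst 0)); rewrite addn0.
Qed.

Lemma bigO_sum n I (r : seq I) (P : pred I) (F : I -> R -> R -> R) :
  (forall i, P i -> bigO n (F i)) ->
  bigO n (fun e x => \sum_(i <- r | P i) F i e x).
Proof.
move=> OF; elim: r => [|i r IH].
  by apply: bigO_eq (bigO0 n) => e x _; rewrite big_nil.
have [Pi|Pi] := boolP (P i).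
  by apply: bigO_eq (bigOD (OF i Pi) IH) => e x _; rewrite big_cons Pi.
by apply: bigO_eq IH => e x _; rewrite big_cons (negbTE Pi).
Qed.

Definition taylor N (f : R -> R) (h x : R) : R :=
  \sum_(m < N) h ^+ m / m`!%:R * dxn m f x.

Lemma is_derive_taylor N f (x h : R) :
  is_derive h (1 : R) (fun h => taylor N.+1 f h x) (taylor N (dx f) h x).
Proof.
pose p : {poly R} := \poly_(m < N.+1) (dxn m f x / m`!%:R).
have pE : (fun h => taylor N.+1 f h x) = horner p.
  apply/funext => u; rewrite horner_poly; apply: eq_bigr => i _.
  by rewrite -mulrA mulrC [_^-1 * _]mulrC.
rewrite pE; apply: is_derive_eq.
rewrite (@horner_coef_wide _ N); last first.
  have [->|p0] := eqVneq p 0; first by rewrite deriv0 size_poly0.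
  by rewrite -ltnS; apply: leq_trans (lt_size_deriv p0) (size_poly _ _).
apply: eq_bigr => i _; rewrite coef_deriv coef_poly ltnS ltn_ord.
rewrite -dxSn factS natrM invfM -mulrnAr -[_ *+ i.+1]mulr_natr.
have i0 : i.+1%:R != 0 :> R by rewrite pnatr_eq0.
have f0 : i`!%:R != 0 :> R by rewrite pnatr_eq0 -lt0n fact_gt0.
by field; apply/andP; split.
Qed.

(** The derivative of the remainder in the step [h] is the remainder of [dx f] with one term fewer,
    and the remainder vanishes at [h = 0]. The mean value theorem thus gains one power of [h] per
    order; used in this way it leaves no factorial in the bound. *)
Lemma taylor_bound N (f : R -> R) (A M : R) : smth f ->
  (forall y, `|y| <= A -> `|dxn N f y| <= M) ->
  forall x h, `|x| + `|h| <= A ->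
  `|f (x + h) - taylor N f h x| <= M * `|h| ^+ N.
Proof.
move=> sf fM x; elim: N f sf fM => [|N IH] f sf fM h xhA.
  rewrite /taylor big_ord0 subr0 expr0 mulr1; apply: fM.
  exact: le_trans (ler_normD _ _) xhA.
pose g t : R := f (x + t) - taylor N.+1 f t x.
pose dg t := dx f (x + t) - taylor N (dx f) t x.
have M0 : 0 <= M.
  apply: le_trans (fM x _) => //; apply: le_trans xhA.
  by rewrite lerDl.
have gd (t : R) : is_derive t (1 : R) g (dg t).
  apply: is_deriveB; last exact: is_derive_taylor.
  rewrite (_ : (fun t => f (x + t)) = fun t => f (t + x)); last first.
    by apply/funext => u; rewrite addrC.
  have [d1 E] := dfun_shift x (smth_dfun sf).
  by rewrite [x + t]addrC -[dx f (t + x)]/((fun y => dx f (y + x)) t) -E;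
     apply: dfun_derive.
have g0 : g 0 = 0.
  rewrite /g addr0 /taylor big_ord_recl big1 ?addr0.
    by rewrite expr0 fact0 divr1 mul1r subrr.
  by move=> i _; rewrite expr0n mul0r mul0r.
have gc : continuous g by apply: dfun_continuous; have [] := dfun_is gd.
have dgM t : `|t| <= `|h| -> `|dg t| <= M * `|h| ^+ N.
  move=> th; have tA : `|x| + `|t| <= A by apply: le_trans xhA; rewrite lerD2l.
  apply: le_trans (IH _ _ _ _ tA) _; first exact: smth_dx.
    by move=> y yA; rewrite -dxSn fM.
  by rewrite ler_wpM2l // lerXn2r // nnegrE.
rewrite -/(g h) exprSr mulrA.
case: (ltgtP h 0) => h0.
- have [|c cI] := @MVT R g dg h 0 h0 (fun t _ => gd t).
    exact: continuous_subspaceT.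
  rewrite g0 !sub0r => /eqP; rewrite eqr_oppLR => /eqP ->.
  rewrite mulrN opprK normrM ler_wpM2r // dgM //.
  move: cI; rewrite in_itv /= => /andP[hc c0].
  by rewrite !ltr0_norm // lerN2 ltW.
- have [|c cI] := @MVT R g dg 0 h h0 (fun t _ => gd t).
    exact: continuous_subspaceT.
  rewrite g0 !subr0 => ->.
  rewrite normrM ler_wpM2r // dgM //.
  move: cI; rewrite in_itv /= => /andP[hc c0].
  by rewrite !gtr0_norm // ltW.
- by rewrite h0 g0 normr0 mulr_ge0 // mulr_ge0 // exprn_ge0.
Qed.

Lemma smth_taylor N f h : smth f -> smth (taylor N f h).
Proof. by move=> sf; apply: smth_sum => i; exact/smthZ/smth_dxn. Qed.

Lemma dx_taylor N f h : smth f -> dx (taylor N f h) = taylor N (dx f) h.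
Proof.
move=> sf; rewrite /taylor dx_sum; last by move=> i; exact/smthZ/smth_dxn.
apply/funext => x; apply: eq_bigr => i _.
by rewrite dxZ -?dxnS ?dxSn //; apply: smth_dxn.
Qed.

(* The x-derivatives of the remainder of F are the remainders of the
   x-derivatives of F, so the pointwise bound suffices. *)
Lemma bigO_taylor n N (q : R) F : bigO n F ->
  bigO (N + n) (fun e x => F e (x + q * e) - taylor N (F e) (q * e) x).
Proof.
have B F' : bigO n F' -> forall A, exists C, forall e x, 0 < e <= 1 -> `|x| <= A ->
    `|F' e (x + q * e) - taylor N (F' e) (q * e) x| <= C * e ^+ (N + n).
  move=> OF' A.
  have [C C0 HC] := bigO_bound (bigO_dxn N OF') (A + `|q|).
  exists (C * `|q| ^+ N) => e x he xA.
  have e0 : 0 < e by case/andP: he.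
  have qe : `|q * e| <= `|q|.
    by rewrite normrM ler_piMr // gtr0_norm //; case/andP: he.
  have := @taylor_bound N (F' e) (A + `|q|) (C * e ^+ n) (bigO_smth OF' he)
    (fun y => HC e y he) x (q * e) (lerD xA qe).
  rewrite normrM exprMn (gtr0_norm e0) => /le_trans; apply.
  by rewrite exprD le_eqVlt; apply/orP; left; apply/eqP; ring.
move=> OF; constructor=> K; elim: K F OF => [|K IH] F OF; split=> //; first exact: B.
  exact: B.
have s1 e : 0 < e <= 1 -> smth (fun x => F e (x + q * e)).
  by move=> he; apply: smth_shift; exact: (bigO_smth OF he).
have s2 e : 0 < e <= 1 -> smth (fun x => -1 * taylor N (F e) (q * e) x).
  by move=> he; apply: smthZ; apply: smth_taylor; exact: (bigO_smth OF he).
have E e : (fun x => F e (x + q * e) - taylor N (F e) (q * e) x) =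
    (fun x => F e (x + q * e) + -1 * taylor N (F e) (q * e) x).
  by apply/funext => x; rewrite mulN1r.
have D e : 0 < e <= 1 -> _ :=
  fun he => dfunD (smth_dfun (s1 e he)) (smth_dfun (s2 e he)).
split=> [e he|]; first by rewrite E; have [] := D e he.
apply: bigOn_eq (IH _ (bigO_dx OF)) => e x he.
rewrite E (D e he).2 (dfun_shift _ (bigO_dfun OF he)).2 dxZ; last first.
  by apply: smth_taylor; exact: (bigO_smth OF he).
by rewrite dx_taylor ?mulN1r //; exact: (bigO_smth OF he).
Qed.

(** This is the Taylor remainder of the empty Taylor polynomial. *)
Lemma bigO_shift n (q : R) F : bigO n F -> bigO n (fun e x => F e (x + q * e)).
Proof.
move=> /(bigO_taylor 0 q); apply: bigO_eq => e x _.
by rewrite /taylor big_ord0 subr0.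
Qed.

End BigO.

(** * Congruence modulo powers of the parameter, and determinants *)

Section Congruence.
Variable R : realType.
Implicit Types (F G H : R -> R -> R) (n m : nat).

(** Boundedness of both sides is part of the relation, so that congruences can be multiplied. *)
Inductive cong n F G : Prop :=
  Cong of bigO 0 F & bigO 0 G & bigO n (fun e x => F e x - G e x).

Lemma congl n F G : cong n F G -> bigO 0 F. Proof. by case. Qed.
Lemma congr n F G : cong n F G -> bigO 0 G. Proof. by case. Qed.
Lemma congB n F G : cong n F G -> bigO n (fun e x => F e x - G e x).
Proof. by case. Qed.

Lemma cong_refl n F : bigO 0 F -> cong n F F.
Proof.
move=> OF; split=> //.
by apply: bigO_eq (bigO0 _ n) => e x _; rewrite subrr.
Qed.

Lemma cong_add n F G : bigO 0 F -> bigO n G ->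
  cong n (fun e x => F e x + G e x) F.
Proof.
move=> OF OG; split=> //; first exact: bigOD OF (bigO_leq (leq0n n) OG).
by apply: bigO_eq OG => e x _; rewrite addrAC subrr add0r.
Qed.

Lemma cong_sym n F G : cong n F G -> cong n G F.
Proof.
case=> OF OG OFG; split=> //.
by apply: bigO_eq (bigON OFG) => e x _; rewrite opprB.
Qed.

Lemma cong_trans n F G H : cong n F G -> cong n G H -> cong n F H.
Proof.
case=> OF _ OFG [_ OH OGH]; split=> //.
by apply: bigO_eq (bigOD OFG OGH) => e x _; rewrite addrA subrK.
Qed.

Lemma cong_leq n m F G : (n <= m)%N -> cong m F G -> cong n F G.
Proof. by move=> nm [OF OG OFG]; split=> //; apply: bigO_leq OFG. Qed.

Lemma cong_eq n F F' G G' : (forall e x, 0 < e <= 1 -> F e x = F' e x) ->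
  (forall e x, 0 < e <= 1 -> G e x = G' e x) -> cong n F G -> cong n F' G'.
Proof.
move=> EF EG [OF OG OFG]; split.
- exact: bigO_eq OF.
- exact: bigO_eq OG.
- by apply: bigO_eq OFG => e x he; rewrite EF ?EG.
Qed.

Lemma congM n F F' G G' : cong n F F' -> cong n G G' ->
  cong n (fun e x => F e x * G e x) (fun e x => F' e x * G' e x).
Proof.
case=> OF OF' B [OG OG' B']; split; [exact: (bigOM OF OG)|exact: (bigOM OF' OG')|].
have := bigOM B OG; rewrite addn0 => O1; have O2 := bigOM OF' B'.
by apply: bigO_eq (bigOD O1 O2) => e x _; ring.
Qed.

Lemma congZ n (a : R) F F' : cong n F F' ->
  cong n (fun e x => a * F e x) (fun e x => a * F' e x).
Proof. by apply: congM; apply: cong_refl; exact: bigO_cst. Qed.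

Lemma cong_sum n I (r : seq I) (F G : I -> R -> R -> R) :
  (forall i, cong n (F i) (G i)) ->
  cong n (fun e x => \sum_(i <- r) F i e x) (fun e x => \sum_(i <- r) G i e x).
Proof.
move=> FG; split.
- by apply: bigO_sum => i _; exact: congl (FG i).
- by apply: bigO_sum => i _; exact: congr (FG i).
- have : bigO n (fun e x => \sum_(i <- r) (F i e x - G i e x)).
    by apply: bigO_sum => i _; exact: congB (FG i).
  by apply: bigO_eq => e x _; rewrite sumrB.
Qed.

Lemma cong_prod n I (r : seq I) (F G : I -> R -> R -> R) :
  (forall i, cong n (F i) (G i)) ->
  cong n (fun e x => \prod_(i <- r) F i e x) (fun e x => \prod_(i <- r) G i e x).
Proof.
move=> FG; elim: r => [|i r IH].
  apply: cong_eq (cong_refl n (bigO_cst (1 : R))).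
    by move=> e x _; rewrite big_nil.
  by move=> e x _; rewrite big_nil.
apply: cong_eq (congM (FG i) IH).
  by move=> e x _; rewrite big_cons.
by move=> e x _; rewrite big_cons.
Qed.

Lemma bigO_prod I (r : seq I) (F : I -> R -> R -> R) :
  (forall i, bigO 0 (F i)) -> bigO 0 (fun e x => \prod_(i <- r) F i e x).
Proof.
move=> OF; apply: (@congl 0).
by apply: (@cong_prod 0 _ r F F) => i; apply: cong_refl.
Qed.

Definition mcong n p q (A B : R -> R -> 'M[R]_(p, q)) :=
  forall i j, cong n (fun e x => A e x i j) (fun e x => B e x i j).

Lemma mcong_mul n p q r (A A' : R -> R -> 'M[R]_(p, q))
    (B B' : R -> R -> 'M[R]_(q, r)) :
  mcong n A A' -> mcong n B B' ->
  mcong n (fun e x => A e x *m B e x) (fun e x => A' e x *m B' e x).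
Proof.
move=> AA BB i j.
apply: cong_eq (cong_sum (index_enum _) (fun k => congM (AA i k) (BB k j))).
  by move=> e x _; rewrite mxE.
by move=> e x _; rewrite mxE.
Qed.

Lemma mcong_det n p (A B : R -> R -> 'M[R]_p) : mcong n A B ->
  cong n (fun e x => \det (A e x)) (fun e x => \det (B e x)).
Proof.
move=> AB; apply: cong_sum => s.
by apply: congZ; apply: cong_prod => i; exact: AB.
Qed.

Lemma mcong_adj n p (A B : R -> R -> 'M[R]_p) : mcong n A B ->
  mcong n (fun e x => \adj (A e x)) (fun e x => \adj (B e x)).
Proof.
move=> AB i j.
have D : cong n (fun e x => cofactor (A e x) j i) (fun e x => cofactor (B e x) j i).
  apply: congZ; apply: mcong_det => k l.
  by apply: cong_eq (AB (lift j k) (lift i l)) => e x _; rewrite !mxE.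
by apply: cong_eq D => e x _; rewrite mxE.
Qed.

Lemma bigO_prod1 n I (r : seq I) (Z : I -> R -> R -> R) :
  (forall i, bigO n (Z i)) ->
  bigO (n + n) (fun e x =>
    \prod_(i <- r) (1 + Z i e x) - (1 + \sum_(i <- r) Z i e x)).
Proof.
move=> OZ.
have O1 i : bigO 0 (fun e x => 1 + Z i e x).
  exact: bigOD (bigO_cst 1) (bigO_leq (leq0n n) (OZ i)).
elim: r => [|i r IH].
  by apply: bigO_eq (bigO0 _ _) => e x _; rewrite !big_nil addr0 subrr.
have OS : bigO n (fun e x => \sum_(i <- r) Z i e x) by apply: bigO_sum.
have IH' := bigOM (O1 i) IH.
apply: bigO_eq (bigOD IH' (bigOM (OZ i) OS)) => e x _.
by rewrite !big_cons; ring.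
Qed.

(* In the expansion of det A, a nontrivial permutation contributes at least
   two off-diagonal factors. *)
Lemma bigO_det1 n p (A : R -> R -> 'M[R]_p) :
  (forall i j, bigO n (fun e x => A e x i j - (i == j)%:R)) ->
  bigO (n + n) (fun e x => \det (A e x) - (1 + \sum_i (A e x i i - 1))).
Proof.
move=> OA.
have A0 i j : bigO 0 (fun e x => A e x i j).
  have := bigOD (bigO_leq (leq0n n) (OA i j)) (bigO_cst (i == j)%:R).
  by apply: bigO_eq => e x _; rewrite subrK.
have Od : bigO (n + n) (fun e x =>
    \prod_i A e x i i - (1 + \sum_i (A e x i i - 1))).
  have := @bigO_prod1 n 'I_p (index_enum _) (fun i e x => A e x i i - 1).
  have OA1 i : bigO n (fun e x => A e x i i - 1).
    by apply: bigO_eq (OA i i) => e x _; rewrite eqxx.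
  move=> /(_ OA1); apply: bigO_eq => e x _; congr (_ - _).
  by apply: eq_bigr => i _; rewrite addrC subrK.
have Os : bigO (n + n) (fun e x => \sum_(s : 'S_p | s != 1%g)
    (-1) ^+ s * \prod_i A e x i (s i)).
  apply: bigO_sum => s s1; apply: bigOZ.
  have [i si] : exists i, s i != i.
    apply/existsP; rewrite -negb_forall; apply: contra s1 => /forallP sI.
    by apply/eqP/permP => i; rewrite perm1; apply/eqP; have := sI i; case: eqP.
  have ssi : s (s i) != s i by rewrite (inj_eq perm_inj).
  have off j : s j != j -> bigO n (fun e x => A e x j (s j)).
    move=> sj; apply: bigO_eq (OA j (s j)) => e x _.
    by rewrite eq_sym (negbTE sj) subr0.
  have rest : bigO 0 (fun e x =>
      \prod_(j | (j != i) && (j != s i)) A e x j (s j)).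
    have : bigO 0 (fun e x => \prod_(j <- [seq j <- index_enum _ |
       (j != i) && (j != s i)]) A e x j (s j)).
      by apply: bigO_prod => j; exact: A0.
    by apply: bigO_eq => e x _; rewrite big_filter.
  have := bigOM (off i si) (bigOM (off (s i) ssi) rest); rewrite addn0.
  apply: bigO_eq => e x _.
  rewrite [in RHS](bigD1 i) //=; congr (_ * _).
  by rewrite [in RHS](bigD1 (s i)).
apply: bigO_eq (bigOD Od Os) => e x _.
rewrite addrAC; congr (_ - _); rewrite /determinant [RHS](bigD1 1%g) //=.
rewrite odd_perm1 expr0 mul1r; congr (_ + _).
by apply: eq_bigr => i _; rewrite perm1.
Qed.

End Congruence.

(** * Finite differences and the relation between d+2 points *)

Section Differences.
Variable R : realType.
Implicit Types (F G : R -> R -> R) (f : R -> R).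

Definition dif F : R -> R -> R := fun e x => e^-1 * (F e (x + e) - F e x).

Definition difn k F := iter k dif F.

(** The one-term Taylor remainder gains the power of e that the division loses. *)
Lemma bigO_dif n F : bigO n F -> bigO n (dif F).
Proof.
move=> OF; apply: bigO_div; apply: bigO_eq (bigO_taylor 1 1 OF) => e x _.
by rewrite /taylor big_ord1 mul1r expr0 fact0 divr1 mul1r.
Qed.

Lemma dif_cong F : bigO 0 F -> cong 1 (dif F) (fun e => dx (F e)).
Proof.
move=> OF; split; [exact: bigO_dif|exact: bigO_dx|].
have := bigO_div (bigO_taylor 2 1 OF); apply: bigO_eq => e x /andP[e0 _].
rewrite /taylor big_ord_recl big_ord1 /= /bump /= mul1r expr0 expr1 fact0 factS.
rewrite fact0 /dif !divr1 mul1r; field.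
by rewrite gt_eqF.
Qed.

(** By linearity of [dif] and [bigO_dif], an O(e) error at order k stays O(e) after one more
    difference; only replacing the last difference by a derivative adds a new O(e). *)
Lemma difn_cong k f : smth f -> cong 1 (difn k (fun=> f)) (fun=> dxn k f).
Proof.
move=> sf; elim: k => [|k IH]; first by apply: cong_refl; exact: bigO_fun.
have Of : bigO 0 (fun=> dxn k f) by apply: bigO_fun; exact: smth_dxn.
apply: cong_trans (dif_cong Of).
case: IH => O1 _ O2; split; [exact: bigO_dif|exact: bigO_dif|].
apply: bigO_eq (bigO_dif O2) => e x _; rewrite /difn iterS -/(difn k _).
by rewrite /dif; move: (difn k _) => D; ring.
Qed.

(** The weight of the m-th point in the k-th forward difference. The exponent k + m has the parity
    of k - m and avoids truncated subtraction; the binomial vanishes for m > k, so sums may run past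
    k. *)
Definition difc (k m : nat) : R := (-1) ^+ (k + m) * 'C(k, m)%:R.

Lemma difcS k m : difc k.+1 m.+1 = difc k m - difc k m.+1.
Proof. by rewrite /difc binS natrD addSn !addnS !exprS; ring. Qed.

Lemma difnE k f e x : e != 0 ->
  e ^+ k * difn k (fun=> f) e x = \sum_(m < k.+1) difc k m * f (x + m%:R * e).
Proof.
move=> e0; elim: k x => [|k IH] x.
  by rewrite big_ord1 /difc bin0 expr0 !mul1r mul0r addr0.
rewrite [difn _ _]iterS /dif exprSr mulrA -[_ * _ * e^-1]mulrA divff // mulr1.
rewrite mulrBr !IH.
rewrite [RHS]big_ord_recl /= [\sum_(m < k.+1) difc k m * f (x + _)]big_ord_recl /=.
rewrite mul0r addr0 opprD addrCA; congr (_ + _).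
  by rewrite /difc !bin0 addSn exprS; ring.
have -> : \sum_(i < k) difc k (bump 0 i) * f (x + (bump 0 i)%:R * e) =
    \sum_(m < k.+1) difc k m.+1 * f (x + m.+1%:R * e).
  rewrite big_ord_recr /= [difc k k.+1]/difc bin_small // mulr0 mul0r addr0.
  by apply: eq_bigr => i _; rewrite /bump /= add1n.
rewrite -sumrB; apply: eq_bigr => m _; rewrite /bump /= add1n difcS mulrBl.
by congr (_ * f _ - _); rewrite -natr1; ring.
Qed.

End Differences.

(** * The linear relation between d+2 consecutive points *)

Definition wmat (R : realType) (n : nat) (h : 'I_n -> R -> R) x : 'M[R]_n :=
  \matrix_(k, j) dxn k (h j) x.

Section Relation.
Variables (R : realType) (d : nat) (g : 'I_d.+1 -> R -> R).
Hypothesis sg : forall j, smth (g j).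

Definition jet k x : 'rV[R]_d.+1 := \row_j dxn k (g j) x.
Local Notation Wmx := (wmat g).

Hypothesis Wmx1 : forall x, \det (Wmx x) = 1.

Lemma mcong_W n : mcong n (fun _ => Wmx) (fun _ => Wmx).
Proof.
move=> i j; apply: cong_refl; apply: (@bigO_eq _ _ (fun=> dxn i (g j))).
  by move=> e x _; rewrite mxE.
by apply: bigO_fun; exact: smth_dxn.
Qed.

Lemma mulW_adj x : Wmx x *m \adj (Wmx x) = 1%:M.
Proof. by rewrite mul_mx_adj Wmx1. Qed.

(* [\adj] is the inverse here, the Wronskian being 1. *)
Definition coords (v : 'rV[R]_d.+1) x := v *m \adj (Wmx x).

Lemma coords_jet k (kd : (k < d.+1)%N) x :
  coords (jet k x) x = delta_mx 0 (Ordinal kd).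
Proof.
rewrite /coords (_ : jet k x = delta_mx 0 (Ordinal kd) *m Wmx x).
  by rewrite -mulmxA mulW_adj mulmx1.
by rewrite -rowE; apply/rowP => j; rewrite !mxE.
Qed.

(* The derivative of the (constant) Wronskian is the trace of W' W^-1. *)
Lemma coords_top x : coords (jet d.+1 x) x 0 ord_max = 0.
Proof.
pose W1 x : 'M[R]_d.+1 := \matrix_(k, j) dxn k.+1 (g j) x.
pose N x := W1 x *m \adj (Wmx x).
have NE y : \tr (N y) = coords (jet d.+1 y) y 0 ord_max.
  have rN i : N y i = coords (jet i.+1 y) y 0 .
    apply/funext => j; rewrite !mxE; apply: eq_bigr => k _.
    by rewrite !mxE.
  rewrite /mxtrace big_ord_recr /= rN big1 ?add0r // => i _.
  have id : (i.+1 < d.+1)%N by rewrite ltnS.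
  by rewrite rN (coords_jet id) mxE eqxx /= -val_eqE /= ltn_eqF.
(* Both Wronskians in [A] are 1, so det A = 1 for every e. With A = 1 + e N + O(e^2), the expansion
   of the determinant leaves e tr N = O(e^2). *)
pose A (e y : R) := Wmx (y + e) *m \adj (Wmx y).
have sh i j : cong 2 (fun e y => Wmx (y + e) i j)
    (fun e y => Wmx y i j + e * W1 y i j).
  have Of : bigO 0 (fun _ : R => dxn i (g j)).
    by apply: bigO_fun; exact: smth_dxn.
  have Of1 : bigO 0 (fun _ : R => dxn i.+1 (g j)).
    by apply: bigO_fun; exact: smth_dxn.
  apply: (@cong_eq _ _ (fun e y => dxn i (g j) (y + 1 * e)) _
     (fun e y => dxn i (g j) y + e ^+ 1 * dxn i.+1 (g j) y)).
  - by move=> e y _; rewrite mxE mul1r.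
  - by move=> e y _; rewrite !mxE.
  split; [exact: (bigO_shift 1 Of)| |].
    by apply: bigOD Of _; apply: bigO_leq (bigO_exp 1 Of1).
  apply: bigO_eq (bigO_taylor 2 1 Of) => e y _.
  rewrite /taylor big_ord_recl big_ord1 /= /bump /= mul1r expr0 fact0 factS.
  by rewrite fact0 !divr1 mul1r.
have adjW : mcong 2 (fun _ y => \adj (Wmx y)) (fun _ y => \adj (Wmx y)).
  by apply: mcong_adj; exact: mcong_W.
have AN : mcong 2 A (fun e y => (Wmx y + e *: W1 y) *m \adj (Wmx y)).
  apply: mcong_mul adjW => i j; apply: cong_eq (sh i j) => // e y _.
  by rewrite !mxE.
have ANE e y : (Wmx y + e *: W1 y) *m \adj (Wmx y) = 1%:M + e *: N y.
  by rewrite mulmxDl mulW_adj -scalemxAl.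
have ON i j : bigO 0 (fun _ y => N y i j).
  have := congl (@mcong_mul _ 0 _ _ _ (fun _ => W1) (fun _ => W1) _ _ _
    (fun i j => cong_leq (leq0n 2) (adjW i j)) i j); apply => k l.
  apply: cong_refl; apply: (@bigO_eq _ _ (fun=> dxn k.+1 (g l))).
    by move=> e z _; rewrite mxE.
  by apply: bigO_fun; exact: smth_dxn.
have A1 i j : bigO 2 (fun e y => A e y i j - ((i == j)%:R + e * N y i j)).
  apply: bigO_eq (congB (AN i j)) => e y _; rewrite ANE.
  by rewrite !mxE.
have eN i j : bigO 1 (fun e y => e * N y i j).
  by apply: (bigO_exp 1 (ON i j)).
have A2 i j : bigO 1 (fun e y => A e y i j - (i == j)%:R).
  apply: bigO_eq (bigOD (bigO_leq (leqnSn 1) (A1 i j)) (eN i j)) => e y _.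
  by rewrite opprD addrA subrK.
have detA e y : \det (A e y) = 1.
  rewrite /A det_mulmx Wmx1 mul1r.
  by rewrite -[LHS]mul1r -(Wmx1 y) -det_mulmx mulW_adj det1.
have O1 := bigO_det1 A2.
have O2 : bigO 2 (fun e y => \sum_i (A e y i i - ((i == i)%:R + e * N y i i))).
  by apply: bigO_sum => i _; exact: A1.
have O3 : bigO 2 (fun e y => e * \tr (N y)).
  apply: bigO_eq (bigON (bigOD O1 O2)) => e y _.
  have -> : e * \tr (N y) = \sum_i (A e y i i - 1) -
      \sum_i (A e y i i - ((i == i)%:R + e * N y i i)).
    rewrite /mxtrace mulr_sumr -sumrB; apply: eq_bigr => i _.
    by rewrite eqxx mulr1n; ring.
  by rewrite detA; ring.
have O4 : bigO 1 (fun _ y => \tr (N y)).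
  apply: bigO_eq (bigO_div O3) => e y /andP[e0 _].
  by rewrite mulKf // gt_eqF.
(* tr N does not depend on e, yet it is bounded by C e for all e in the range; hence it is 0. *)
rewrite -NE; have [C C0 HC] := bigO_bound O4 `|x|.
apply/eqP; rewrite -normr_le0; apply/ler_addgt0Pl => h h0; rewrite addr0.
pose e := Num.min 1 (h / (C + 1)).
have C1 : 0 < C + 1 by apply: ltr_wpDl.
have e0 : 0 < e <= 1 by rewrite /e lt_min ge_min ltr01 lexx divr_gt0.
apply: le_trans (HC e x e0 (lexx _)) _; rewrite expr1.
have : e <= h / (C + 1) by rewrite /e ge_min lexx orbT.
rewrite ler_pdivlMr // => He; apply: le_trans He.
by rewrite mulrC ler_wpM2l //; [case/andP: e0 => /ltW|rewrite lerDl].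
Qed.

Definition Fmx e x : 'M[R]_d.+1 := \matrix_(k, j) difn k (fun=> g j) e x.
Definition gdet e x := \det (Fmx e x).
Definition relc e x : 'rV[R]_d.+1 :=
  (\row_j difn d.+1 (fun=> g j) e x) *m \adj (Fmx e x).

(* Cramer's rule for the (d+1)-st difference in the frame [Fmx] of the lower
   ones, cleared of denominators and expanded in the points. *)
Definition rela (m : nat) e x : R :=
  gdet e x * difc R d.+1 m -
  \sum_(k < d.+1) e ^+ (d.+1 - k) * relc e x 0 k * difc R k m.

(** Multiplied by e^(d+1), Cramer's identity becomes a relation between the points, since e^k times
    the k-th difference quotient is a combination of them. This is the origin of the powers
    e^(d+1-k) in [rela]. *)
Lemma relaE e x j : e != 0 ->
  \sum_(m < d.+2) rela m e x * g j (x + m%:R * e) = 0.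
Proof.
move=> e0.
have D (k : nat) : (k <= d.+1)%N -> \sum_(m < d.+2) difc R k m * g j (x + m%:R * e)
    = e ^+ k * difn k (fun=> g j) e x.
  move=> kd; rewrite difnE //.
  rewrite [RHS](big_ord_widen d.+2 (fun m => difc R k m * g j (x + m%:R * e))) //.
  rewrite [RHS]big_mkcond /=; apply: eq_bigr => m _; case: ltnP => // km.
  by rewrite /difc bin_small // mulr0 mul0r.
have -> : \sum_(m < d.+2) rela m e x * g j (x + m%:R * e) =
    gdet e x * (e ^+ d.+1 * difn d.+1 (fun=> g j) e x) -
    \sum_(k < d.+1) e ^+ (d.+1 - k) * relc e x 0 k *
       (e ^+ k * difn k (fun=> g j) e x).
  have -> : \sum_(k < d.+1) e ^+ (d.+1 - k) * relc e x 0 k *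
       (e ^+ k * difn k (fun=> g j) e x) = \sum_(m < d.+2) \sum_(k < d.+1)
       e ^+ (d.+1 - k) * relc e x 0 k * difc R k m * g j (x + m%:R * e).
    rewrite exchange_big /=; apply: eq_bigr => k _.
    rewrite -D; last exact: ltnW (ltn_ord k).
    rewrite mulr_sumr.
    by apply: eq_bigr => m _; rewrite !mulrA.
  rewrite -D // mulr_sumr -sumrB; apply: eq_bigr => m _.
  by rewrite /rela mulrBl; congr (_ - _); rewrite ?mulrA // mulr_suml.
have E : (relc e x *m Fmx e x) 0 j = gdet e x * difn d.+1 (fun=> g j) e x.
  by rewrite /relc -mulmxA mul_adj_mx mul_mx_scalar !mxE.
rewrite mulrCA -E mxE mulr_sumr -sumrB big1 // => k _.
have -> : Fmx e x k j = difn k (fun=> g j) e x by rewrite mxE.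
rewrite -[X in e ^+ X](subnK (ltnW (ltn_ord k))) exprD.
by move: (relc e x 0 k) => r; ring.
Qed.

Lemma Fmx_cong : mcong 1 Fmx (fun _ => Wmx).
Proof.
move=> i j; apply: cong_eq (difn_cong i (sg j)) => e x _; by rewrite mxE.
Qed.

Lemma gdet_cong : cong 1 gdet (fun _ _ => 1).
Proof. by apply: cong_eq (mcong_det Fmx_cong) => // e x _; rewrite Wmx1. Qed.

Lemma relc_cong k : cong 1 (fun e x => relc e x 0 k)
  (fun e x => coords (jet d.+1 x) x 0 k).
Proof.
apply: mcong_mul (mcong_adj Fmx_cong) _ _ => i j.
by apply: cong_eq (difn_cong d.+1 (sg j)) => e x _; rewrite mxE.
Qed.

(** The factor [gdet] is kept: it is 1 only up to O(e), but being common to all m it drops out of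
    the moment conditions. *)
Lemma rela_cong m :
  cong 2 (rela m) (fun e x => difc R d.+1 m * gdet e x).
Proof.
apply: cong_sym; apply: cong_eq (cong_sym (cong_add (n := 2)
  (G := fun e x => - \sum_(k < d.+1) e ^+ (d.+1 - k) * relc e x 0 k * difc R k m)
  (bigOZ (difc R d.+1 m) (congl gdet_cong)) _)).
- by [].
- by move=> e x _; rewrite /rela mulrC.
apply: bigON; apply: bigO_sum => k _.
apply: (@bigO_eq _ _ (fun e x => difc R k m * (e ^+ (d.+1 - k) * relc e x 0 k))).
  by move=> e x _; rewrite mulrC.
apply: bigOZ; have [kd|kd] := ltnP k d; last first.
  (* For k = d the explicit power is only e. The second factor e comes from [relc], which agrees up
     to O(e) with a coordinate that vanishes by [coords_top]. *)
  have -> : k = ord_max by apply/val_inj/eqP; rewrite eqn_leq kd -ltnS ltn_ord.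
  rewrite subSnn; apply: (bigO_exp 1).
  apply: bigO_eq (congB (relc_cong ord_max)) => e x _.
  by rewrite coords_top subr0.
apply: bigO_leq (bigO_exp _ (congl (relc_cong k))).
by rewrite addn0 subSn ?(ltnW kd) // ltnS subn_gt0.
Qed.

End Relation.

(** * Moments of truncated alternating binomial sums *)

Section Moments.
Variables (R : realType) (d : nat).

Lemma natr_bin_left s : s.+1%:R * 'C(d, s.+1)%:R = (d%:R - s%:R) * 'C(d, s)%:R :> R.
Proof.
have [sd|ds] := leqP s d; last by rewrite !bin_small ?mulr0 // ltnW.
by rewrite -natrB // -!natrM mul_bin_left.
Qed.

Lemma natr_bin_diag s : s.+1%:R * 'C(d.+1, s.+1)%:R = d.+1%:R * 'C(d, s)%:R :> R.
Proof. by rewrite -!natrM mul_bin_diag. Qed.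

Let b (m : nat) : R := (-1) ^+ m * 'C(d.+1, m)%:R.

Lemma sum_bin0 s : \sum_(m < s.+1) b m = (-1) ^+ s * 'C(d, s)%:R.
Proof.
elim: s => [|s IH]; first by rewrite big_ord1 /b !bin0.
by rewrite big_ord_recr /= IH /b binS natrD exprS; ring.
Qed.

(** The closed form has denominator d, which is cleared so that the induction stays free of
    division. The inductive step is the pair of absorption identities [natr_bin_left] and
    [natr_bin_diag]; [sum_bin2] works alike with denominator d (d - 1). *)
Lemma sum_bin1 s :
  d%:R * \sum_(m < s.+1) b m * m%:R = d.+1%:R * s%:R * (-1) ^+ s * 'C(d, s)%:R.
Proof.
elim: s => [|s IH]; first by rewrite big_ord1 !mulr0 !mul0r.
rewrite big_ord_recr /= mulrDr IH /b.
transitivity (d.+1%:R * s%:R * (-1) ^+ s * 'C(d, s)%:R +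
  d%:R * (-1) ^+ s.+1 * (s.+1%:R * 'C(d.+1, s.+1)%:R) : R); first by ring.
transitivity (d.+1%:R * (-1) ^+ s.+1 * (s.+1%:R * 'C(d, s.+1)%:R) : R);
  last by ring.
by rewrite natr_bin_left natr_bin_diag exprS; ring.
Qed.

Lemma sum_bin2 s :
  d%:R * (d%:R - 1) * \sum_(m < s.+1) b m * m%:R ^+ 2 =
  s%:R * d.+1%:R * (d%:R * s%:R - 1) * (-1) ^+ s * 'C(d, s)%:R.
Proof.
elim: s => [|s IH]; first by rewrite big_ord1 expr0n !mulr0 !mul0r.
rewrite big_ord_recr /= mulrDr IH /b.
transitivity (s%:R * d.+1%:R * (d%:R * s%:R - 1) * (-1) ^+ s * 'C(d, s)%:R +
  d%:R * (d%:R - 1) * (-1) ^+ s.+1 * s.+1%:R * (s.+1%:R * 'C(d.+1, s.+1)%:R) : R).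
  by ring.
transitivity (d.+1%:R * (d%:R * s.+1%:R - 1) * (-1) ^+ s.+1 *
  (s.+1%:R * 'C(d, s.+1)%:R) : R); last by ring.
by rewrite natr_bin_left natr_bin_diag exprS -natr1; ring.
Qed.

End Moments.

Section Moments2.
Variables (R : realType) (d s : nat).
Hypotheses (hd : (2 <= d)%N) (hs : (1 <= s <= d.-1)%N).

(* Half the second moment, and the shift making the first moment vanish, of the
   normalized weights (-1)^m C(d+1, m), m <= s. *)
Definition kdv_coef : R := s%:R * d.+1%:R * (s%:R - d%:R) / (2 * d%:R ^+ 2 * (d%:R - 1)).
Definition base_shift : R := - (s%:R * d.+1%:R / d%:R).
Definition coef_sum : R := \sum_(m < s.+1) difc R d.+1 m.

Let d0 : d%:R != 0 :> R.
Proof. by rewrite pnatr_eq0 -lt0n ltnW. Qed.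
Let d1 : d%:R - 1 != 0 :> R.
Proof. by rewrite subr_eq0 -[1]/(1%:R) eqr_nat gtn_eqF. Qed.

Lemma kdv_coef_neq0 : kdv_coef != 0.
Proof.
case/andP: hs => s1 s2; have sd : (s < d)%N.
  by apply: leq_ltn_trans s2 _; rewrite prednK // ltnW.
have s0 : s%:R != 0 :> R by rewrite pnatr_eq0 -lt0n.
have sd0 : s%:R - d%:R != 0 :> R by rewrite subr_eq0 eqr_nat ltn_eqF.
by rewrite /kdv_coef !mulf_neq0 // ?pnatr_eq0 // invr_neq0 // !mulf_neq0.
Qed.

Lemma difcE m : difc R d.+1 m = (-1) ^+ d.+1 * ((-1) ^+ m * 'C(d.+1, m)%:R).
Proof. by rewrite /difc exprD mulrA. Qed.

Lemma coef_sumE : coef_sum = (-1) ^+ d.+1 * ((-1) ^+ s * 'C(d, s)%:R).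
Proof.
rewrite -sum_bin0 mulr_sumr; apply: eq_bigr => m _; exact: difcE.
Qed.

Lemma coef_sum_neq0 : coef_sum != 0.
Proof.
rewrite coef_sumE !mulf_neq0 ?signr_eq0 // pnatr_eq0 -lt0n bin_gt0.
by case/andP: hs => _ /leq_trans; apply; exact: leq_pred.
Qed.

Lemma moment1 : \sum_(m < s.+1) difc R d.+1 m * (base_shift + m%:R) = 0.
Proof.
have -> : \sum_(m < s.+1) difc R d.+1 m * (base_shift + m%:R) = base_shift * coef_sum +
    (-1) ^+ d.+1 * \sum_(m < s.+1) ((-1) ^+ m * 'C(d.+1, m)%:R) * m%:R.
  rewrite /coef_sum !mulr_sumr -big_split /=; apply: eq_bigr => m _.
  by rewrite difcE; ring.
apply: (mulfI d0); rewrite mulr0 mulrDr mulrCA [X in _ + X]mulrCA sum_bin1 coef_sumE /base_shift.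
by field.
Qed.

(** The normalized weights have mean s(d+1)/d and second moment s(d+1)(ds-1)/(d(d-1)). Their
    variance is therefore s(d+1)(s-d)/(d^2(d-1)), twice [kdv_coef]; it can be negative because the
    weights alternate in sign. *)
Lemma moment2 : \sum_(m < s.+1) difc R d.+1 m * ((base_shift + m%:R) ^+ 2 / 2 - kdv_coef) = 0.
Proof.
have -> : \sum_(m < s.+1) difc R d.+1 m * ((base_shift + m%:R) ^+ 2 / 2 - kdv_coef) =
    (base_shift ^+ 2 / 2 - kdv_coef) * coef_sum +
    base_shift * ((-1) ^+ d.+1 * \sum_(m < s.+1) ((-1) ^+ m * 'C(d.+1, m)%:R) * m%:R) +
    (-1) ^+ d.+1 / 2 * \sum_(m < s.+1) ((-1) ^+ m * 'C(d.+1, m)%:R) * m%:R ^+ 2.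
  rewrite /coef_sum !mulr_sumr -!big_split /=; apply: eq_bigr => m _.
  by rewrite difcE; field.
have -> : \sum_(m < s.+1) ((-1) ^+ m * 'C(d.+1, m)%:R) * m%:R ^+ 2 =
    s%:R * d.+1%:R * (d%:R * s%:R - 1) * (-1) ^+ s * 'C(d, s)%:R / (d%:R * (d%:R - 1)) :> R.
  by rewrite -sum_bin2; field; rewrite d0 d1.
have -> : \sum_(m < s.+1) ((-1) ^+ m * 'C(d.+1, m)%:R) * m%:R =
    d.+1%:R * s%:R * (-1) ^+ s * 'C(d, s)%:R / d%:R :> R.
  by rewrite -sum_bin1; field.
rewrite coef_sumE /base_shift /kdv_coef -[d.+1%:R]natr1; field.
by rewrite d0 d1.
Qed.

End Moments2.

(** * Rescaled Wronskians and the expansion of the vertex *)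

Section Wronskian.
Variables (R : realType) (n : nat).

(** By the Leibniz rule the matrix of the products is a lower triangular matrix with [f x] on the
    diagonal times the matrix of [h]. *)
Lemma wmatM (f : R -> R) (h : 'I_n -> R -> R) x :
  smth f -> (forall j, smth (h j)) ->
  \det (wmat (fun j y => f y * h j y) x) = f x ^+ n * \det (wmat h x).
Proof.
move=> sf sh.
pose T : 'M[R]_n := \matrix_(k, i) ('C(k, i)%:R * dxn (k - i) f x).
have -> : wmat (fun j y => f y * h j y) x = T *m wmat h x.
  apply/matrixP => k j; rewrite !mxE dxnM //.
  under [RHS]eq_bigr => i _ do rewrite !mxE.
  rewrite (big_ord_widen n
    (fun i => 'C(k, i)%:R * dxn (k - i) f x * dxn i (h j) x)) ?ltn_ord //.
  rewrite big_mkcond /=; apply: eq_bigr => i _.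
  by case: ltnP => // ki; rewrite bin_small // !mul0r.
rewrite det_mulmx det_trig; last first.
  by apply/is_trig_mxP => i j ij; rewrite mxE bin_small // mul0r.
congr (_ * _); rewrite (eq_bigr (fun=> f x)).
  by rewrite prodr_const card_ord.
by move=> i _; rewrite mxE binn subnn mul1r.
Qed.

End Wronskian.

Section Expansion.
Variables (R : realType) (d : nat) (g : 'I_d.+1 -> R -> R).
Hypothesis sg : forall j, smth (g j).
Hypothesis Wg1 : forall x, \det (wmat g x) = 1.

Lemma cong_shift n q (F G : R -> R -> R) : cong n F G ->
  cong n (fun e x => F e (x + q * e)) (fun e x => G e (x + q * e)).
Proof.
case=> OF OG OFG; split; [exact: bigO_shift|exact: bigO_shift|].
exact: (bigO_shift q OFG).
Qed.

Lemma cong_dxn n k (F G : R -> R -> R) : cong n F G ->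
  cong n (fun e => dxn k (F e)) (fun e => dxn k (G e)).
Proof.
case=> OF OG OFG; split; [exact: bigO_dxn|exact: bigO_dxn|].
apply: bigO_eq (bigO_dxn k OFG) => e x he.
have sF := bigO_smth OF he; have sG := bigO_smth OG he.
rewrite (_ : (fun x => F e x - G e x) = fun x => F e x + -1 * G e x).
  rewrite dxnD //; last exact: smthZ.
  by rewrite dxnZ // mulN1r.
by apply/funext => y; rewrite mulN1r.
Qed.

Variables (s : nat) (q c : R) (mu : R).
Hypothesis mu0 : mu != 0.
Hypothesis muE : \sum_(m < s.+1) difc R d.+1 m = mu.
Hypothesis mom1 : \sum_(m < s.+1) difc R d.+1 m * (q + m%:R) = 0.
Hypothesis mom2 : \sum_(m < s.+1) difc R d.+1 m * ((q + m%:R) ^+ 2 / 2 - c) = 0.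

Definition vcoef (m : nat) e x : R := mu^-1 * rela g m e (x + q * e).
Definition vY e x : R := \sum_(m < s.+1) vcoef m e x.
Definition vV j e x : R := \sum_(m < s.+1) vcoef m e x * g j (x + (q + m%:R) * e).

Lemma vcoef_cong m : cong 2 (vcoef m)
  (fun e x => mu^-1 * difc R d.+1 m * gdet g e (x + q * e)).
Proof.
apply: cong_eq (congZ mu^-1 (cong_shift q (rela_cong sg Wg1 m))) => // e x _.
by rewrite mulrA.
Qed.

Lemma vY_cong : cong 1 vY (fun _ _ => 1).
Proof.
have h m : cong 1 (vcoef m) (fun _ _ => mu^-1 * difc R d.+1 m).
  apply: cong_trans (cong_leq (leqnSn 1) (vcoef_cong m)) _.
  apply: cong_eq (congZ (mu^-1 * difc R d.+1 m)
    (cong_shift q (gdet_cong sg Wg1))) => // e x _.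
  by rewrite mulr1.
apply: cong_eq (cong_sum (index_enum 'I_s.+1) h) => // e x _.
by rewrite -mulr_sumr muE mulVf.
Qed.

(** In the three-term Taylor expansion of the points the constant terms add up to exactly [vY],
    which is not expanded further. In the linear terms, and in the quadratic ones after subtraction
    of c, the binomial weights cancel. What remains is the O(e^2) deviation of [vcoef] from them,
    times e or e^2. *)
Lemma vV_cong j : cong 3 (vV j)
  (fun e x => vY e x * (g j x + c * e ^+ 2 * dxn 2 (g j) x)).
Proof.
have Og k : bigO 0 (fun _ : R => dxn k (g j)).
  by apply: bigO_fun; exact: smth_dxn.
have Oa m : bigO 0 (vcoef m) by exact: congl (vcoef_cong m).
have OY : bigO 0 vY by exact: congl vY_cong.
have Oe2 : bigO 0 (fun e x => c * e ^+ 2 * dxn 2 (g j) x).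
  apply: (@bigO_leq _ 0 2) => //.
  apply: bigO_eq (bigOZ c (bigO_exp 2 (Og 2%N))) => e x _.
  by rewrite mulrA.
have Os m : bigO 0 (fun e x => g j (x + (q + m%:R) * e)).
  exact: (bigO_shift (q + m%:R) (Og 0%N)).
split.
- by apply: bigO_sum => m _; exact: bigOM (Oa m) (Os m).
- exact: bigOM OY (bigOD (Og 0%N) Oe2).
pose r m e x := vcoef m e x - mu^-1 * difc R d.+1 m * gdet g e (x + q * e).
have Or m : bigO 2 (r m) by exact: congB (vcoef_cong m).
pose t (m : nat) e x := g j (x + (q + m%:R) * e) - taylor 3 (g j) ((q + m%:R) * e) x.
have Ot m : bigO 3 (t m) by exact: (bigO_taylor 3 (q + m%:R) (Og 0%N)).
have O1 : bigO 3 (fun e x => \sum_(m < s.+1) vcoef m e x * t m e x).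
  by apply: bigO_sum => m _; exact: bigOM (Oa m) (Ot m).
have O2 : bigO 3 (fun e x => \sum_(m < s.+1)
    (q + m%:R) * (e ^+ 1 * (r m e x * dxn 1 (g j) x))).
  by apply: bigO_sum => m _; apply: bigOZ; exact: (bigO_exp 1 (bigOM (Or m) (Og 1%N))).
have O3 : bigO 3 (fun e x => \sum_(m < s.+1)
    ((q + m%:R) ^+ 2 / 2 - c) * (e ^+ 2 * (r m e x * dxn 2 (g j) x))).
  apply: bigO_sum => m _; apply: bigOZ.
  exact: (bigO_leq (isT : 3 <= 4)%N (bigO_exp 2 (bigOM (Or m) (Og 2%N)))).
apply: bigO_eq (bigOD O1 (bigOD O2 O3)) => e x _.
(* Passing from [r] to [vcoef] adds a multiple of the first moment, which vanishes by [mom1]. The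
   same holds in [E2] with [mom2]. *)
have E1 : \sum_(m < s.+1) (q + m%:R) * (e ^+ 1 * (r m e x * dxn 1 (g j) x)) =
    \sum_(m < s.+1) vcoef m e x * ((q + m%:R) * e * dxn 1 (g j) x).
  apply/eqP; rewrite -subr_eq0 -sumrB.
  rewrite (eq_bigr (fun m : 'I_s.+1 => - (mu^-1 * gdet g e (x + q * e) * e *
     dxn 1 (g j) x) * (difc R d.+1 m * (q + m%:R)))).
    by rewrite -mulr_sumr mom1 mulr0.
  by move=> m _; rewrite /r; ring.
have E2 : \sum_(m < s.+1) ((q + m%:R) ^+ 2 / 2 - c) * (e ^+ 2 * (r m e x * dxn 2 (g j) x)) =
    \sum_(m < s.+1) vcoef m e x * (((q + m%:R) ^+ 2 / 2 - c) * e ^+ 2 * dxn 2 (g j) x).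
  apply/eqP; rewrite -subr_eq0 -sumrB.
  rewrite (eq_bigr (fun m : 'I_s.+1 => - (mu^-1 * gdet g e (x + q * e) * e ^+ 2 *
     dxn 2 (g j) x) * (difc R d.+1 m * ((q + m%:R) ^+ 2 / 2 - c)))).
    by rewrite -mulr_sumr mom2 mulr0.
  by move=> m _; rewrite /r; ring.
rewrite E1 E2 /vV /vY mulr_suml -sumrB -!big_split /=.
apply: eq_bigr => m _; rewrite /t /taylor.
rewrite !big_ord_recl big_ord0 /= /bump /= !addn0 !addn1 /=.
rewrite !factS fact0 !expr1 expr0 -[1%:R]/1 -[(2 * (1 * 1))%:R]/(2%:R : R).
by rewrite /dxn /=; field.
Qed.

End Expansion.

(** * The Wronskian of the vertex curve *)

Section WronskianExpansion.
Variables (R : realType) (d : nat) (g : 'I_d.+1 -> R -> R).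
Hypothesis sg : forall j, smth (g j).
Hypothesis Wg1 : forall x, \det (wmat g x) = 1.

Definition frame2 x : 'M[R]_d.+1 :=
  (\matrix_(k < d.+1, j < d.+1) dxn k.+2 (g j) x) *m \adj (wmat g x).

(** The infinitesimal change of the Wronskian under Gamma -> Gamma + h Gamma''. The operator L does
    not enter here; [tau_lax] evaluates the trace once L is given. *)
Definition tau x : R := \tr (frame2 x).

Lemma bigO_frame2 i j : bigO 0 (fun _ x => frame2 x i j).
Proof.
have H k : mcong 0 (fun (_ : R) x => \matrix_(i < d.+1, j < d.+1) dxn (i + k) (g j) x)
    (fun _ x => \matrix_(i < d.+1, j < d.+1) dxn (i + k) (g j) x).
  move=> k' l; apply: cong_refl; apply: (@bigO_eq _ _ (fun=> dxn (k' + k) (g l))).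
    by move=> e z _; rewrite mxE.
  by apply: bigO_fun; exact: smth_dxn.
have := congl (mcong_mul (H 2%N) (mcong_adj (H 0%N)) i j).
apply: bigO_eq => e x _; rewrite /frame2 /wmat; congr ((_ *m \adj _) _ _).
  by apply/matrixP => a b; rewrite !mxE addn2.
by apply/matrixP => a b; rewrite !mxE addn0.
Qed.

Lemma bigO_tau : bigO 0 (fun _ => tau).
Proof. by apply: bigO_sum => i _; exact: bigO_frame2. Qed.

Variables (c : R) (Y : R -> R -> R) (v : 'I_d.+1 -> R -> R -> R).
Hypothesis OY : bigO 0 Y.
Hypothesis vE : forall j, cong 3 (v j)
  (fun e x => Y e x * (g j x + c * e ^+ 2 * dxn 2 (g j) x)).

(** A congruence survives differentiation, so [v j] may be replaced by [Y] times [Z j] inside the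
    Wronskian. Then [wmatM] extracts Y^(d+1), and what is left is det (1 + c e^2 frame2), whose
    expansion has an O(e^4) error by [bigO_det1]. *)
Lemma wronskian_cong : cong 3 (fun e x => \det (wmat (fun j => v j e) x))
  (fun e x => Y e x ^+ d.+1 * (1 + c * e ^+ 2 * tau x)).
Proof.
pose Z j e x := g j x + c * e ^+ 2 * dxn 2 (g j) x.
have OZ j : bigO 0 (Z j).
  apply: bigOD; first exact: bigO_fun.
  apply: (@bigO_leq _ 0 2) => //.
  apply: bigO_eq (bigOZ c (bigO_exp 2 (bigO_fun (smth_dxn 2 (sg j))))) => e x _.
  by rewrite mulrA.
have D1 : cong 3 (fun e x => \det (wmat (fun j => v j e) x))
    (fun e x => \det (wmat (fun j x => Y e x * Z j e x) x)).
  apply: mcong_det => k j.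
  by apply: cong_eq (cong_dxn k (vE j)) => e x _; rewrite mxE.
apply: (cong_trans D1).
pose A e x : 'M[R]_d.+1 := 1%:M + (c * e ^+ 2) *: frame2 x.
have WZ e x : wmat (fun j => Z j e) x = A e x *m wmat g x.
  rewrite /A mulmxDl mul1mx -scalemxAl /frame2 -mulmxA mul_adj_mx Wg1 mulmx1.
  apply/matrixP => k j; rewrite !mxE dxnD //; last exact/smthZ/smth_dxn.
  by rewrite dxnZ; [rewrite /dxn -iterD addn2|exact: smth_dxn].
have OA i j : bigO 2 (fun e x => A e x i j - (i == j)%:R).
  apply: bigO_eq (bigOZ c (bigO_exp 2 (bigO_frame2 i j))) => e x _.
  by rewrite /A !mxE addrAC subrr add0r mulrA.
have OYn : bigO 0 (fun e x => Y e x ^+ d.+1).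
  apply: bigO_eq (bigO_prod (index_enum 'I_d.+1) (fun=> OY)) => e x _.
  by rewrite prodr_const card_ord.
have Ot : bigO 0 (fun e x => 1 + c * e ^+ 2 * tau x).
  apply: bigOD; first exact: bigO_cst.
  apply: (@bigO_leq _ 0 2) => //.
  by apply: bigO_eq (bigOZ c (bigO_exp 2 bigO_tau)) => e x _; rewrite mulrA.
split; [exact: congr D1|exact: bigOM OYn Ot|].
have := bigOM OYn (bigO_det1 OA) => /(bigO_leq (isT : 3 <= 0 + (2 + 2))%N).
apply: bigO_eq => e x he.
rewrite wmatM; last 2 first.
- exact: bigO_smth OY he.
- by move=> j; exact: bigO_smth (OZ j) he.
rewrite WZ det_mulmx Wg1 mulr1 -mulrBr; congr (_ * (_ - (1 + _))).
rewrite /tau /mxtrace mulr_sumr; apply: eq_bigr => i _.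
by rewrite /A !mxE eqxx addrAC subrr add0r.
Qed.

End WronskianExpansion.

(** * Lifts, monodromy and intersections of hyperplanes *)

Section Components.
Variables (R : realType) (n : nat).
Implicit Types (G H : R -> 'rV[R]_n.+1).

Definition coordf G : 'I_n.+1 -> R -> R := fun j x => G x 0 j.

Lemma coordf_dfun G : (forall x, derivable G x 1) <-> forall j, dfun (coordf G j).
Proof.
split=> [dG j|dG x].
  by apply/dfunP => x; have /derivable_mxP := dG x; apply.
by apply/derivable_mxP => i j; rewrite (ord1 i); have /dfunP := dG j; apply.
Qed.

Lemma coordf_derive1 G j : (forall x, derivable G x 1) ->
  coordf G^`() j = dx (coordf G j).
Proof.
move=> dG; apply/funext => x.
by rewrite /coordf derive1E derive_mx // mxE dxE derive1E.
Qed.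

Lemma smooth_coordf G : smooth G <-> forall j, smth (coordf G j).
Proof.
split=> [sG j|sG].
  constructor=> k; elim: k G sG => //= k IH G sG.
  have dG x : derivable G x 1 by exact: (sG 0%N).
  split; first exact: (coordf_dfun G).1.
  by rewrite -coordf_derive1 //; apply: IH => m x; rewrite -derive1Sn; exact: sG.
move=> k; elim: k G sG => [|k IH] G sG x.
  by apply: (coordf_dfun G).2 => j; exact: smth_dfun.
rewrite derive1Sn; apply: IH => j.
rewrite coordf_derive1; first exact: smth_dx.
by apply: (coordf_dfun G).2 => i; exact: smth_dfun.
Qed.

Lemma coordf_derive1n G k j : smooth G -> coordf G^`(k) j = dxn k (coordf G j).
Proof.
move=> sG; elim: k => // k IH.
by rewrite derive1nS coordf_derive1 ?IH // => x; exact: (sG k).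
Qed.

Lemma wronskianE G x : smooth G -> wronskian G x = \det (wmat (coordf G) x).
Proof.
move=> sG; congr (\det _); apply/matrixP => k j.
by rewrite !mxE -coordf_derive1n.
Qed.

Lemma coordf_mulmx G (M : 'M[R]_n.+1) j : smooth G ->
  smth (coordf (fun x => G x *m M) j) /\
  forall k, dxn k (coordf (fun x => G x *m M) j) =
    fun x => \sum_i dxn k (coordf G i) x * M i j.
Proof.
move=> /smooth_coordf sG.
have E : coordf (fun x => G x *m M) j = fun x => \sum_i M i j * coordf G i x.
  apply/funext => x; rewrite /coordf mxE; apply: eq_bigr => i _.
  by rewrite mulrC.
have s i : smth (fun x => M i j * coordf G i x) by apply: smthZ.
split=> [|k]; first by rewrite E; apply: smth_sum.
rewrite E dxn_sum //; apply/funext => x; apply: eq_bigr => i _.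
by rewrite dxnZ // mulrC.
Qed.

Lemma smooth_mulmx G (M : 'M[R]_n.+1) : smooth G -> smooth (fun x => G x *m M).
Proof. by move=> sG; apply/smooth_coordf => j; have [] := coordf_mulmx M j sG. Qed.

Lemma wmat_mulmx G (M : 'M[R]_n.+1) x : smooth G ->
  wmat (coordf (fun x => G x *m M)) x = wmat (coordf G) x *m M.
Proof.
move=> sG; apply/matrixP => k j; rewrite !mxE (coordf_mulmx M j sG).2.
by apply: eq_bigr => i _; rewrite !mxE.
Qed.

Lemma coordf_scale (f : R -> R) G j :
  coordf (fun x => f x *: G x) j = fun x => f x * coordf G j x.
Proof. by apply/funext => x; rewrite /coordf mxE. Qed.

Lemma smooth_scale (f : R -> R) G : smth f -> smooth G ->
  smooth (fun x => f x *: G x).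
Proof.
move=> sf /smooth_coordf sG; apply/smooth_coordf => j; rewrite coordf_scale.
exact: smthM.
Qed.

Lemma det_wmat_scale (f : R -> R) G x : smth f -> smooth G ->
  \det (wmat (coordf (fun x => f x *: G x)) x) =
  f x ^+ n.+1 * \det (wmat (coordf G) x).
Proof.
move=> sf /smooth_coordf sG; rewrite -wmatM //; congr (\det _).
by apply/matrixP => k j; rewrite !mxE coordf_scale.
Qed.

Lemma wmat_neq0 G x : \det (wmat (coordf G) x) != 0 -> G x != 0.
Proof.
apply: contraNneq => G0; rewrite (expand_det_row _ ord0) big1 // => j _.
by rewrite mxE /= /coordf G0 mxE mul0r.
Qed.

(** The factor is recovered as the quotient of the Euclidean products of G with H and of H with H,
    which shows that it is smooth. *)
Lemma proportional G H : smooth G -> smooth H -> (forall x, H x != 0) ->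
  (forall x, <[G x]>%VS = <[H x]>%VS) ->
  exists f, [/\ smth f, forall x, G x = f x *: H x & forall x, f x != 0].
Proof.
move=> /smooth_coordf sG /smooth_coordf sH H0 GH.
pose N x := \sum_j coordf H j x * coordf H j x.
have N0 x : 0 < N x.
  rewrite lt_neqAle; apply/andP; split; last first.
    by apply: sumr_ge0 => j _; rewrite -expr2 sqr_ge0.
  apply: contra (H0 x) => /eqP/esym N0; apply/eqP/rowP => j; rewrite mxE.
  have /psumr_eq0P := N0 => /(_ (fun i _ => sqr_ge0 (coordf H i x))) /(_ j isT) /eqP.
  by rewrite mulf_eq0 orbb => /eqP.
have cE x : exists2 c, G x = c *: H x & c != 0.
  have /vlineP[c Gc] : G x \in <[H x]>%VS by rewrite -GH memv_line.
  exists c => //; apply: contraNneq (H0 x) => c0.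
  have : H x \in <[G x]>%VS by rewrite GH memv_line.
  rewrite Gc c0 scale0r => /vlineP[k ->]; by rewrite scaler0.
exists (fun x => (\sum_j coordf G j x * coordf H j x) * (N x)^-1).
have fE x c : G x = c *: H x ->
    (\sum_j coordf G j x * coordf H j x) * (N x)^-1 = c.
  move=> Gc; rewrite (eq_bigr (fun j => c * (coordf H j x * coordf H j x))).
    by rewrite -mulr_sumr -/(N x) mulfK // gt_eqF.
  by move=> j _; rewrite {1}/coordf Gc mxE mulrA.
split=> [|x|x].
- apply: smthM; first by apply: smth_sum => j; apply: smthM.
  by apply: smthV => //; apply: smth_sum => j; apply: smthM.
- by have [c Gc _] := cE x; rewrite (fE x c Gc).
- by have [c Gc c0] := cE x; rewrite (fE x c Gc).
Qed.

Lemma continuous_same_sign (f : R -> R) : continuous f -> (forall x, f x != 0) ->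
  forall x y, 0 < f x -> 0 < f y.
Proof.
move=> cf f0 x y fx; rewrite ltNge; apply/negP; rewrite le_eqVlt (negbTE (f0 y)) /=.
move=> fy.
have I a b : a <= b -> Num.min (f a) (f b) <= 0 <= Num.max (f a) (f b) -> False.
  move=> ab fab; have cab := continuous_subspaceT (A := `[a, b]%classic) cf.
  have [c _ fc] := IVT ab cab fab.
  by have := f0 c; rewrite fc eqxx.
have [xy|yx] := leP x y.
  by apply: (I _ _ xy); rewrite ge_min le_max (ltW fx) (ltW fy) orbT.
by apply: (I _ _ (ltW yx)); rewrite ge_min le_max (ltW fx) (ltW fy) orbT.
Qed.

(** A priori the projective monodromy only gives G(x + 2 pi) = f(x) G(x) M. Comparing Wronskians
    yields f^(n+1) det M = 1, so f^(n+1) is constant; f never vanishes and is continuous, hence has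
    constant sign and is itself constant. *)
Lemma monodromy_lift (gam : R -> projpoint R n) G M :
  has_monodromy gam M -> normalized_lift (fun x => line (gam x)) G ->
  exists2 M', \det M' = 1 & forall x, G (x + 2 * pi) = G x *m M'.
Proof.
move=> [Mu gM] [sG lG WG].
have G0 x : G x != 0.
  by apply: wmat_neq0; rewrite -(wronskianE _ sG) WG oner_neq0.
pose G2 x := G (x + 2 * pi).
have sG2 : smooth G2.
  apply/smooth_coordf => j.
  exact: (smth_shift (2 * pi) ((smooth_coordf G).1 sG j)).
have GM0 x : G x *m M != 0.
  apply: contraNneq (G0 x) => GM; have := congr1 (mulmxr (invmx M)) GM.
  by rewrite /= mulmxK // mul0mx => ->.
have E x : <[G2 x]>%VS = <[G x *m M]>%VS.
  rewrite /G2 lG gM /projact -lG limg_line; congr <[_]>%VS.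
  by rewrite lfunE.
have [f [sf fE f0]] := proportional sG2 (@smooth_mulmx G M sG) GM0 E.
have fM x : f x ^+ n.+1 * \det M = 1.
  have -> : \det M = \det (wmat (coordf (fun x => G x *m M)) x).
    by rewrite (wmat_mulmx _ _ sG) det_mulmx -(wronskianE _ sG) WG mul1r.
  rewrite -(det_wmat_scale x sf (@smooth_mulmx G M sG)).
  rewrite (_ : (fun x => _) = G2); last by apply/funext => y; rewrite fE.
  rewrite -(WG (x + 2 * pi)) (wronskianE _ sG); congr (\det _).
  apply/matrixP => k j; rewrite !mxE /G2.
  have -> : coordf (fun x => G (x + 2 * pi)) j = fun x => coordf G j (x + 2 * pi) by [].
  by rewrite (dxn_shift _ _ ((smooth_coordf G).1 sG j)).
have fc x : f x = f 0.
  have ff : 0 < f x / f 0.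
    have : continuous (fun x => f x / f 0).
      apply: smth_continuous; apply: smthM => //; exact: smth_cst.
    move/continuous_same_sign => /(_ _ 0 x); rewrite divff //; apply => // y.
    by rewrite mulf_neq0 ?invr_eq0.
  have : (f x / f 0) ^+ n.+1 = 1.
    rewrite expr_div_n; have := fM x; rewrite -(fM 0) => /mulIf -> //.
      by rewrite divff // expf_neq0.
    by move: Mu; rewrite unitmxE unitfE.
  move/eqP; rewrite pexpr_eq1 ?ltW // => /eqP H.
  by rewrite -[LHS](divfK (f0 0)) H mul1r.
exists (f 0 *: M); first by rewrite detZ fM.
by move=> x; rewrite -/(G2 x) fE fc scalemxAr.
Qed.

End Components.

(** * Intersections of windows of consecutive points *)

Section Windows.
Variables (K : fieldType) (d : nat) (P : nat -> 'rV[K]_d.+1).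

Definition seg a n := [seq P k | k <- iota a n].

Hypothesis freeP : forall a, free (seg a d.+1).

Lemma free_seg a n : (n <= d.+1)%N -> free (seg a n).
Proof.
move=> nd; have := freeP a; rewrite /seg -[X in iota a X](subnKC nd) iotaD map_cat.
exact: catl_free.
Qed.

Lemma span_seg_sub a n b m : (b <= a)%N -> (a + n <= b + m)%N ->
  (<<seg a n>> <= <<seg b m>>)%VS.
Proof.
move=> ba nm; apply: sub_span => x /mapP[k]; rewrite mem_iota => /andP[ak kn] ->.
by apply: map_f; rewrite mem_iota (leq_trans ba) //= (leq_trans kn).
Qed.

(** If v lies in the span of P_r, ..., P_(d-1) and also in the window starting at r + 1, its
    coefficient at P_r vanishes, because P_r, ..., P_(r+d) are independent. The span thus shrinks
    point by point to 0. *)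
Lemma cap_windows v : (forall i, (i <= d)%N -> v \in <<seg i d>>%VS) -> v = 0.
Proof.
move=> vH.
suff H r : (r <= d)%N -> v \in <<seg r (d - r)>>%VS.
  by have := H d (leqnn d); rewrite subnn span_nil memv0 => /eqP.
elim: r => [|r IH] rd; first by rewrite subn0; apply: vH.
have := IH (ltnW rd); rewrite -(subnSK rd) /seg /= span_cons.
move=> /memv_addP[u /vlineP[k ->] [w wS vE]].
have wH : w \in <<seg r.+1 d>>%VS.
  by apply: subvP wS; apply: span_seg_sub => //; rewrite leq_add2l leq_subr.
have : k *: P r \in <<seg r.+1 d>>%VS.
  by rewrite -(addrK w (k *: P r)) -vE memvB // vH.
have := freeP r; rewrite /seg /= free_cons => /andP[Pr _].
have [k0|k0] := eqVneq k 0; first by rewrite vE k0 scale0r add0r.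
move=> PH; move: Pr; rewrite -/(seg _ _) -[P r](scalerK k0).
by rewrite memvZ.
Qed.

(* A window is a hyperplane and all d+1 windows meet in 0, so d of them meet
   in at most a line. *)
Lemma cap_windows_line t V : (t <= d)%N -> V != 0 ->
  (forall i, (i <= d)%N -> i != t -> V \in <<seg i d>>%VS) ->
  (\bigcap_(i < d) <<seg (bump t i) d>>)%VS = <[V]>%VS.
Proof.
move=> td V0 VH; set U := (\bigcap_(i < d) _)%VS.
have bd (i : 'I_d) : (bump t i <= d)%N.
  have := ltn_ord i; rewrite /bump; case: (t <= i)%N => //.
  by rewrite add0n => /ltnW.
have VU : (<[V]> <= U)%VS.
  apply/subv_bigcapP => i _; rewrite -memvE; apply: VH => //.
  by rewrite eq_sym neq_bump.
apply/esym/eqP; rewrite eqEdim VU dim_vline V0 /=.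
have cap0 : (U :&: <<seg t d>>)%VS = 0%VS.
  apply/eqP; rewrite -subv0; apply/subvP => v; rewrite memv_cap => /andP[vU vt].
  rewrite memv0; apply/eqP; apply: cap_windows => i id.
  have [->//|it] := eqVneq i t.
  have jd : (unbump t i < d)%N.
    rewrite /unbump; have [ti|ti] /= := ltnP t i.
      by rewrite subn1 prednK // (leq_ltn_trans _ ti).
    by rewrite subn0 (leq_trans _ td) // ltn_neqAle it.
  have /subv_bigcapP /(_ (Ordinal jd) isT) : (U <= U)%VS by [].
  by move=> /subvP /(_ v vU); rewrite /= unbumpK.
have := dimv_sum_cap U <<seg t d>>.
rewrite cap0 dimv0 addn0 (eqP (free_seg t (leqnSn d))) size_map size_iota.
move=> dE; rewrite -(leq_add2r d) -dE add1n.
by have := dimvS (subvf (U + <<seg t d>>)); rewrite dimvf /dim /= mul1n.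
Qed.

End Windows.

(** * Normalization and expansion *)

Section PointwiseO.
Variables (R : realType) (D : R -> R -> Prop).
Hypothesis D01 : forall e x, D e x -> 0 < e <= 1.

(** The normalizing factor is known only point by point, through an algebraic equation, so its
    estimates carry no x-derivatives. [D] is the set of pairs (e, x) for which the estimate is
    claimed. *)
Definition ptO n (F : R -> R -> R) :=
  exists2 C, 0 <= C & forall e x, D e x -> `|F e x| <= C * e ^+ n.

Lemma ptOD n F G : ptO n F -> ptO n G -> ptO n (fun e x => F e x + G e x).
Proof.
move=> [C C0 HC] [C' C'0 HC']; exists (C + C'); first exact: addr_ge0.
by move=> e x De; apply: le_trans (ler_normD _ _) _; rewrite mulrDl lerD ?HC ?HC'.
Qed.

Lemma ptOM n m F G : ptO n F -> ptO m G -> ptO (n + m) (fun e x => F e x * G e x).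
Proof.
move=> [C C0 HC] [C' C'0 HC']; exists (C * C'); first exact: mulr_ge0.
by move=> e x De; rewrite normrM exprD mulrACA ler_pM ?HC ?HC'.
Qed.

Lemma ptO_leq n m F : (n <= m)%N -> ptO m F -> ptO n F.
Proof.
move=> nm [C C0 HC]; exists C => // e x De; apply: le_trans (HC e x De) _.
have /andP[e0 e1] := D01 De.
by rewrite ler_wpM2l // ler_wiXn2l // ltW.
Qed.

Lemma ptO_le n F G : (forall e x, D e x -> `|F e x| <= `|G e x|) ->
  ptO n G -> ptO n F.
Proof.
move=> FG [C C0 HC]; exists C => // e x De.
exact: le_trans (FG e x De) (HC e x De).
Qed.

Lemma ptO_eq n F G : (forall e x, D e x -> F e x = G e x) -> ptO n F -> ptO n G.
Proof. by move=> FG; apply: ptO_le => e x De; rewrite FG. Qed.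

Lemma ptO_cst (B : R) : ptO 0 (fun _ _ => B).
Proof. by exists `|B| => // e x _; rewrite mulr1. Qed.

Lemma ptO_norm n F : ptO n F -> ptO n (fun e x => `|F e x|).
Proof. by apply: ptO_le => e x _; rewrite normr_id. Qed.

Lemma bigO_ptO n F A : (forall e x, D e x -> `|x| <= A) -> bigO n F -> ptO n F.
Proof.
move=> DA OF; have [C C0 HC] := bigO_bound OF A.
by exists C => // e x De; apply: HC (D01 De) (DA _ _ De).
Qed.

End PointwiseO.

(** * Expansion of the normalizing root *)

Section Root.
Variable R : realType.

Lemma bigO_small (F : R -> R -> R) A h : bigO 1 F -> 0 < h ->
  exists2 e1, 0 < e1 <= 1 & forall e x, 0 < e < e1 -> `|x| <= A -> `|F e x| <= h.
Proof.
move=> OF h0; have [C C0 HC] := bigO_bound OF A.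
have C1 : 0 < C + 1 by apply: ltr_wpDl.
exists (Num.min 1 (h / (C + 1))).
  by rewrite lt_min ge_min ltr01 lexx divr_gt0.
move=> e x /andP[e0]; rewrite lt_min => /andP[e1 eh] xA.
apply: le_trans (HC e x _ xA) _; first by rewrite e0 ltW.
rewrite expr1; move: eh; rewrite ltr_pdivlMr // => /ltW eh; apply: le_trans eh.
by rewrite mulrC ler_wpM2l ?ltW // ltrDl.
Qed.

Lemma bernoulli_expand m : exists2 K : R, 0 <= K &
  forall y : R, `|y| <= 1 -> `|(1 + y) ^+ m - (1 + m%:R * y)| <= K * y ^+ 2.
Proof.
elim: m => [|m [K K0 HK]].
  by exists 0 => // y _; rewrite expr0 mul0r addr0 subrr normr0 mul0r.
exists (2 * K + m%:R); first by rewrite addr_ge0 // mulr_ge0.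
move=> y y1.
have -> : (1 + y) ^+ m.+1 - (1 + m.+1%:R * y) =
    (1 + y) * ((1 + y) ^+ m - (1 + m%:R * y)) + m%:R * y ^+ 2.
  by rewrite exprS -natr1; ring.
apply: le_trans (ler_normD _ _) _; rewrite [leRHS]mulrDl; apply: lerD; last first.
  by rewrite ger0_norm // mulr_ge0 // sqr_ge0.
rewrite normrM -mulrA; apply: ler_pM => //; last exact: HK.
by apply: le_trans (ler_normD _ _) _; rewrite normr1 -[2]/(1 + 1) lerD2l.
Qed.

(** With N = n + 1 and r = 1 - z/N, the difference p^N - r^N is O(z^2 + |h|) by [bernoulli_expand].
    It factors as p - r times a sum of nonnegative terms containing r^n, which is at least
    2^(-n). *)
Lemma root_expand n : exists2 K : R, 0 <= K & forall z h p : R,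
  `|z| <= 4^-1 -> `|h| <= 4^-1 -> 0 < p -> p ^+ n.+1 * (1 + z + h) = 1 ->
  `|p - (1 - z / n.+1%:R)| <= K * (z ^+ 2 + `|h|).
Proof.
have [K K0 HK] := bernoulli_expand n.+1.
(* The factor 2 K + 4 bounds the numerator of p^N - r^N, the next 2 comes from 1 + z + h >= 1/2, and
   2^n from the lower bound for the cofactor of p - r. *)
exists ((2 * K + 4) * 2 * 2 ^+ n).
  by rewrite !mulr_ge0 ?exprn_ge0 // addr_ge0 // mulr_ge0.
move=> z h p z4 h4 p0 pE.
set N : R := n.+1%:R; have N1 : 1 <= N by rewrite ler1n.
have N0 : N != 0 by rewrite pnatr_eq0.
set y := - (z / N); set r := 1 - z / N; rewrite -/N in z4 *.
have yz : `|y| <= `|z|.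
  by rewrite normrN normrM normfV [`|N|]ger0_norm ?ler_pdivrMr ?ler_peMr //;
     apply: le_trans N1 => //.
have y4 : `|y| <= 4^-1 by apply: le_trans yz z4.
have r2 : 2^-1 <= r.
  have : - `|y| <= y by rewrite lerNl -normrN ler_norm.
  by rewrite /r -/y; lra.
have u2 : 2^-1 <= 1 + z + h.
  have : - `|z| <= z by rewrite lerNl -normrN ler_norm.
  have : - `|h| <= h by rewrite lerNl -normrN ler_norm.
  by lra.
have u0 : 0 < 1 + z + h by lra.
have r0 : 0 < r by lra.
pose k := r ^+ n.+1 - (1 - z).
have kz : `|k| <= K * z ^+ 2.
  apply: (@le_trans _ _ (K * y ^+ 2)).
    have -> : k = (1 + y) ^+ n.+1 - (1 + n.+1%:R * y).
      by rewrite /k /r /y -/N; congr (_ - _); field.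
    by apply: HK; apply: le_trans y4 _; rewrite invf_le1 ?ler1n.
  rewrite ler_wpM2l // -(real_normK (num_real y)) -(real_normK (num_real z)).
  by rewrite lerXn2r // nnegrE.
have uu : `|1 + z + h| <= 2.
  have := ler_normD (1 + z) h; have := ler_normD 1 z; rewrite normr1; lra.
have E1 : `|p ^+ n.+1 - r ^+ n.+1| <= (2 * K + 4) * 2 * (z ^+ 2 + `|h|).
  have -> : p ^+ n.+1 - r ^+ n.+1 =
      (z ^+ 2 - k * (1 + z + h) - (1 - z) * h) / (1 + z + h).
    have -> : p ^+ n.+1 = (1 + z + h)^-1.
      by rewrite -[LHS](mulfK (lt0r_neq0 u0)) pE mul1r.
    have -> : r ^+ n.+1 = k + (1 - z) by rewrite /k subrK.
    by field; rewrite gt_eqF.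
  rewrite normrM normfV ler_pdivrMr ?normr_gt0 ?gt_eqF //.
  have z1 : `|1 - z| <= 2 by have := ler_normB 1 z; rewrite normr1; lra.
  have t1 : `|k * (1 + z + h)| <= K * z ^+ 2 * 2 by rewrite normrM ler_pM.
  have t2 : `|(1 - z) * h| <= 2 * `|h| by rewrite normrM ler_pM.
  have t3 : `|z ^+ 2| = z ^+ 2 by rewrite ger0_norm // sqr_ge0.
  apply: (@le_trans _ _ (z ^+ 2 + K * z ^+ 2 * 2 + 2 * `|h|)).
    have := ler_normB (z ^+ 2 - k * (1 + z + h)) ((1 - z) * h).
    have := ler_normB (z ^+ 2) (k * (1 + z + h)).
    by lra.
  have zz : 0 <= z ^+ 2 by exact: sqr_ge0.
  have hh : 0 <= `|h| by [].
  have Kz : 0 <= K * z ^+ 2 by exact: mulr_ge0.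
  have Kh : 0 <= K * `|h| by exact: mulr_ge0.
  have un : 2^-1 <= `|1 + z + h| by rewrite gtr0_norm.
  apply: (@le_trans _ _ ((2 * K + 4) * 2 * (z ^+ 2 + `|h|) * 2^-1)); last first.
    by rewrite ler_wpM2l // !mulr_ge0 // addr_ge0 // mulr_ge0.
  by nra.
have S : 2^-1 ^+ n <= \sum_(i < n.+1) p ^+ (n.+1.-1 - i) * r ^+ i.
  rewrite big_ord_recr /= subnn expr0 mul1r.
  apply: (@le_trans _ _ (r ^+ n)); first by rewrite lerXn2r // nnegrE ?ltW //; lra.
  by rewrite lerDr sumr_ge0 // => i _; rewrite mulr_ge0 // exprn_ge0 // ltW.
move: E1; rewrite subrXX normrM => E1.
have Sn : 2^-1 ^+ n <= `|\sum_(i < n.+1) p ^+ (n.+1.-1 - i) * r ^+ i|.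
  exact: le_trans S (ler_norm _).
have := le_trans (ler_wpM2l (normr_ge0 (p - r)) Sn) E1.
rewrite -ler_pdivlMr; last by rewrite exprn_gt0 // invr_gt0.
rewrite exprVn invrK => /le_trans; apply.
by rewrite le_eqVlt; apply/orP; left; apply/eqP; ring.
Qed.

End Root.

(** * Expansion of the normalized vertex *)

Section Core.
Variables (R : realType) (d : nat) (g : 'I_d.+1 -> R -> R).
Hypothesis sg : forall j, smth (g j).
Hypothesis Wg1 : forall x, \det (wmat g x) = 1.
Variables (c : R) (Y : R -> R -> R) (v : 'I_d.+1 -> R -> R -> R).
Hypothesis Y1 : cong 1 Y (fun _ _ => 1).
Hypothesis vE : forall j, cong 3 (v j)
  (fun e x => Y e x * (g j x + c * e ^+ 2 * dxn 2 (g j) x)).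
Local Notation W e x := (\det (wmat (fun j => v j e) x)).

(** The product phi = f Y satisfies phi^(d+1) (1 + z + h) = 1 with z = c e^2 tau and h = O(e^3), so
    phi = 1 - z/(d+1) + O(e^3) by [root_expand]. Since f v = phi (g + c e^2 g'') + O(e^3), the
    factor Y, known only to first order, has disappeared. *)
Lemma expansion_core (A : R) : exists2 C, 0 <= C &
  exists2 e1, 0 < e1 & forall e x f, 0 < e < e1 -> `|x| <= A -> 0 < f ->
    f ^+ d.+1 * W e x = 1 -> forall j,
    `|f * v j e x - (g j x + e ^+ 2 * (c * dxn 2 (g j) x -
       c / d.+1%:R * tau g x * g j x))| <= C * e ^+ 3.
Proof.
have OY := congl Y1.
pose z e x := c * e ^+ 2 * tau g x.
have Oz : bigO 2 z.
  apply: bigO_eq (bigOZ c (bigO_exp 2 (bigO_tau sg))) => e x _.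
  by rewrite mulrA.
pose w e x := W e x - Y e x ^+ d.+1 * (1 + z e x).
have Ow : bigO 3 w by exact: congB (wronskian_cong sg Wg1 OY vE).
have i2 : 0 < 2^-1 :> R by rewrite invr_gt0.
have i4 : 0 < 4^-1 :> R by rewrite invr_gt0.
(* The threshold for [w] that keeps w / Y^(d+1) below 1/4 as long as Y >= 1/2. *)
have b0 : 0 < 4^-1 * 2^-1 ^+ d.+1 :> R by rewrite mulr_gt0 // exprn_gt0.
have [e1 /andP[e10 e11] H1] := bigO_small A (congB Y1) i2.
have [e2 /andP[e20 e21] H2] := bigO_small A (bigO_leq (leqnSn 1) Oz) i4.
have [e3 /andP[e30 e31] H3] := bigO_small A (bigO_leq (isT : 1 <= 3)%N Ow) b0.
have [K K0 HK] := root_expand R d.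
pose e0 := Num.min e1 (Num.min e2 e3).
have e00 : 0 < e0 by rewrite !lt_min e10 e20.
pose D e x := exists2 f, [/\ 0 < e < e0, `|x| <= A & 0 < f] & f ^+ d.+1 * W e x = 1.
(* The positive roots are collected into one function of (e, x), to which the calculus of [ptO]
   applies. Uniqueness of the positive (d+1)-st root identifies it in the end with the given factor;
   0 is a default outside [D]. *)
have : forall ex : R * R, exists r : R, D ex.1 ex.2 ->
    0 < r /\ r ^+ d.+1 * W ex.1 ex.2 = 1.
  move=> ex; have [[r [_ _ r0] rE]|nD] := pselect (D ex.1 ex.2); first by exists r.
  by exists 0.
move=> /choice[f fP].
have De e x : D e x -> [/\ 0 < e <= 1, 0 < e < e1, 0 < e < e2, 0 < e < e3 & `|x| <= A].
  move=> [r [/andP[ep]]]; rewrite !lt_min => /and3P[h1 h2 h3] xA _ _.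
  by rewrite ep h1 h2 h3 xA /= (ltW (lt_le_trans h1 e11)).
have D01 e x : D e x -> 0 < e <= 1 by case/De.
have DA e x : D e x -> `|x| <= A by case/De.
have Yb e x : D e x -> 2^-1 <= Y e x.
  move=> /De[_ he _ _ xA]; have := H1 e x he xA.
  by rewrite ler_norml => /andP[+ _]; lra.
pose h e x := w e x / Y e x ^+ d.+1.
have Yinv e x : D e x -> `|(Y e x)^-1| <= 2.
  move=> hD; have Yh := Yb e x hD.
  rewrite gtr0_norm ?invr_gt0; last by lra.
  by rewrite -[2]invrK lef_pV2 // posrE; lra.
have pYinv k : ptO D 0 (fun e x => (Y e x)^-1 ^+ k).
  exists (2 ^+ k) => [|e x hD]; first by rewrite exprn_ge0.
  by rewrite mulr1 normrX lerXn2r ?nnegrE // Yinv.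
have pB n F : bigO n F -> ptO D n F by exact: (bigO_ptO D01 DA).
have ph : ptO D 3 h.
  by apply: ptO_eq (ptOM (pB _ _ Ow) (pYinv d.+1)) => e x _; rewrite exprVn.
have h4 e x : D e x -> `|h e x| <= 4^-1.
  move=> hD; have [_ _ _ he xA] := De _ _ hD.
  rewrite normrM -exprVn normrX.
  apply: (@le_trans _ _ (4^-1 * 2^-1 ^+ d.+1 * 2 ^+ d.+1)).
    by apply: ler_pM => //; [exact: H3|rewrite lerXn2r ?nnegrE // Yinv].
  by rewrite -mulrA -exprMn mulVf // expr1n mulr1.
pose phi e x := f (e, x) * Y e x.
pose th e x := phi e x - (1 - z e x / d.+1%:R).
have pth : ptO D 3 th.
  have pz2 : ptO D 4 (fun e x => z e x * z e x).
    exact: (ptOM (pB _ _ Oz) (pB _ _ Oz)).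
  have p3 : ptO D 3 (fun e x => K * (z e x * z e x + `|h e x|)).
    apply: (ptOM (n := 0)); first exact: ptO_cst.
    by apply: ptOD; [exact: (ptO_leq D01 _ pz2)|exact: ptO_norm].
  apply: ptO_le p3 => e x hD.
  have [_ _ he _ xA] := De _ _ hD; have [f0 fE] := fP (e, x) hD.
  have Yp : 0 < Y e x by have := Yb e x hD; lra.
  rewrite [leRHS]ger0_norm; last first.
    by rewrite mulr_ge0 // addr_ge0 // -expr2 sqr_ge0.
  rewrite -expr2; apply: HK; [exact: H2|exact: h4|exact: mulr_gt0|].
  rewrite -[RHS]fE /phi exprMn -mulrA; congr (_ * _).
  by rewrite /h /w /=; field; rewrite expf_neq0 // gt_eqF.
have pf : ptO D 0 (fun e x => f (e, x)).
  have : ptO D 0 (fun e x => (th e x + (1 - z e x / d.+1%:R)) * (Y e x)^-1 ^+ 1).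
    apply: (ptOM (n := 0) (m := 0)) => //; apply: ptOD.
      exact: (ptO_leq D01 _ pth).
    apply: pB; apply: bigOB; first exact: bigO_cst.
    apply: bigO_eq (bigOZ d.+1%:R^-1 (bigO_leq (leq0n 2) Oz)) => e x _.
    by rewrite mulrC.
  apply: ptO_eq => e x hD; rewrite /th subrK /phi expr1 mulfK //.
  by have := Yb e x hD => Yh; rewrite gt_eqF //; lra.
have pall j : ptO D 3 (fun e x => f (e, x) * v j e x -
    (g j x + e ^+ 2 * (c * dxn 2 (g j) x - c / d.+1%:R * tau g x * g j x))).
  have Og k : bigO 0 (fun _ : R => dxn k (g j)).
    by apply: bigO_fun; exact: smth_dxn.
  have p1 := ptOM pf (pB _ _ (congB (vE j))).
  have p2 : ptO D 3 (fun e x => th e x * (g j x + c * e ^+ 2 * dxn 2 (g j) x)).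
    apply: (ptOM (m := 0) pth); apply: pB; apply: bigOD; first exact: Og 0%N.
    apply: (@bigO_leq _ 0 2) => //.
    apply: bigO_eq (bigOZ c (bigO_exp 2 (Og 2%N))) => e x _.
    by rewrite mulrA.
  have p3 : ptO D 3 (fun e x => - (c / d.+1%:R) * (z e x * (e ^+ 2 * dxn 2 (g j) x))).
    apply: pB; apply: bigOZ; apply: (@bigO_leq _ 3 4) => //.
    exact: (bigOM Oz (bigO_exp 2 (Og 2%N))).
  apply: ptO_eq (ptOD p1 (ptOD p2 p3)) => e x hD.
  have dn : d.+1%:R != 0 :> R by rewrite pnatr_eq0.
  by rewrite /th /phi /z; field.
pose C j := sval (cid2 (pall j)).
have CP j : 0 <= C j /\ forall e x, D e x -> `|f (e, x) * v j e x -
    (g j x + e ^+ 2 * (c * dxn 2 (g j) x - c / d.+1%:R * tau g x * g j x))|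
    <= C j * e ^+ 3.
  by rewrite /C; case: cid2.
exists (\sum_j C j); first by apply: sumr_ge0 => j _; case: (CP j).
exists e0 => // e x r he xA r0 rE j.
have hD : D e x by exists r.
have [f0 fE] := fP (e, x) hD.
have W0 : W e x != 0.
  by apply/eqP => W0; move: rE; rewrite W0 mulr0 => /esym/eqP; rewrite oner_eq0.
have -> : r = f (e, x).
  apply/eqP; rewrite -(eqrXn2 (ltn0Sn d) (ltW r0) (ltW f0)); apply/eqP.
  by apply: (mulIf W0); rewrite rE fE.
apply: le_trans ((CP j).2 e x hD) _.
have /andP[ep _] := he.
rewrite ler_wpM2r ?exprn_ge0 ?(ltW ep) // (bigD1 j) //= lerDl.
by apply: sumr_ge0 => i _; case: (CP i).
Qed.

End Core.

(** * The vertex along a curve with monodromy *)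

Section Curve.
Variables (R : realType) (d : nat) (G : R -> 'rV[R]_d.+1) (M : 'M[R]_d.+1).
Hypothesis sG : smooth G.
Hypothesis WG : forall x, \det (wmat (coordf G) x) = 1.
Hypothesis M1 : \det M = 1.
Hypothesis GM : forall x, G (x + 2 * pi) = G x *m M.
Local Notation g := (coordf G).

Let sg j : smth (g j). Proof. exact: (smooth_coordf G).1 sG j. Qed.

(** Up to powers of e, the differences of order at most d are obtained from the d+1 points by a
    square matrix of constants. Hence dependent points would give [gdet] the value 0. *)
Lemma free_points e x : e != 0 -> gdet g e x != 0 ->
  free [seq G (x + k%:R * e) | k <- iota 0 d.+1].
Proof.
move=> e0 F0.
pose Pm : 'M[R]_d.+1 := \matrix_(k, j) g j (x + k%:R * e).
pose C : 'M[R]_d.+1 := \matrix_(k, m) difc R k m.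
have E : diag_mx (\row_(k < d.+1) e ^+ k) *m Fmx g e x = C *m Pm.
  rewrite mul_diag_mx; apply/matrixP => k j; rewrite !mxE difnE //.
  rewrite (big_ord_widen d.+1 (fun m => difc R k m * g j (x + m%:R * e))) //.
  rewrite big_mkcond /=; apply: eq_bigr => m _; rewrite !mxE.
  by case: ltnP => // km; rewrite /difc bin_small // mulr0 mul0r.
have P0 : Pm \in unitmx.
  rewrite unitmxE unitfE; apply: contraNneq F0 => P0.
  have := congr1 determinant E; rewrite !det_mulmx P0 mulr0 det_diag => /eqP.
  rewrite mulf_eq0 => /orP[|//]; rewrite prodf_seq_eq0 => /hasP[k _ /=].
  by rewrite mxE expf_eq0 (negbTE e0) andbF.
have sz : size [seq G (x + k%:R * e) | k <- iota 0 d.+1] == d.+1.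
  by rewrite size_map size_iota.
apply/(@freeP _ _ _ (Tuple sz)) => k kE i.
have kP : (\row_i k i) *m Pm = 0.
  rewrite -[RHS]kE; apply/rowP => j; rewrite mxE summxE; apply: eq_bigr => m _.
  by rewrite !mxE (nth_map 0%N) ?size_iota // nth_iota.
have := congr1 (mulmx^~ (invmx Pm)) kP; rewrite mulmxK // mul0mx => /rowP/(_ i).
by rewrite !mxE.
Qed.

Lemma difn_per k e x j :
  difn k (fun=> g j) e (x + 2 * pi) = \sum_i difn k (fun=> g i) e x * M i j.
Proof.
elim: k x => [|k IH] x; first by rewrite /difn /coordf /= GM mxE.
rewrite /difn iterS -/(difn k _) /dif addrAC !IH -sumrB mulr_sumr.
by apply: eq_bigr => i _; rewrite -mulrBl mulrA.
Qed.

Lemma Fmx_per e x : Fmx g e (x + 2 * pi) = Fmx g e x *m M.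
Proof.
apply/matrixP => k j; rewrite !mxE difn_per.
by apply: eq_bigr => i _; rewrite mxE.
Qed.

Lemma gdet_per e x : gdet g e (x + 2 * pi) = gdet g e x.
Proof. by rewrite /gdet Fmx_per det_mulmx M1 mulr1. Qed.

Lemma relc_mulF e x :
  relc g e x *m Fmx g e x = gdet g e x *: \row_j difn d.+1 (fun=> g j) e x.
Proof. by rewrite /relc -mulmxA mul_adj_mx mul_mx_scalar. Qed.

(** A period multiplies the frame and the top difference by the same M on the right, which leaves
    coordinates unchanged; [relc_mulF] determines [relc] once the frame is invertible. *)
Lemma relc_per e x : gdet g e x != 0 -> relc g e (x + 2 * pi) = relc g e x.
Proof.
move=> F0; have Fu : Fmx g e x *m M \in unitmx.
  by rewrite unitmxE unitfE det_mulmx M1 mulr1.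
apply: (can_inj (mulmxK Fu)); rewrite -{1}Fmx_per relc_mulF gdet_per.
rewrite mulmxA relc_mulF -scalemxAl; congr (_ *: _).
apply/rowP => j; rewrite !mxE difn_per.
by apply: eq_bigr => i _; rewrite mxE.
Qed.

Lemma rela_per m e x : gdet g e x != 0 -> rela g m e (x + 2 * pi) = rela g m e x.
Proof. by move=> F0; rewrite /rela gdet_per relc_per. Qed.

Lemma periodic_ind (T : R) (Q : R -> Prop) : 0 < T ->
  (forall x, Q (x + T) <-> Q x) -> (forall x, `|x| <= T -> Q x) -> forall x, Q x.
Proof.
move=> T0 QT Q0.
have H n x : `|x| <= n.+1%:R * T -> Q x.
  elim: n x => [|n IH] x xn; first by apply: Q0; rewrite mul1r in xn.
  have Tn : n.+2%:R * T = n.+1%:R * T + T by rewrite -[n.+2%:R]natr1; ring.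
  have Tn1 : T <= n.+1%:R * T by rewrite ler_peMl ?ler1n // ltW.
  rewrite Tn ler_norml in xn; case/andP: xn => xl xr.
  have [x0|x0] := leP 0 x.
    rewrite -[x](subrK T); apply/QT; apply: IH.
    by rewrite ler_norml; apply/andP; split; lra.
  apply/QT; apply: IH.
  by rewrite ler_norml; apply/andP; split; lra.
move=> x; apply: (H (Num.truncn (`|x| / T))).
have xT : 0 <= `|x| / T by rewrite divr_ge0 // ltW.
have := truncnS_gt (`|x| / T).
by rewrite ltr_pdivrMr // => /ltW.
Qed.

Lemma periodic_lower (F : R -> R -> R) e0 : 0 < e0 ->
  bigO 1 (fun e x => F e x - 1) ->
  (forall e x, 0 < e < e0 -> F e (x + 2 * pi) = F e x) ->
  exists2 e1, 0 < e1 <= e0 & forall e x, 0 < e < e1 -> 0 < F e x.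
Proof.
move=> e00 OF FT; have i2 : 0 < 2^-1 :> R by rewrite invr_gt0.
have [e1 /andP[e10 e11] H] := bigO_small (2 * pi) OF i2.
exists (Num.min e0 e1); first by rewrite lt_min e00 e10 ge_min lexx.
move=> e x /andP[ep]; rewrite lt_min => /andP[ee0 ee1].
apply: (@periodic_ind (2 * pi) (fun x => 0 < F e x)).
- by rewrite mulr_gt0 // pi_gt0.
- by move=> y; rewrite FT // ep.
move=> y yT; have /H := yT => /(_ e); rewrite ep ee1 ler_norml => /(_ isT) /andP[+ _].
by lra.
Qed.

Variables (s : nat) (q mu c : R).
Hypothesis mu0 : mu != 0.
Hypothesis muE : \sum_(m < s.+1) difc R d.+1 m = mu.
Hypothesis mom1 : \sum_(m < s.+1) difc R d.+1 m * (q + m%:R) = 0.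
Hypothesis mom2 : \sum_(m < s.+1) difc R d.+1 m * ((q + m%:R) ^+ 2 / 2 - c) = 0.

Definition vvec e x : 'rV[R]_d.+1 :=
  \sum_(m < s.+1) vcoef g q mu m e x *: G (x + (q + m%:R) * e).

Lemma coordf_vvec e j : coordf (vvec e) j = vV g s q mu j e.
Proof.
apply/funext => x; rewrite /coordf /vvec summxE; apply: eq_bigr => m _.
by rewrite mxE.
Qed.

Let Y1 := vY_cong sg WG q mu0 muE.
Let vE := vV_cong sg WG mu0 muE mom1 mom2.

Lemma smooth_vvec e : 0 < e <= 1 -> smooth (vvec e).
Proof.
move=> he; apply/smooth_coordf => j; rewrite coordf_vvec.
exact: bigO_smth (congl (vE j)) he.
Qed.

Definition wvec e x := \det (wmat (coordf (vvec e)) x).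

Lemma wvecE e x : wvec e x = \det (wmat (fun j => vV g s q mu j e) x).
Proof.
by congr (\det _); apply/matrixP => k j; rewrite !mxE coordf_vvec.
Qed.

Lemma wvec_cong : cong 1 wvec (fun _ _ => 1).
Proof.
have W3 : cong 1 wvec
    (fun e x => vY g s q mu e x ^+ d.+1 * (1 + c * e ^+ 2 * tau g x)).
  have := cong_leq (isT : 1 <= 3)%N (wronskian_cong sg WG (congl Y1) vE).
  by apply: cong_eq => e x _; [exact/esym/wvecE|].
apply: cong_trans W3 _.
have Yn : cong 1 (fun e x => vY g s q mu e x ^+ d.+1) (fun _ _ => 1).
  apply: cong_eq (cong_prod (index_enum 'I_d.+1) (fun=> Y1)) => e x _.
    by rewrite prodr_const card_ord.
  by rewrite prodr_const card_ord expr1n.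
have Z1 : cong 1 (fun e x => 1 + c * e ^+ 2 * tau g x) (fun _ _ => 1).
  apply: cong_add; first exact: bigO_cst.
  apply: (@bigO_leq _ 1 2) => //.
  apply: bigO_eq (bigOZ c (bigO_exp 2 (bigO_tau sg))) => e x _.
  by rewrite mulrA.
by apply: cong_eq (congM Yn Z1) => // e x _; rewrite mulr1.
Qed.

Lemma small_eps : exists2 e0, 0 < e0 <= 1 & forall e x, 0 < e < e0 ->
  gdet g e x != 0 /\ 0 < wvec e x.
Proof.
have [e1 /andP[e10 e11] H1] := periodic_lower (ltr01 : 0 < 1 :> R)
  (congB (gdet_cong sg WG)) (fun e x _ => gdet_per e x).
(* Periodicity of [rela] is available only where [gdet] is nonzero, so the threshold for the
   Wronskian is sought below the one for [gdet]. *)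
have gd0 e x : 0 < e < e1 -> gdet g e x != 0 by move=> he; rewrite gt_eqF ?H1.
have vper e x : 0 < e < e1 -> vvec e (x + 2 * pi) = vvec e x *m M.
  move=> he; rewrite /vvec mulmx_suml; apply: eq_bigr => m _.
  by rewrite /vcoef -!addrA ![2 * pi + _]addrC !addrA rela_per ?gd0 // GM scalemxAl.
have wper e x : 0 < e < e1 -> wvec e (x + 2 * pi) = wvec e x.
  move=> he; have he1 : 0 < e <= 1.
    by case/andP: he => -> /ltW h; rewrite (le_trans h).
  have sv := smooth_vvec he1.
  rewrite -[RHS]mulr1 -[X in _ = _ * X]M1 -det_mulmx -(wmat_mulmx _ _ sv); congr (\det _).
  apply/matrixP => k j; rewrite !mxE.
  have -> : coordf (fun x => vvec e x *m M) j = fun x => coordf (vvec e) j (x + 2 * pi).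
    by apply/funext => y; rewrite /coordf vper.
  by rewrite (dxn_shift _ _ ((smooth_coordf _).1 sv j)).
have [e2 /andP[e20 e21] H2] := periodic_lower e10 (congB wvec_cong) wper.
exists e2; first by rewrite e20 (le_trans e21).
move=> e x he; split; last exact: H2.
by apply: gd0; case/andP: he => -> h /=; apply: lt_le_trans h e21.
Qed.

Lemma vvec_rel e x : e != 0 ->
  \sum_(m < d.+2) vcoef g q mu m e x *: G (x + (q + m%:R) * e) = 0.
Proof.
move=> e0; apply/rowP => j; rewrite summxE mxE.
transitivity (mu^-1 * 0 : R); last by rewrite mulr0.
rewrite -[X in _ = _ * X](relaE g (x + q * e) j e0) mulr_sumr.
apply: eq_bigr => m _; rewrite mxE /vcoef mulrA; congr (_ * _).
by rewrite /coordf mulrDl addrA.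
Qed.

Variables (delta : R).
Hypothesis sd : (s < d)%N.
Hypothesis qE : q = (d - s.+1)%:R + delta.

Local Notation P e x := (fun k : nat => G (x + (k%:R + delta) * e)).

Lemma free_P e x a : e != 0 -> (forall x, gdet g e x != 0) ->
  free (seg (P e x) a d.+1).
Proof.
move=> e0 F0.
have -> : seg (P e x) a d.+1 =
    [seq G (x + (a%:R + delta) * e + k%:R * e) | k <- iota 0 d.+1].
  rewrite /seg -[X in iota X _]addn0 iotaDl -map_comp; apply: eq_map => k /=.
  by congr G; rewrite natrD; ring.
exact: free_points.
Qed.

Lemma vvecP e x : vvec e x =
  \sum_(m < s.+1) vcoef g q mu m e x *: P e x (d - s.+1 + m)%N.
Proof.
apply: eq_bigr => m _; congr (_ *: G _).
by rewrite qE natrD; ring.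
Qed.

Lemma vvecN e x : e != 0 -> vvec e x =
  - \sum_(m < d.+2 | (s < m)%N) vcoef g q mu m e x *: P e x (d - s.+1 + m)%N.
Proof.
move=> e0; apply/eqP; rewrite -subr_eq0 opprK; apply/eqP.
rewrite -[RHS](vvec_rel x e0) [RHS](bigID (fun m : 'I_d.+2 => (m < s.+1)%N)) /=.
have -> : \sum_(m < d.+2 | (m < s.+1)%N)
    vcoef g q mu m e x *: G (x + (q + m%:R) * e) = vvec e x.
  rewrite /vvec.
  rewrite [RHS](big_ord_widen_cond d.+2 xpredT
    (fun m => vcoef g q mu m e x *: G (x + (q + m%:R) * e))) //.
  by rewrite ltnS ltnW // ltnW // ltnS.
congr (_ + _); apply: eq_big => [m|m _]; first by rewrite -ltnNge.
by congr (_ *: G _); rewrite qE natrD; ring.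
Qed.

Lemma vvec_window e x i : e != 0 -> (i <= d)%N -> i != (d - s)%N ->
  vvec e x \in <<seg (P e x) i d>>%VS.
Proof.
move=> e0 id; rewrite neq_ltn => /orP[ids|ids].
  rewrite vvecP; apply: memv_suml => m _; apply: memvZ; apply: memv_span.
  apply: map_f; rewrite mem_iota; have := ltn_ord m; lia.
rewrite vvecN // memvN; apply: memv_suml => m sm; apply: memvZ; apply: memv_span.
by apply: map_f; rewrite mem_iota; have := ltn_ord m; lia.
Qed.

Lemma pentagram_vvec e x : e != 0 -> (forall x, gdet g e x != 0) -> wvec e x != 0 ->
  (\bigcap_(i < d) <<seg (P e x) (bump (d - s) i) d>>)%VS = <[vvec e x]>%VS /\
  forall i, \dim <<seg (P e x) i d>> = d.
Proof.
move=> e0 F0 W0; have fP a := free_P x a e0 F0; split=> [|i].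
  apply: cap_windows_line => //; first exact: leq_subr.
    exact: wmat_neq0 W0.
  by move=> i id ids; apply: vvec_window.
by rewrite (eqP (free_seg fP i (leqnSn d))) size_map size_iota.
Qed.

End Curve.

Section Limits.
Variable R : realType.

Lemma near_at_right0 (Q : R -> Prop) :
  (\forall e \near 0^'+, Q e) <-> exists2 e1, 0 < e1 & forall e, 0 < e < e1 -> Q e.
Proof.
split=> [[e1 /= e10 H]|[e1 e10 H]].
  exists e1 => // e /andP[ep ee]; apply: H => //=.
  by rewrite sub0r normrN gtr0_norm.
near=> e; apply: H; apply/andP; split.
  by near: e; exact: nbhs_right_gt.
by near: e; exact: nbhs_right_lt.
Unshelve. all: by end_near. Qed.

Lemma norm_rV_le n (v : 'rV[R]_n) (B : R) : 0 <= B ->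
  (forall j, `|v 0 j| <= B) -> `|v| <= B.
Proof.
move=> B0 vB; rewrite [leLHS]/Num.Def.normr /= mx_normrE.
by apply: bigmax_le => // -[i j] _ /=; rewrite (ord1 i).
Qed.

Lemma norm_rV_coord n (v : 'rV[R]_n) j : `|v 0 j| <= `|v|.
Proof.
rewrite [leRHS]/Num.Def.normr /= mx_normrE.
exact: (le_bigmax _ (fun ij : 'I_1 * 'I_n => `|v ij.1 ij.2|) (0, j)).
Qed.

End Limits.

(** * The shifted dual dented map: existence and uniqueness of the expansion *)

Section Main.
Variables (R : realType) (d s : nat).
Hypotheses (hd : (2 <= d)%N) (hs : (1 <= s <= d.-1)%N).
Local Notation delta := (1 - d%:R - s%:R / d%:R : R).
Local Notation chi := (shift_config (dual_dented R d s) delta).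
Local Notation c := (kdv_coef R d s).
Local Notation q := (base_shift R d s).
Local Notation mu := (coef_sum R d s).

(** Written with [tau] instead of u_(d-1), since centralization speaks of curves for which no L has
    been chosen. *)
Definition lim2 (Gam : R -> 'rV[R]_d.+1) (i : nat) (x : R) : R :=
  if i == 0%N then - (c / d.+1%:R) * tau (coordf Gam) x
  else if i == 2 then c else 0.

Lemma diffop_coef02 (V : normedModType R) (a : nat -> R -> R) (f : R -> V) x :
  (forall i, (i < d.+1)%N -> i != 0%N -> i != 2 -> a i x = 0) ->
  diffop d.+1 a f x = a 0%N x *: f x + a 2 x *: f^`(2) x.
Proof.
move=> a0; rewrite /diffop (bigD1 ord0) //=; congr (_ + _).
have d2 : (2 < d.+1)%N by rewrite ltnS.
rewrite (bigD1 (Ordinal d2)) //= big1 ?addr0 // => i /andP[i0 i2].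
by rewrite a0 ?scale0r.
Qed.

Lemma diffop_lim2 (V : normedModType R) Gam (f : R -> V) x :
  diffop d.+1 (lim2 Gam) f x =
  - (c / d.+1%:R) * tau (coordf Gam) x *: f x + c *: f^`(2) x.
Proof.
by apply: diffop_coef02 => i _ i0 i2; rewrite /lim2 (negbTE i0) (negbTE i2).
Qed.

Lemma diffop0 (V : normedModType R) (f : R -> V) x :
  diffop d.+1 (fun _ _ => 0) f x = 0.
Proof. by apply: big1 => i _; rewrite scale0r. Qed.

Variables (gam : R -> projpoint R d) (Gam : R -> 'rV[R]_d.+1).
Hypothesis hC : curve_with_lift gam Gam.
Local Notation g := (coordf Gam).

Let hL : normalized_lift (fun x => line (gam x)) Gam.
Proof. by case: hC. Qed.
Let sG : smooth Gam. Proof. by case: hL. Qed.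
Let lG x : line (gam x) = <[Gam x]>%VS. Proof. by case: hL => _ ->. Qed.
Let WG x : \det (wmat g x) = 1.
Proof. by case: hL => _ _ W; rewrite -(wronskianE _ sG). Qed.
Let sg j : smth (g j). Proof. exact: (smooth_coordf Gam).1 sG j. Qed.
Let sd : (s < d)%N.
Proof. by case/andP: hs => _ h; apply: leq_ltn_trans h _; rewrite prednK // ltnW. Qed.
Let muE : \sum_(m < s.+1) difc R d.+1 m = mu. Proof. by []. Qed.
Let mu0 : mu != 0. Proof. exact: coef_sum_neq0. Qed.
Let mom1 := moment1 R s hd.
Let mom2 := moment2 R s hd.
Let Y1 := vY_cong sg WG q mu0 muE.
Let vE := vV_cong sg WG mu0 muE mom1 mom2.
Local Notation V := (vvec Gam s q mu).
Local Notation W := (wvec Gam s q mu).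

Let qE : q = (d - s.+1)%:R + delta.
Proof.
have d0 : d%:R != 0 :> R by rewrite pnatr_eq0 -lt0n ltnW.
rewrite /base_shift natrB // -[s.+1%:R]natr1 -[d.+1%:R]natr1; field.
by [].
Qed.

Lemma hyperplaneE e x (i : 'I_d) : hyperplane chi gam e i x =
  <<seg (fun k => Gam (x + (k%:R + delta) * e)) (bump (d - s) i) d>>%VS.
Proof.
rewrite span_def /seg big_map -[X in iota X _]addn0 iotaDl big_map.
rewrite -[d in iota 0 d]subn0 -/(index_iota 0 d) big_mkord.
apply: eq_bigr => j _; rewrite lG; congr <[Gam (_ + _ * _)]>%VS.
Qed.

Lemma small_eps_main : exists2 e0, 0 < e0 <= 1 & forall e, 0 < e < e0 ->
  [/\ forall x, pentagram chi gam e x = <[V e x]>%VS,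
      forall i x, \dim (hyperplane chi gam e i x) = d
    & forall x, 0 < W e x].
Proof.
case: hC => _ _ [M hM] _; have [M' M1 GM] := monodromy_lift hM hL.
have [e0 e01 H] := small_eps sG WG M1 GM mu0 muE mom1 mom2.
exists e0 => // e he; have e_neq0 : e != 0 by case/andP: he => /lt0r_neq0.
have F0 x := (H e x he).1; have W0 x := lt0r_neq0 (H e x he).2.
have PV (x : R) := pentagram_vvec sd qE e_neq0 F0 (W0 x).
split=> [x|i x|x]; last exact: (H e x he).2.
  rewrite -(PV x).1; apply: eq_bigr => i _; exact: hyperplaneE.
by rewrite hyperplaneE (PV x).2.
Qed.

(** The common property of the lift constructed from the root of the Wronskian and of an arbitrary
    pentagram lift. The sign condition on [f] makes the factor unique. *)
Definition good_lift Game := exists2 e1, 0 < e1 & forall e x, 0 < e < e1 ->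
  exists f : R, [/\ 0 < f, Game e x = f *: V e x & f ^+ d.+1 * W e x = 1].

Lemma good_expansion Game : good_lift Game ->
  expansion2 Gam Game (fun _ _ => 0) (lim2 Gam).
Proof.
move=> [e1 e10 H] A.
have [C C0 [e2 e20 HC]] := expansion_core sg WG Y1 vE A.
exists C; apply/near_at_right0; exists (Num.min e1 e2); first by rewrite lt_min e10.
move=> e /andP[ep]; rewrite lt_min => /andP[ee1 ee2] x xA.
have [|f [f0 -> fW]] := H e x; first by rewrite ep.
rewrite diffop0 scaler0 addr0 diffop_lim2.
apply: norm_rV_le => [|j]; first by rewrite mulr_ge0 // exprn_ge0 // ltW.
have e_in : 0 < e < e2 by rewrite ep.
have fW' : f ^+ d.+1 * \det (wmat (fun j => vV g s q mu j e) x) = 1.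
  by rewrite -wvecE.
have := HC e x f e_in xA f0 fW' j; congr (`|_| <= _).
have -> : vV g s q mu j e x = V e x 0 j by rewrite -coordf_vvec.
have G2 : Gam^`(2) x 0 j = dxn 2 (g j) x by rewrite -coordf_derive1n.
by rewrite !mxE G2 /coordf; ring.
Qed.

Lemma good_cvg Game x : good_lift Game -> Game e x @[e --> 0^'+] --> Gam x.
Proof.
move=> gG; have [C /near_at_right0[e1 e10 HC]] := good_expansion gG `|x|.
apply/cvgrPdist_le => /= h h0; apply/near_at_right0.
pose B := `|diffop d.+1 (lim2 Gam) Gam x| + `|C|.
have B0 : 0 <= B by rewrite addr_ge0.
have B1 : 0 < B + 1 by rewrite ltr_wpDl.
exists (Num.min e1 (Num.min 1 (h / (B + 1)))).
  by rewrite !lt_min e10 ltr01 divr_gt0.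
move=> e /andP[ep]; rewrite !lt_min => /and3P[ee1 el1 eh].
have := HC e; rewrite ep ee1 => /(_ isT x (lexx _)).
rewrite diffop0 scaler0 addr0; set u := diffop _ _ _ _ => Hu.
rewrite distrC.
have -> : Game e x - Gam x = (Game e x - (Gam x + e ^+ 2 *: u)) + e ^+ 2 *: u.
  by rewrite opprD addrA subrK.
apply: le_trans (ler_normD _ _) _; rewrite normrZ ger0_norm ?exprn_ge0 ?(ltW ep) //.
have e2 : e ^+ 2 <= e by rewrite expr2 ler_piMl ?ltW.
have e3 : e ^+ 3 <= e by rewrite exprS ler_piMr ?exprn_ile1 ?ltW.
move: eh; rewrite ltr_pdivlMr // => /ltW; apply: le_trans.
apply: (@le_trans _ _ (`|C| * e + e * `|u|)).
  apply: lerD; last by rewrite ler_wpM2r.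
  apply: le_trans Hu _; apply: (@le_trans _ _ (`|C| * e ^+ 3)).
    by rewrite ler_wpM2r ?ler_norm // exprn_ge0 // ltW.
  by rewrite ler_wpM2l.
by rewrite /B -/u; have := ltW ep; nra.
Qed.

Lemma lift_exists : exists Game, pentagram_lift chi gam Gam Game.
Proof.
have [e0 /andP[e00 e01] H] := small_eps_main.
pose n1 : R := - d.+1%:R^-1.
exists (fun e x => W e x `^ n1 *: V e x).
have D01 e : 0 < e < e0 -> 0 < e <= 1.
  by case/andP=> -> /ltW h; rewrite (le_trans h).
have rootW w : 0 < w -> (w `^ n1) ^+ d.+1 * w = 1 :> R.
  move=> w0; rewrite -powR_mulrn ?powR_ge0 // -powRrM /n1 mulNr mulVf ?pnatr_eq0 //.
  by rewrite powR_inv1 ?ltW // mulVf // gt_eqF.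
have sW e : 0 < e < e0 -> smth (fun x => W e x `^ n1).
  move=> he; have [_ _ W0] := H e he; apply: smth_powR => //.
  exact: bigO_smth (congl (wvec_cong sG WG mu0 muE mom1 mom2)) (D01 e he).
split; last first.
  move=> x; apply: (@good_cvg (fun e x => W e x `^ n1 *: V e x)); exists e0 => // e y he.
  have [_ _ W0] := H e he.
  exists (W e y `^ n1); split=> //; first exact: powR_gt0.
  exact: rootW.
apply/near_at_right0; exists e0; first exact: e00.
move=> e he; have [PV Hd W0] := H e he.
have sV : smooth (V e) := smooth_vvec sG WG mu0 muE mom1 mom2 (D01 e he).
split; first exact: Hd.
split.
- exact: (smooth_scale (sW e he) sV).
- move=> x; rewrite PV; apply/eqP; rewrite eqEdim; apply/andP; split.
    by rewrite -memvE memvZ // memv_line.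
  rewrite !dim_vline scaler_eq0 negb_or (gt_eqF (powR_gt0 _ (W0 x))) /=.
  exact: leqnn.
move=> x; rewrite wronskianE; last exact: (smooth_scale (sW e he) sV).
by rewrite (det_wmat_scale x (sW e he) sV) -/(W e x) rootW.
Qed.

(** Any lift is a smooth nonvanishing multiple f of V, and only the sign of f is in question. Near e
    = 0 a coordinate of V at x = 0 has the sign of the nonzero limit coordinate, and so has that of
    [Game]; hence f 0 > 0. Continuity carries the sign to every x, so convergence at a single point
    suffices. *)
Lemma lift_good Game : pentagram_lift chi gam Gam Game -> good_lift Game.
Proof.
move=> [/near_at_right0[e1 e10 HG] cG].
have [e0 /andP[e00 e01] H] := small_eps_main.
have G0 : Gam 0 != 0 by apply: wmat_neq0; rewrite WG oner_neq0.
have [j gj] : exists j, g j 0 != 0.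
  apply/existsP; rewrite -negb_forall; apply: contra G0 => /forallP g0.
  by apply/eqP/rowP => j; rewrite mxE; exact/eqP/g0.
have h0 : 0 < `|g j 0| / 2 by rewrite divr_gt0 // normr_gt0.
have [e2 e20 H2] : exists2 e2, 0 < e2 & forall e, 0 < e < e2 ->
    `|Game e 0 0 j - g j 0| < `|g j 0|.
  apply/near_at_right0; have /cvgrPdist_lt/(_ `|g j 0|) := cG 0.
  rewrite normr_gt0 => /(_ gj); apply: filterS => e; rewrite distrC.
  apply: le_lt_trans.
  by have := norm_rV_coord (Game e 0 - Gam 0) j; rewrite !mxE.
have [e3 /andP[e30 e31] H3] : exists2 e3, 0 < e3 <= 1 & forall e x, 0 < e < e3 ->
    `|x| <= 0 -> `|vV g s q mu j e x - g j x| <= `|g j 0| / 2.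
  have vg : cong 1 (vV g s q mu j) (fun _ => g j).
    apply: cong_trans (cong_leq (isT : 1 <= 3)%N (vE j)) _.
    have Z1 : cong 1 (fun e x => g j x + c * e ^+ 2 * dxn 2 (g j) x) (fun _ => g j).
      apply: cong_add; first exact: bigO_fun.
      apply: (@bigO_leq _ 1 2) => //.
      apply: bigO_eq (bigOZ c (bigO_exp 2 (bigO_fun (smth_dxn 2 (sg j))))) => e x _.
      by rewrite mulrA.
    by apply: cong_eq (congM Y1 Z1) => // e x _; rewrite mul1r.
  exact: (bigO_small 0 (congB vg) h0).
exists (Num.min (Num.min e0 e1) (Num.min e2 e3)).
  by rewrite !lt_min e00 e10 e20 e30.
move=> e x /andP[ep]; rewrite !lt_min => /andP[/andP[ee0 ee1] /andP[ee2 ee3]].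
have he0 : 0 < e < e0 by rewrite ep.
have [PV _ W0] := H e he0.
have [_ [sGe lGe WGe]] : (forall i x, \dim (hyperplane chi gam e i x) = d) /\
    normalized_lift (pentagram chi gam e) (Game e).
  by apply: HG; rewrite ep.
have he1 : 0 < e <= 1 by rewrite ep (le_trans (ltW ee0)).
have sV : smooth (V e) := smooth_vvec sG WG mu0 muE mom1 mom2 he1.
have V0 y : V e y != 0 by apply: wmat_neq0; exact: lt0r_neq0 (W0 y).
have GV y : <[Game e y]>%VS = <[V e y]>%VS by rewrite lGe PV.
have [f [sf fE f0]] := proportional sGe sV V0 GV.
exists (f x); split=> //; last first.
  rewrite -(det_wmat_scale x sf sV) -(WGe x) wronskianE //; congr (\det (wmat _ x)).
  by congr coordf; apply/funext => y; rewrite fE.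
apply: (continuous_same_sign (smth_continuous sf) f0 (x := 0)).
have := H2 e; rewrite ep ee2 => /(_ isT); rewrite fE mxE.
have := H3 e 0; rewrite ep ee3 normr0 => /(_ isT (lexx _)).
rewrite -coordf_vvec /coordf -/(g j 0).
set a := V e 0 0 j; set b := g j 0 in gj *; move=> ab fab.
rewrite ltNge; apply/negP => f00.
have [bp|bn|b0] := ltgtP b 0; last by rewrite b0 eqxx in gj.
  move: ab fab; rewrite (ltr0_norm bp) ler_norml ltr_norml.
  move=> /andP[a1 a2] /andP[fa1 fa2].
  have a_neg : a <= 0 by lra.
  have : 0 <= f 0 * a by rewrite mulr_le0.
  by lra.
move: ab fab; rewrite (gtr0_norm bn) ler_norml ltr_norml.
move=> /andP[a1 a2] /andP[fa1 fa2].
have a_pos : 0 <= a by lra.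
have : f 0 * a <= 0 by rewrite mulr_le0_ge0.
by lra.
Qed.

Lemma has_expansion_lim2 : has_expansion chi gam Gam (fun _ _ => 0) (lim2 Gam).
Proof.
split; first exact: lift_exists.
by move=> Game /lift_good; exact: good_expansion.
Qed.

Lemma wmat_indep (k : 'I_d.+1 -> R) x :
  \sum_i k i *: Gam^`(i) x = 0 -> forall i, k i = 0.
Proof.
move=> kE i; have Wu : wmat g x \in unitmx by rewrite unitmxE WG unitr1.
have kW : (\row_i k i) *m wmat g x = 0.
  rewrite -[RHS]kE; apply/rowP => j; rewrite mxE summxE; apply: eq_bigr => m _.
  by rewrite !mxE -coordf_derive1n.
have := congr1 (mulmx^~ (invmx (wmat g x))) kW.
by rewrite mulmxK // mul0mx => /rowP/(_ i); rewrite !mxE.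
Qed.

(** Two expansions of the same lift differ by e^2 (u - v) = O(e^3), so u = v. The Wronskian being 1,
    equality of the values on Gamma gives equality of the d+1 coefficients. *)
Lemma expansion_unique a2 : has_expansion chi gam Gam (fun _ _ => 0) a2 ->
  forall i x, (i < d.+1)%N -> a2 i x = lim2 Gam i x.
Proof.
move=> [[Game hG] Hu] i x id.
have E1 := Hu Game hG `|x|; have E2 := has_expansion_lim2.2 Game hG `|x|.
have [C1 /near_at_right0[e1 e10 H1]] := E1.
have [C2 /near_at_right0[e2 e20 H2]] := E2.
set u := diffop d.+1 a2 Gam x in H1 *; set v := diffop d.+1 (lim2 Gam) Gam x in H2 *.
suff uv : u = v.
  have : \sum_(i < d.+1) (a2 i x - lim2 Gam i x) *: Gam^`(i) x = 0.
    under eq_bigr => k _ do rewrite scalerBl.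
    by rewrite sumrB; apply/eqP; rewrite subr_eq0; apply/eqP.
  by move=> /wmat_indep /(_ (Ordinal id)) /eqP; rewrite subr_eq0 => /eqP.
apply/eqP; rewrite -subr_eq0 -normr_le0; apply/ler_addgt0Pl => h h0; rewrite addr0.
pose B := `|C1| + `|C2|; have B0 : 0 <= B by rewrite addr_ge0.
have B1 : 0 < B + 1 by rewrite ltr_wpDl.
pose e := Num.min (Num.min e1 e2) (h / (B + 1)) / 2.
have m0 : 0 < Num.min (Num.min e1 e2) (h / (B + 1)).
  by rewrite !lt_min e10 e20 divr_gt0.
have ep : 0 < e by rewrite divr_gt0.
have : e < Num.min (Num.min e1 e2) (h / (B + 1)).
  by rewrite ltr_pdivrMr // ltr_pMr // ltr1n.
rewrite !lt_min => /andP[/andP[ee1 ee2] eh].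
have := H1 e; rewrite ep ee1 => /(_ isT x (lexx _)).
have := H2 e; rewrite ep ee2 => /(_ isT x (lexx _)).
rewrite -/u -/v diffop0 scaler0 addr0 => Hv Hw.
have E : e ^+ 2 *: (u - v) = (Game e x - (Gam x + e ^+ 2 *: v)) -
    (Game e x - (Gam x + e ^+ 2 *: u)).
  by rewrite scalerBr opprB [RHS]addrC addrA subrK opprD addrACA subrr add0r.
have e20' : 0 < e ^+ 2 by rewrite exprn_gt0.
have : e ^+ 2 * `|u - v| <= e ^+ 2 * (e * B).
  rewrite -[X in X * `|_|]gtr0_norm // -normrZ E.
  apply: le_trans (ler_normB _ _) _.
  have e3 : 0 <= e ^+ 3 by rewrite exprn_ge0 // ltW.
  apply: (@le_trans _ _ (`|C2| * e ^+ 3 + `|C1| * e ^+ 3)).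
    apply: lerD; [apply: le_trans Hv _|apply: le_trans Hw _];
      by rewrite ler_wpM2r // ler_norm.
  by rewrite le_eqVlt; apply/orP; left; apply/eqP; rewrite /B; ring.
rewrite ler_pM2l // => /le_trans; apply.
move: eh; rewrite ltr_pdivlMr // => /ltW; apply: le_trans.
by rewrite ler_wpM2l ?ltW // ltrDl.
Qed.

End Main.

(** * The KdV equation *)

Section Lax.
Variables (R : realType) (d : nat).
Implicit Types (u : nat -> R -> R) (f h : R -> R).

Definition Lf u f x : R := dxn d.+1 f x + \sum_(j < d) u j x * dxn j f x.
Definition Q2f u f x : R := dxn 2 f x + 2 / d.+1%:R * u d.-1 x * f x.

Lemma LopE u f : @Lop R R^o d u f = Lf u f.
Proof.
apply/funext => x; rewrite /Lop /Lf dxnE; congr (_ + _).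
by apply: eq_bigr => j _; rewrite dxnE.
Qed.

Lemma Q2opE u f : @Q2op R R^o d u f = Q2f u f.
Proof. by apply/funext => x; rewrite /Q2op /Q2f dxnE. Qed.

Lemma coordf_Lop u (G : R -> 'rV[R]_d.+1) i : smooth G ->
  coordf (Lop d u G) i = Lf u (coordf G i).
Proof.
move=> sG; apply/funext => x; rewrite /Lf -!coordf_derive1n // /coordf /Lop /diffop.
rewrite mxE summxE; congr (_ + _); apply: eq_bigr => j _.
by rewrite mxE -coordf_derive1n.
Qed.

Lemma coordf_Q2op u (G : R -> 'rV[R]_d.+1) i : smooth G ->
  coordf (Q2op d u G) i = Q2f u (coordf G i).
Proof.
by move=> sG; apply/funext => x; rewrite /Q2f -!coordf_derive1n // /coordf /Q2op !mxE.
Qed.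

Lemma smth_Lf u f : (forall j, (j < d)%N -> smth (u j)) -> smth f -> smth (Lf u f).
Proof.
move=> su sf; apply: smthD; first exact: smth_dxn.
by apply: smth_sum => j; apply: smthM; [exact: su|exact: smth_dxn].
Qed.

Lemma smth_Q2f u f : smth (u d.-1) -> smth f -> smth (Q2f u f).
Proof.
move=> su sf; apply: smthD; first exact: smth_dxn.
by apply: smthM => //; apply: smthZ.
Qed.

Lemma Lf_lin u f h (a : R) : smth f -> smth h ->
  Lf u (fun x => a * f x + h x) = (fun x => a * Lf u f x + Lf u h x).
Proof.
move=> sf sh; have dE k : dxn k (fun x => a * f x + h x) = fun x => a * dxn k f x + dxn k h x.
  by rewrite dxnD ?dxnZ //; exact: smthZ.
apply/funext => x; rewrite /Lf dE mulrDr mulr_sumr addrACA -big_split /=.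
by congr (_ + _); apply: eq_bigr => j _; rewrite dE mulrDr mulrCA.
Qed.

Lemma Q2f_lin u f h (a : R) : smth f -> smth h ->
  Q2f u (fun x => a * f x + h x) = (fun x => a * Q2f u f x + Q2f u h x).
Proof.
move=> sf sh; apply/funext => x; rewrite /Q2f dxnD ?dxnZ //; last exact: smthZ.
by ring.
Qed.

Definition bracket u f x : R := Q2f u (Lf u f) x - Lf u (Q2f u f) x.

Lemma bracket_lin u f h (a : R) : (0 < d)%N ->
  (forall j, (j < d)%N -> smth (u j)) -> smth f -> smth h ->
  forall x, bracket u (fun x => a * f x + h x) x = a * bracket u f x + bracket u h x.
Proof.
move=> d0 su sf sh x; have sd : smth (u d.-1) by apply: su; rewrite prednK.
rewrite /bracket Lf_lin // !Q2f_lin //; try exact: smth_Lf.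
rewrite Lf_lin; [|exact: smth_Q2f|exact: smth_Q2f].
by ring.
Qed.

Lemma dxn_flat n (a : R -> R) h x : smth a -> smth h ->
  (forall k, (k < n)%N -> dxn k h x = 0) ->
  dxn n (fun y => a y * h y) x = a x * dxn n h x.
Proof.
move=> sa sh h0; rewrite dxnM // big_ord_recr /= binn subnn mul1r big1 ?add0r //.
by move=> i _; rewrite h0 // mulr0.
Qed.

(* [Q_2, L] has order at most d: the derivatives of h of order d+1, d+2 and
   d+3 cancel. *)
Lemma bracket_flat u h x : (0 < d)%N ->
  (forall j, (j < d)%N -> smth (u j)) -> smth h ->
  (forall k, (k <= d)%N -> dxn k h x = 0) -> bracket u h x = 0.
Proof.
move=> d0 su sh h0; have sd : smth (u d.-1) by apply: su; rewrite prednK.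
have sw : smth (fun x => 2 / d.+1%:R * u d.-1 x) by exact: smthZ.
have sj (j : 'I_d) : smth (fun x => u j x * dxn j h x).
  by apply: smthM; [exact: su|exact: smth_dxn].
have dxnA k m : dxn k (dxn m h) = dxn (k + m) h by rewrite /dxn iterD.
rewrite /bracket /Q2f /Lf dxnD; [|exact: smth_dxn|exact: smth_sum].
rewrite dxn_sum // dxnA.
have E1 : \sum_(j < d) dxn 2 (fun x => u j x * dxn j h x) x =
    \sum_(j < d) u j x * dxn (2 + j) h x.
  apply: eq_bigr => j _; rewrite dxn_flat ?dxnA //; [exact: su|exact: smth_dxn|].
  move=> k k2; rewrite dxnA h0 //.
  by rewrite (leq_trans (leq_add (k2 : (k <= 1)%N) (leqnn j))) // add1n.
have sQ : smth (fun x => 2 / d.+1%:R * u d.-1 x * h x) by apply: smthM.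
have E2 n : (n <= d.+1)%N ->
    dxn n (fun x => dxn 2 h x + 2 / d.+1%:R * u d.-1 x * h x) x =
    dxn (n + 2) h x + 2 / d.+1%:R * u d.-1 x * dxn n h x.
  move=> nd; rewrite dxnD //; last exact: smth_dxn.
  rewrite dxnA (dxn_flat sw sh) // => k kn.
  by apply: h0; rewrite -ltnS (leq_trans kn).
rewrite E1 E2 // [(2 + d.+1)%N]addnC.
have -> : \sum_(j < d) u j x *
    dxn j (fun x => dxn 2 h x + 2 / d.+1%:R * u d.-1 x * h x) x =
    \sum_(j < d) u j x * dxn (2 + j) h x +
    2 / d.+1%:R * u d.-1 x * \sum_(j < d) u j x * dxn j h x.
  rewrite mulr_sumr -big_split /=; apply: eq_bigr => j _.
  rewrite E2; last by rewrite (leq_trans (ltnW (ltn_ord j))).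
  by rewrite [(j + 2)%N]addnC -[dx (dx _)]/(dxn (2 + j) h); ring.
by ring.
Qed.

End Lax.

(** For k + 2 <= d the vector D^(k+2) Gamma belongs to the frame and differs from D^k Gamma, so it
    adds nothing to the trace. The two last rows are given by L Gamma = 0 and by its derivative, and
    each contributes - u_(d-1). *)
Lemma tau_lax (R : realType) (d : nat) (u : nat -> R -> R)
    (G : R -> 'rV[R]_d.+1) x : (2 <= d)%N -> smooth G ->
  (forall x, \det (wmat (coordf G) x) = 1) -> lax_coefs G u ->
  tau (coordf G) x = - (2 * u d.-1 x).
Proof.
case: d u G => // n u G n1 sG WG [su _ L0].
have sg j : smth (coordf G j) by exact: (smooth_coordf G).1.
have suj j : (j < n.+1)%N -> smth (u j) by move=> /su /smthP.
pose J k y := jet (coordf G) k y.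
have LG i y : dxn n.+2 (coordf G i) y = - \sum_(j < n.+1) u j y * dxn j (coordf G i) y.
  have := congr1 (fun v : 'rV[R]_n.+2 => v 0 i) (L0 y).
  rewrite -[LHS]/(coordf (Lop n.+1 u G) i y) (coordf_Lop _ _ sG) mxE /Lf => /eqP.
  by rewrite addr_eq0 => /eqP.
have J1 : J n.+2 x = - \sum_(j < n.+1) u j x *: J j x.
  apply/rowP => i; rewrite !mxE LG summxE; congr (- _).
  by apply: eq_bigr => j _; rewrite !mxE.
have J2 : J n.+3 x = - \sum_(j < n.+1) (dx (u j) x *: J j x + u j x *: J j.+1 x).
  apply/rowP => i; rewrite !mxE summxE.
  have -> : dxn n.+3 (coordf G i) =
      dx (fun y => -1 * \sum_(j < n.+1) u j y * dxn j (coordf G i) y).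
    rewrite dxnS; congr dx; apply/funext => y; by rewrite LG mulN1r.
  have sj (j : 'I_n.+1) : smth (fun y => u j y * dxn j (coordf G i) y).
    by apply: smthM; [exact: suj|exact: smth_dxn].
  rewrite dxZ; last exact: smth_sum.
  rewrite mulN1r dx_sum //; congr (- _); apply: eq_bigr => j _.
  have sdj := smth_dfun (smth_dxn j (sg i)).
  by rewrite (dfunM (smth_dfun (suj j (ltn_ord j))) sdj).2 !mxE -dxnS.
have coJ (k m : nat) (kn : (k < n.+2)%N) (mn : (m < n.+2)%N) :
    coords (coordf G) (J k x) x 0 (Ordinal mn) = (m == k)%:R.
  by rewrite (coords_jet WG kn) mxE eqxx /= -val_eqE.
have tE : tau (coordf G) x = \sum_(k < n.+2) coords (coordf G) (J k.+2 x) x 0 k.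
  apply: eq_bigr => k _; rewrite !mxE; apply: eq_bigr => m _.
  by rewrite !mxE.
have n2 : (n < n.+2)%N by rewrite ltnS leqnSn.
have n3 : (n.+1 < n.+2)%N by [].
rewrite tE 2!big_ord_recr /= big1 ?add0r; last first.
  move=> i _; have i2 : (i.+2 < n.+2)%N by rewrite !ltnS.
  have i0 : (i < n.+2)%N by have := ltn_ord i; lia.
  rewrite (_ : widen_ord _ _ = Ordinal i0); last exact: val_inj.
  by rewrite (coJ i.+2 i i2 i0) ltn_eqF // ltnW.
rewrite (_ : widen_ord _ _ = Ordinal n2); last exact: val_inj.
rewrite (_ : ord_max = Ordinal n3); last exact: val_inj.
have coS (m : nat) (mn : (m < n.+2)%N) (a : 'I_n.+1 -> 'rV[R]_n.+2) :
    coords (coordf G) (- \sum_j a j) x 0 (Ordinal mn) =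
    - \sum_j coords (coordf G) (a j) x 0 (Ordinal mn).
  by rewrite /coords mulNmx mulmx_suml mxE summxE.
have coZ (m : nat) (mn : (m < n.+2)%N) a v :
    coords (coordf G) (a *: v) x 0 (Ordinal mn) = a * coords (coordf G) v x 0 (Ordinal mn).
  by rewrite /coords -scalemxAl mxE.
have coD (m : nat) (mn : (m < n.+2)%N) v w : coords (coordf G) (v + w) x 0 (Ordinal mn) =
    coords (coordf G) v x 0 (Ordinal mn) + coords (coordf G) w x 0 (Ordinal mn).
  by rewrite /coords mulmxDl mxE.
rewrite J1 J2 !coS big_ord_recr /= [X in _ + - X]big_ord_recr /=.
rewrite big1 ?add0r; last first.
  move=> i _; have i0 : (i < n.+2)%N by have := ltn_ord i; lia.
  by rewrite coZ (coJ i n i0 n2) gtn_eqF ?mulr0.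
rewrite big1 ?add0r; last first.
  move=> i _; have i0 : (i < n.+2)%N by have := ltn_ord i; lia.
  have i1 : (i.+1 < n.+2)%N by have := ltn_ord i; lia.
  rewrite coD !coZ (coJ i n.+1 i0 n3) (coJ i.+1 n.+1 i1 n3) !gtn_eqF ?mulr0 ?addr0 //.
  by have := ltn_ord i; lia.
rewrite coD !coZ (coJ n n n2 n2) (coJ n n.+1 n2 n3) (coJ n.+1 n.+1 n3 n3).
rewrite !eqxx gtn_eqF // mulr0 add0r !mulr1.
by ring.
Qed.

(** * Equality of mixed partial derivatives *)

Section Schwarz.
Variable R : realType.

Lemma MVT_derive (f df : R -> R) (a b : R) : a < b ->
  (forall x : R, a <= x <= b -> is_derive x (1 : R) f (df x)) ->
  exists2 c, a < c < b & f b - f a = df c * (b - a).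
Proof.
move=> ab fd; have [|x xab|c] := @MVT R f df a b ab.
- move=> x; rewrite in_itv /= => /andP[ax xb]; apply: fd.
  by rewrite !ltW.
- apply: derivable_within_continuous => y yab.
  rewrite in_itv /= in yab.
  exact: (@ex_derive _ _ _ _ _ _ _ (fd y yab)).
by rewrite in_itv /= => cab E; exists c.
Qed.

Lemma continuous2_ball (F : R -> R -> R) t0 x0 :
  {for (t0, x0), continuous (fun z : R * R => F z.1 z.2)} ->
  forall h, 0 < h -> exists2 e, 0 < e & forall t x,
    `|t - t0| < e -> `|x - x0| < e -> `|F t x - F t0 x0| <= h.
Proof.
move=> cF h h0; have /cvgrPdist_le/(_ h h0) := cF.
move=> /nbhs_ballP[e /= e0 He]; exists e => // t x te xe.
rewrite distrC; apply: (He (t, x)); split.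
  by rewrite /ball /= distrC.
by rewrite /ball /= distrC.
Qed.

(** The second difference of H over a square of side e at (t0, x0) is evaluated by the mean value
    theorem in both orders. This gives a value of Htx and a value of Hxt near (t0, x0) that agree,
    and continuity does the rest. *)
Lemma schwarz (I : set R) (H Ht Hx Htx Hxt : R -> R -> R) t0 x0 :
  open I -> I t0 ->
  (forall t x : R, I t -> is_derive t (1 : R) (fun t' => H t' x) (Ht t x)) ->
  (forall t x : R, I t -> is_derive x (1 : R) (H t) (Hx t x)) ->
  (forall t x : R, I t -> is_derive x (1 : R) (Ht t) (Htx t x)) ->
  (forall t x : R, I t -> is_derive t (1 : R) (fun t' => Hx t' x) (Hxt t x)) ->
  {for (t0, x0), continuous (fun z : R * R => Htx z.1 z.2)} ->
  {for (t0, x0), continuous (fun z : R * R => Hxt z.1 z.2)} ->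
  Htx t0 x0 = Hxt t0 x0.
Proof.
move=> oI It0 dt dx' dtx dxt ctx cxt.
apply/eqP; rewrite -subr_eq0 -normr_le0; apply/ler_addgt0Pl => h h0; rewrite addr0.
have h2 : 0 < h / 2 by rewrite divr_gt0.
have [e1 e10 H1] := continuous2_ball ctx h2.
have [e2 e20 H2] := continuous2_ball cxt h2.
have : nbhs t0 I by apply: open_nbhs_nbhs.
move=> /nbhs_ballP[r /= r0 rI].
pose e := Num.min (Num.min e1 e2) r / 2.
have m0 : 0 < Num.min (Num.min e1 e2) r by rewrite !lt_min e10 e20.
have e0 : 0 < e by rewrite divr_gt0.
have : e < Num.min (Num.min e1 e2) r by rewrite ltr_pdivrMr // ltr_pMr // ltr1n.
rewrite !lt_min => /andP[/andP[ee1 ee2] er]; clearbody e.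
have It t : t0 <= t <= t0 + e -> I t.
  case/andP=> tl tr; apply: rI; rewrite /ball /= distrC ger0_norm ?subr_ge0 //.
  by apply: le_lt_trans er; rewrite lerBlDl.
have te : t0 < t0 + e by rewrite ltrDl.
have xe : x0 < x0 + e by rewrite ltrDl.
have Ie : I (t0 + e) by apply: It; rewrite lexx ltW.
have [t1 /andP[t1l t1r] E1] := @MVT_derive (fun t => H t (x0 + e) - H t x0)
  (fun t => Ht t (x0 + e) - Ht t x0) _ _ te
  (fun t ht => is_deriveB (dt t _ (It t ht)) (dt t _ (It t ht))).
have It1 : I t1 by apply: It; rewrite !ltW.
have [x1 /andP[x1l x1r] E2] := @MVT_derive (Ht t1) (Htx t1) _ _ xe
  (fun x _ => dtx t1 x It1).
have [x2 /andP[x2l x2r] E3] := @MVT_derive (fun x => H (t0 + e) x - H t0 x)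
  (fun x => Hx (t0 + e) x - Hx t0 x) _ _ xe
  (fun x _ => is_deriveB (dx' _ x Ie) (dx' _ x It0)).
have [t2 /andP[t2l t2r] E4] := @MVT_derive (fun t => Hx t x2) (fun t => Hxt t x2)
  _ _ te (fun t ht => dxt t x2 (It t ht)).
have E : Htx t1 x1 = Hxt t2 x2.
  have ee : e * e != 0 by rewrite mulf_neq0 // gt_eqF.
  have aK (a : R) : a + e - a = e by ring.
  rewrite E2 !aK in E1; rewrite E4 !aK in E3.
  apply: (mulIf ee); rewrite !mulrA.
  apply: (etrans (esym E1)); apply: (etrans _ E3); ring.
have n1 (a y : R) : a < y -> y < a + e -> `|y - a| < e.
  by move=> ay ya; rewrite gtr0_norm ?subr_gt0 // ltrBlDl.
have B1 := H1 t1 x1 (lt_trans (n1 _ _ t1l t1r) ee1) (lt_trans (n1 _ _ x1l x1r) ee1).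
have B2 := H2 t2 x2 (lt_trans (n1 _ _ t2l t2r) ee2) (lt_trans (n1 _ _ x2l x2r) ee2).
have -> : Htx t0 x0 - Hxt t0 x0 =
    (Hxt t2 x2 - Hxt t0 x0) - (Htx t1 x1 - Htx t0 x0) by rewrite E; ring.
by apply: le_trans (ler_normB _ _) _; rewrite [leRHS]splitr lerD.
Qed.

End Schwarz.

(** * Differentiation in time of determinants and of the flow *)

Section DerivableAt.
Variables (R : realType) (t : R).

Lemma derivable_at_sum I (r : seq I) (F : I -> R -> R) :
  (forall i, derivable (F i) t 1) -> derivable (fun y => \sum_(i <- r) F i y) t 1.
Proof.
move=> dF; elim: r => [|i r IH].
  rewrite (_ : (fun y => _) = fun=> 0); first exact: derivable_cst.
  by apply/funext => y; rewrite big_nil.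
rewrite (_ : (fun y => _) = fun y => F i y + \sum_(j <- r) F j y).
  exact: (derivableD (dF i) IH).
by apply/funext => y; rewrite big_cons.
Qed.

Lemma derivable_at_prod I (r : seq I) (F : I -> R -> R) :
  (forall i, derivable (F i) t 1) -> derivable (fun y => \prod_(i <- r) F i y) t 1.
Proof.
move=> dF; elim: r => [|i r IH].
  rewrite (_ : (fun y => _) = fun=> 1); first exact: derivable_cst.
  by apply/funext => y; rewrite big_nil.
rewrite (_ : (fun y => _) = fun y => F i y * \prod_(j <- r) F j y).
  exact: (derivableM (dF i) IH).
by apply/funext => y; rewrite big_cons.
Qed.

Lemma derivable_at_cstM (a : R) (f : R -> R) :
  derivable f t 1 -> derivable (fun y => a * f y) t 1.
Proof. by apply: derivableM; exact: derivable_cst. Qed.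

Lemma derivable_at_det n (A : R -> 'M[R]_n) :
  (forall i j, derivable (fun y => A y i j) t 1) ->
  derivable (fun y => \det (A y)) t 1.
Proof.
move=> dA; apply: derivable_at_sum => p; apply: derivable_at_cstM.
by apply: derivable_at_prod => i; exact: dA.
Qed.

Lemma derivable_at_adj n (A : R -> 'M[R]_n) :
  (forall i j, derivable (fun y => A y i j) t 1) ->
  forall i j, derivable (fun y => (\adj (A y)) i j) t 1.
Proof.
move=> dA i j; rewrite (_ : (fun y => _) =
  fun y => (-1) ^+ (j + i) * \det (row' j (col' i (A y)))); last first.
  by apply/funext => y; rewrite mxE.
apply: derivable_at_cstM; apply: derivable_at_det => k l.
rewrite (_ : (fun y => _) = fun y => A y (lift j k) (lift i l)) //.
by apply/funext => y; rewrite !mxE.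
Qed.

End DerivableAt.

Section Flow.
Variables (R : realType) (n : nat) (I : set R) (G : R -> R -> 'rV[R]_n).
Hypothesis oI : open I.
Hypothesis sG : smooth2 I G.

Lemma is_derive_coord (f : R -> 'rV[R]_n) (x : R) i : derivable f x 1 ->
  is_derive x (1 : R) (fun y => f y 0 i) (f^`() x 0 i).
Proof.
move=> df; rewrite derive1E (derive_mx df) mxE; apply/derivableP.
by have /derivable_mxP := df; apply.
Qed.

Lemma continuous_coord (F : R -> R -> 'rV[R]_n) t x i :
  {for (t, x), continuous (fun z : R * R => F z.1 z.2)} ->
  {for (t, x), continuous (fun z : R * R => F z.1 z.2 0 i)}.
Proof.
move=> cF; apply/cvgrPdist_le => h h0.
have /cvgrPdist_le/(_ h h0) := cF; apply: filterS => z.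
apply: le_trans.
by have := norm_rV_coord (F (t, x).1 (t, x).2 - F z.1 z.2) i; rewrite !mxE.
Qed.

Lemma partialsC w t x : I t ->
  partials (true :: false :: w) G t x = partials (false :: true :: w) G t x.
Proof.
move=> It; apply/rowP => i; apply/esym.
pose H w t x := partials w G t x 0 i.
apply: (@schwarz R I (H w) (H (true :: w)) (H (false :: w))
  (H [:: false, true & w]) (H [:: true, false & w]) t x oI It).
- by move=> t' x' It'; have [d1 d2 _] := sG w x' It'; exact: is_derive_coord.
- by move=> t' x' It'; have [d1 d2 _] := sG w x' It'; exact: is_derive_coord.
- by move=> t' x' It'; have [d1 d2 _] := sG (true :: w) x' It'; exact: is_derive_coord.
- by move=> t' x' It'; have [d1 d2 _] := sG (false :: w) x' It'; exact: is_derive_coord.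
- by have [_ _] := sG [:: false, true & w] x It; exact: continuous_coord.
- by have [_ _] := sG [:: true, false & w] x It; exact: continuous_coord.
Qed.

Lemma partials_nseq j t : partials (nseq j false) G t = (G t)^`(j).
Proof. by elim: j => // j IH; rewrite derive1nS -IH; apply/funext. Qed.

Lemma partials_dt j t : I t ->
  partials (true :: nseq j false) G t = (partials [:: true] G t)^`(j).
Proof.
move=> It; elim: j => // j IH; rewrite derive1nS -IH; apply/funext => x.
exact: partialsC.
Qed.

Lemma is_derive_dt j (t x : R) i : I t ->
  is_derive t (1 : R) (fun t' => (G t')^`(j) x 0 i)
    ((partials [:: true] G t)^`(j) x 0 i).
Proof.
move=> It; have [d1 _ _] := sG (nseq j false) x It.
rewrite (_ : (fun t' => _) = fun t' => partials (nseq j false) G t' x 0 i); last first.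
  by apply/funext => t'; rewrite partials_nseq.
by rewrite -partials_dt //; exact: is_derive_coord.
Qed.

End Flow.

(** * From the flow of Gamma to the flow of L *)

Section Kdv.
Variables (R : realType) (d : nat) (I : set R) (G : R -> R -> 'rV[R]_d.+1).
Variables (u : R -> nat -> R -> R) (c : R).
Hypotheses (d0 : (0 < d)%N) (oI : open I) (sG2 : smooth2 I G).
Hypothesis sG : forall t, I t -> smooth (G t).
Hypothesis WG : forall t x, I t -> \det (wmat (coordf (G t)) x) = 1.
Hypothesis lax : forall t, I t -> lax_coefs (G t) (u t).
Hypothesis flow : forall t x, I t ->
  (fun t' => G t' x)^`() t = c *: Q2op d (u t) (G t) x.

Let su t j : I t -> (j < d)%N -> smth (u t j).
Proof. by move=> /lax [H _ _] jd; apply/smthP; exact: H. Qed.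

Let LG t i x : I t -> Lf d (u t) (coordf (G t) i) x = 0.
Proof.
move=> It; have [_ _ L0] := lax It.
by rewrite -(coordf_Lop _ _ (sG It)) /coordf L0 mxE.
Qed.

Let coordfG t k i x : I t -> (G t)^`(k) x 0 i = dxn k (coordf (G t) i) x.
Proof. by move=> It; rewrite -(coordf_derive1n k i (sG It)). Qed.

Let near_I t : I t -> \forall t' \near t, I t'.
Proof. by move=> It; apply: open_nbhs_nbhs. Qed.

Lemma lax_coords t i x (id : (i < d.+1)%N) : I t -> (i < d)%N ->
  u t i x = - (((G t)^`(d.+1) x *m
    \adj (\matrix_(k < d.+1, j < d.+1) (G t)^`(k) x 0 j)) 0 (Ordinal id)).
Proof.
move=> It i_d.
have WE : \matrix_(k < d.+1, j < d.+1) (G t)^`(k) x 0 j = wmat (coordf (G t)) x.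
  by apply/matrixP => k j; rewrite !mxE coordfG.
have JE k : (G t)^`(k) x = jet (coordf (G t)) k x.
  by apply/rowP => j; rewrite mxE coordfG.
have W1 y : \det (wmat (coordf (G t)) y) = 1 by exact: WG.
have [_ _ L0] := lax It.
have := L0 x; rewrite /Lop => /eqP; rewrite addr_eq0 => /eqP ->.
rewrite WE mulNmx mxE opprK /diffop mulmx_suml summxE.
have coE (k : 'I_d) : ((u t k x *: (G t)^`(k) x) *m \adj (wmat (coordf (G t)) x))
    0 (Ordinal id) = u t k x * (i == k)%:R.
  have kd : (k < d.+1)%N by rewrite ltnW // ltnS.
  rewrite -scalemxAl mxE JE -/(coords (coordf (G t)) _ x) (coords_jet W1 kd).
  by rewrite mxE eqxx /= -val_eqE.
rewrite (eq_bigr (fun k : 'I_d => u t k x * (i == k)%:R)); last by move=> k _.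
rewrite (bigD1 (Ordinal i_d)) //= eqxx mulr1 big1 ?addr0 // => k ki.
by rewrite -[i == k]/(Ordinal i_d == k) eq_sym (negbTE ki) mulr0.
Qed.

(** [lax_coefs] says nothing about the dependence of u on t. It is recovered from [lax_coords]: the
    Wronskian being 1, the u_i are polynomials in the x-derivatives of Gamma. The formula holds for
    times in the open set [I], hence near t. *)
Lemma derivable_lax t i x : I t -> (i < d)%N -> derivable (fun t' => u t' i x) t 1.
Proof.
move=> It i_d; have id : (i < d.+1)%N by rewrite ltnW.
pose F t' := - (((G t')^`(d.+1) x *m
    \adj (\matrix_(k < d.+1, j < d.+1) (G t')^`(k) x 0 j)) 0 (Ordinal id)).
apply: (@near_eq_derivable _ _ _ F).
- by apply: filterS (near_I It) => t' It'; rewrite (lax_coords x id It' i_d).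
have dG k j : derivable (fun t' => (G t')^`(k) x 0 j) t 1.
  exact: (@ex_derive _ _ _ _ _ _ _ (is_derive_dt oI sG2 k x j It)).
apply: derivableN.
rewrite (_ : (fun t' => _) = fun t' => \sum_j (G t')^`(d.+1) x 0 j *
    (\adj (\matrix_(k < d.+1, j < d.+1) (G t')^`(k) x 0 j)) j (Ordinal id)); last first.
  by apply/funext => t'; rewrite mxE.
apply: derivable_at_sum => j; apply: derivableM; first exact: dG.
apply: derivable_at_adj => k l.
rewrite (_ : (fun y => _) = fun y => (G y)^`(k) x 0 l); first exact: dG.
by apply/funext => y; rewrite mxE.
Qed.

Local Notation ut t := (fun (j : nat) (y : R) => (fun t' => u t' j y)^`() t).

Lemma lax_dt t i x : I t ->
  \sum_(j < d) ut t j x * dxn j (coordf (G t) i) x =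
  c * bracket d (u t) (coordf (G t) i) x.
Proof.
move=> It; have sg := (smooth_coordf (G t)).1 (sG It) i.
have sd : smth (u t d.-1) by apply: su => //; rewrite prednK.
pose Gt := partials [:: true] G t.
have GtE : coordf Gt i = fun y => c * Q2f d (u t) (coordf (G t) i) y.
  apply/funext => y; rewrite -(coordf_Q2op _ _ (sG It)) /coordf /Gt /= flow //.
  by rewrite mxE.
have GtE' j : coordf Gt j = fun y => c * Q2f d (u t) (coordf (G t) j) y.
  apply/funext => y; rewrite -(coordf_Q2op _ _ (sG It)) /coordf /Gt /= flow //.
  by rewrite mxE.
have sGt : smooth Gt.
  apply/smooth_coordf => j; rewrite GtE'; apply: smthZ; apply: smth_Q2f => //.
  exact: (smooth_coordf (G t)).1 (sG It) j.
have dE (k : nat) : is_derive t (1 : R) (fun t' => (G t')^`(k) x 0 i)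
    (c * dxn k (Q2f d (u t) (coordf (G t) i)) x).
  have := is_derive_dt oI sG2 k x i It.
  rewrite -/Gt -[Gt^`(k) x 0 i]/(coordf Gt^`(k) i x) coordf_derive1n // GtE dxnZ //.
  exact: smth_Q2f.
have du (j : 'I_d) : is_derive t (1 : R) (fun t' => u t' j x) (ut t j x).
  by rewrite derive1E; apply/derivableP; apply: derivable_lax.
pose S t' := (G t')^`(d.+1) x 0 i + \sum_(j < d) u t' j x * (G t')^`(j) x 0 i.
have S0 t' : I t' -> S t' = 0.
  move=> It'; rewrite -[RHS](LG i x It') /S /Lf (coordfG _ _ _ It').
  congr (_ + _); apply: eq_bigr => j _; congr (_ * _); exact: coordfG.
have dS : is_derive t (1 : R) S (c * dxn d.+1 (Q2f d (u t) (coordf (G t) i)) x +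
    \sum_(j < d) (ut t j x * (G t)^`(j) x 0 i +
      u t j x * (c * dxn j (Q2f d (u t) (coordf (G t) i)) x))).
  apply: is_deriveD.
  rewrite (_ : (fun t' => _) =
    \sum_(j < d) (fun t' => u t' j x * (G t')^`(j) x 0 i)); last first.
    by apply/funext => y; rewrite fct_sumE.
  apply: is_derive_sum => j.
  have H : is_derive t (1 : R) (fun t' => u t' j x * (G t')^`(j) x 0 i) _ :=
    is_deriveM (du j) (dE j).
  by apply: (is_derive_eq H); rewrite /GRing.scale /= addrC [X in X + _]mulrC.
have : S^`() t = 0.
  rewrite derive1E (@near_eq_derive _ _ _ S (fun=> 0)) ?derive_cst //.
  exact: filterS S0 (near_I It).
rewrite derive1E (@derive_val _ _ _ _ _ _ _ dS) big_split /= -dxnS => E.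
have -> : \sum_(j < d) ut t j x * dxn j (coordf (G t) i) x =
    \sum_(j < d) ut t j x * (G t)^`(j) x 0 i.
  by apply: eq_bigr => j _; rewrite coordfG.
(* L Gamma vanishes identically in x, so on Gamma the bracket reduces to - L Q_2 Gamma, the term
   produced by the time derivative of Gamma. *)
have Q0 : Q2f d (u t) (Lf d (u t) (coordf (G t) i)) x = 0.
  have -> : Lf d (u t) (coordf (G t) i) = fun=> 0 by apply/funext => y; exact: LG.
  by rewrite /Q2f dxn0 mulr0 addr0.
have E2 : \sum_(j < d) u t j x * (c * dxn j (Q2f d (u t) (coordf (G t) i)) x) =
    c * \sum_(j < d) u t j x * dxn j (Q2f d (u t) (coordf (G t) i)) x.
  by rewrite mulr_sumr; apply: eq_bigr => j _; rewrite mulrCA.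
rewrite /bracket Q0 sub0r /Lf; move: E; rewrite E2.
move: (dxn d.+1 _ x) (\sum_(j < d) ut t j x * _) (\sum_(j < d) u t j x * _).
move=> A S1 S2 E; transitivity (c * A + (S1 + c * S2) - c * (A + S2)).
  by ring.
by rewrite E sub0r mulrN.
Qed.

(* Subtracting a combination of the components of Gamma with the same d-jet at
   x reduces the identity to functions that are flat to order d at x. *)
Lemma lax_dt_all t (f : R -> R) x : I t -> smth f ->
  \sum_(j < d) ut t j x * dxn j f x = c * bracket d (u t) f x.
Proof.
move=> It sf; have suj j : (j < d)%N -> smth (u t j) by exact: su.
have sg i : smth (coordf (G t) i) by exact: (smooth_coordf (G t)).1 (sG It) i.
pose D (h : R -> R) := \sum_(j < d) ut t j x * dxn j h x - c * bracket d (u t) h x.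
have Dlin a h k : smth h -> smth k -> D (fun y => a * h y + k y) = a * D h + D k.
  move=> sh sk; rewrite /D bracket_lin // (eq_bigr (fun j : 'I_d =>
    a * (ut t j x * dxn j h x) + ut t j x * dxn j k x)).
    by rewrite big_split /= -mulr_sumr; ring.
  by move=> j _; rewrite dxnD ?dxnZ //; [ring|exact: smthZ].
suff : D f = 0 by move=> /eqP; rewrite subr_eq0 => /eqP.
have Wu : wmat (coordf (G t)) x \in unitmx by rewrite unitmxE WG // unitr1.
pose k := invmx (wmat (coordf (G t)) x) *m \col_(m < d.+1) dxn m f x.
have kE m : (m < d.+1)%N -> \sum_i k i 0 * dxn m (coordf (G t) i) x = dxn m f x.
  move=> md; have := congr1 (fun v : 'cV[R]_d.+1 => v (Ordinal md) 0)
    (mulKVmx Wu (\col_(m < d.+1) dxn m f x)).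
  rewrite -/k [LHS]mxE [RHS]mxE => <-.
  by apply: eq_bigr => i _; rewrite [wmat _ _ _ _]mxE mulrC.
have reduce (r : seq 'I_d.+1) (h : R -> R) : smth h ->
    D (fun y => \sum_(i <- r) - k i 0 * coordf (G t) i y + h y) = D h.
  move=> sh; elim: r => [|i r IH].
    by congr D; apply/funext => y; rewrite big_nil add0r.
  rewrite -[RHS]IH.
  have -> : (fun y => \sum_(i <- i :: r) - k i 0 * coordf (G t) i y + h y) =
      fun y => - k i 0 * coordf (G t) i y +
        (\sum_(i <- r) - k i 0 * coordf (G t) i y + h y).
    by apply/funext => y; rewrite big_cons addrA.
  have ss : smth (fun y => \sum_(i <- r) - k i 0 * coordf (G t) i y + h y).
    by apply: smthD => //; apply: smth_sum => j; apply: smthZ.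
  rewrite Dlin // {1}/D lax_dt // subrr mulr0 add0r //.
rewrite -(reduce (index_enum _) f sf).
set h := (fun y => _); have sh : smth h.
  by apply: smthD => //; apply: smth_sum => j; apply: smthZ.
have h0 m : (m <= d)%N -> dxn m h x = 0.
  move=> md; rewrite /h dxnD //; last by apply: smth_sum => j; apply: smthZ.
  rewrite dxn_sum; last by move=> j; apply: smthZ.
  rewrite -kE // -big_split big1 // => i _.
  by rewrite /= dxnZ // mulNr addNr.
rewrite /D (bracket_flat d0 suj sh h0) mulr0 subr0 big1 // => j _.
by rewrite h0 ?mulr0 // ltnW.
Qed.

(** In the time r = c t the derivative d/dr is c^(-1) d/dt, which absorbs the factor c. For c < 0,
    as for [kdv_coef], time is also reversed. *)
Lemma kdv_rescaled : c != 0 -> kdv d [set r | I (r / c)] (fun r => u (r / c)).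
Proof.
move=> c0 r /= Ir.
have dr i (x : R) : (i < d)%N ->
    is_derive r (1 : R) (fun r' => u (r' / c) i x) (ut (r / c) i x * c^-1).
  move=> id; apply: (@is_derive1_comp R (fun t => u t i x) (fun r' => r' / c)).
    by rewrite derive1E; apply/derivableP; apply: derivable_lax.
  have H : is_derive r (1 : R) (fun r' : R => r' / c) _ :=
    is_deriveM (is_derive_id r (1 : R)) (is_derive_cst (c^-1) r (1 : R)).
  by apply: (is_derive_eq H); rewrite /GRing.scale /= mulr0 add0r mulr1.
split=> [i x id|f sf x]; first exact: (@ex_derive _ _ _ _ _ _ _ (dr i x id)).
have {}sf : smth f by apply/smthP.
rewrite !LopE !Q2opE -/(bracket d (u (r / c)) f x).
apply: (mulfI c0); rewrite -(lax_dt_all x Ir sf) /diffop mulr_sumr.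
apply: eq_bigr => j _; rewrite -dxnE derive1E.
rewrite (@derive_val _ _ _ _ _ _ _ (dr j x (ltn_ord j))) /GRing.scale /=.
by field.
Qed.

End Kdv.

Theorem proposition3p25 (R : realType) (d s : nat)
    (hd : (2 <= d)%N) (hs : (1 <= s <= d.-1)%N) :
  let chi := shift_config (dual_dented R d s) (1 - d%:R - s%:R / d%:R) in
  centralized chi /\
  exists2 c : R, c != 0 &
    (forall (gam : R -> projpoint R d) (Gam : R -> 'rV[R]_d.+1)
        (u a2 : nat -> R -> R),
      curve_with_lift gam Gam -> lax_coefs Gam u ->
      has_expansion chi gam Gam (fun _ _ => 0) a2 ->
      forall f : R -> R^o, smooth f -> forall x,
        diffop d.+1 a2 f x = c * Q2op d u f x) /\
    (forall (I : set R) (gam : R -> R -> projpoint R d)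
        (Gam : R -> R -> 'rV[R]_d.+1) (u : R -> nat -> R -> R),
      open I -> continuous_limit chi I gam Gam u ->
      kdv d [set tau | I (tau / c)] (fun tau => u (tau / c))).
Proof.
(* The target [V] is general because the identity serves both for scalar test functions and for the
   vector-valued Gamma of the flow. *)
have G2E (gam : R -> projpoint R d) (Gam : R -> 'rV[R]_d.+1) (u a2 : nat -> R -> R) :
    curve_with_lift gam Gam -> lax_coefs Gam u ->
    has_expansion (shift_config (dual_dented R d s) (1 - d%:R - s%:R / d%:R))
      gam Gam (fun _ _ => 0) a2 ->
    forall (V : normedModType R) (f : R -> V) x,
      diffop d.+1 a2 f x = kdv_coef R d s *: Q2op d u f x.
  move=> hC hu ha V f x; have aE := expansion_unique hd hs hC ha.
  have [_ _ _ [sG _ WG]] := hC.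
  rewrite (diffop_coef02 hd) => [|i id i0 i2]; last first.
    by rewrite aE // /lim2 (negbTE i0) (negbTE i2).
  rewrite !aE // /lim2 /= /Q2op scalerDr addrC scalerA; congr (_ + _ *: _).
  (* With tau = - 2 u_(d-1), the coefficient - c tau / (d+1) becomes c times the potential of
     Q_2. *)
  rewrite (tau_lax x hd sG _ hu); last by move=> y; rewrite -wronskianE.
  by field; rewrite addrC natr1 pnatr_eq0.
split.
  move=> gam Gam hC; exists (lim2 s Gam); exact: has_expansion_lim2.
exists (kdv_coef R d s); first exact: kdv_coef_neq0.
split=> [gam Gam u a2 hC hu ha f _ x|I gam Gam u oI [sG2 hI]].
  by rewrite (G2E _ _ _ _ hC hu ha).
have d0 : (0 < d)%N by exact: ltnW.
have hL t : I t -> normalized_lift (fun x => line (gam t x)) (Gam t).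
  by move=> /hI[[]].
apply: (kdv_rescaled d0 oI sG2).
- by move=> t /hL[].
- by move=> t x /hL[sG _ WG]; rewrite -wronskianE.
- by move=> t /hI[].
- by move=> t x /hI[hC hu [a2 ha ->]]; rewrite (G2E _ _ _ _ hC hu ha).
- exact: kdv_coef_neq0.
Qed.
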